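(* Let $n\ge1$, $\sigma\in J_n^+$, $\Lambda$ a continuous positive function on $[0,\infty)$, $\underline\vartheta,\overline\vartheta>0$, and $V\ge0$ continuous with $V(x,t)\ge\underline\vartheta\Lambda(t)|x|^\sigma$ for $|x|\ge1,t>0$ and $V(x,t)\le\overline\vartheta\Lambda(t)|x|^\sigma$ for $x\in\mathbb{R}^n,t>0$. Let $0<p<\varepsilon_0\underline\vartheta/\overline\vartheta$ ($p<1$), with $\varepsilon_0>0$ any constant such that $\int_{\{|x-y|\ge1\}}B(y)|x-y|^{\sigma+d}dy\ge\varepsilon_0|x|^{\sigma+d}$ for all $x$ and all $d\in[0,\frac{\sigma p}{1-p}]$, and let $a\ge\frac{\sigma}{1-p}$. Assume moreover that there is a continuous function $\alpha>0$ with $\alpha(\tau)\to1$ as $\tau\to0$ and $$V(x,t+\tau)\ge\alpha(\tau)V(x,t)\qquad(x\in\mathbb{R}^n,\ t,\tau>0).$$ For $\kappa\ge0$ let $V^\kappa(x,t)=V(x,t+\kappa)$ and let $u_{*V^\kappa}$ be the maximal s-solution of $\partial_tu-\Delta\partial_tu=\Delta u+V^\kappa u^p$, $u(\cdot,0)=0$. Then $0\le u\in\mathcal{Z}_{\infty,a}$ is a nontrivial (not identically zero) s-solution of $\partial_tu-\Delta\partial_tu=\Delta u+Vu^p$, $u(\cdot,0)=0$, if and only if $u(x,t)=u_{*V^\kappa}(x,[t-\kappa]_+)$ for some $\kappa\ge0$.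
   Context: $J_n^+=\{0\}\cup[1,\infty)$ if $n=1$, $[0,\infty)$ if $n\ge2$; $[s]_+=\max\{s,0\}$. $B=\mathcal{F}^{-1}((1+|\xi|^2)^{-1})$, $\mathcal{B}\varphi=B*\varphi$. $BC_a$: continuous functions with $|\varphi(x)|\le C|x|^a$ for large $|x|$; $\mathcal{Z}_{\infty,a}=C([0,\infty);BC_a)$. For a potential $W$, an s-solution of the zero-data problem is $0\le u$ with $\mu=e^tu\in\mathcal{Z}_{\infty,a}$ and $\mu(t)=\int_0^t\mathcal{B}\mu\,d\tau+\int_0^te^{(1-p)\tau}\mathcal{B}[W\mu^p]\,d\tau$; a maximal s-solution dominates every s-solution pointwise. For $W=V^\kappa$ (which satisfies the same two-sided bounds with $\Lambda(\cdot+\kappa)$) it exists and is unique (a result of the same paper), and it is denoted $u_{*V^\kappa}$. *)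

(* Defs.v *)
From HB Require Import structures.
From mathcomp Require Import all_boot all_order all_algebra.
From mathcomp Require Import all_classical all_reals all_analysis.
Set Implicit Arguments. Unset Strict Implicit. Unset Printing Implicit Defensive.
Import Order.TTheory GRing.Theory Num.Theory.
Import numFieldNormedType.Exports.
Local Open Scope classical_set_scope.
Local Open Scope ring_scope.

Definition eunorm (R : realType) (n : nat) (x : n.-tuple R) : R :=
  Num.sqrt (\sum_(i < n) (tnth x i) ^+ 2).

Definition tsub (R : realType) (n : nat) (x y : n.-tuple R) : n.-tuple R :=
  mktuple (fun i => tnth x i - tnth y i).

Definition eudist (R : realType) (n : nat) (x y : n.-tuple R) : R :=
  eunorm (tsub x y).

(* Lebesgue integral over R^n of a (nonnegative, extended-real valued)
   function, as the iterated one-dimensional Lebesgue integral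
   (by Tonelli this is the n-dimensional Lebesgue integral for
   nonnegative measurable integrands; all integrands below are >= 0). *)
Fixpoint intRn (R : realType) (n : nat) : (n.-tuple R -> \bar R) -> \bar R :=
  match n return (n.-tuple R -> \bar R) -> \bar R with
  | 0 => fun f => f [tuple]
  | k.+1 => fun f =>
      (\int[@lebesgue_measure R]_t intRn (fun y : k.-tuple R => f (cons_tuple t y)))%E
  end.

(* Bessel kernel B = F^{-1}((1+|xi|^2)^{-1}) on R^n, via its standard
   subordination formula B(x) = int_0^oo (4 pi s)^{-n/2} e^{-s-|x|^2/(4s)} ds
   (extended-real valued: B(0) = +oo when n >= 2). *)
Definition Bker (R : realType) (n : nat) (x : n.-tuple R) : \bar R :=
  (\int[@lebesgue_measure R]_(s in `]0%R, +oo[)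
     ((4 * pi * s) `^ (- (n%:R) / 2) * expR (- s - (eunorm x) ^+ 2 / (4 * s)))%:E)%E.

Definition Bconv (R : realType) (n : nat) (phi : n.-tuple R -> R) (x : n.-tuple R)
  : \bar R :=
  intRn (fun y => (Bker (tsub x y) * (phi y)%:E)%E).

Definition BC (R : realType) (n : nat) (a : R) (phi : n.-tuple R -> R) : Prop :=
  (forall x (e : R), 0 < e -> exists2 d : R, 0 < d &
      forall y, eudist y x < d -> `|phi y - phi x| < e) /\
  (exists C R0 : R, forall x, R0 <= eunorm x -> `|phi x| <= C * (eunorm x) `^ a).

(* mu in Z_{oo,a} = C([0,oo); BC_a), BC_a normed by sup |phi(x)|/(1+|x|)^a *)
Definition Zinf (R : realType) (n : nat) (a : R) (mu : n.-tuple R -> R -> R) : Prop :=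
  (forall t, 0 <= t -> BC a (fun x => mu x t)) /\
  (forall t0, 0 <= t0 -> forall e : R, 0 < e -> exists2 d : R, 0 < d &
      forall t, 0 <= t -> `|t - t0| < d ->
        forall x, `|mu x t - mu x t0| <= e * (1 + eunorm x) `^ a).

(* u is an s-solution of  u_t - Lap u_t = Lap u + W u^p,  u(.,0) = 0 *)
Definition is_ssol (R : realType) (n : nat) (p a : R) (W : n.-tuple R -> R -> R)
  (u : n.-tuple R -> R -> R) : Prop :=
  let mu := fun x t => expR t * u x t in
  (forall x t, 0 <= t -> 0 <= u x t) /\
  Zinf a mu /\
  (forall x t, 0 <= t ->
     ((mu x t)%:E =
      (\int[@lebesgue_measure R]_(tau in `[0%R, t]) Bconv (fun y => mu y tau) x)
      + (\int[@lebesgue_measure R]_(tau in `[0%R, t])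
           ((expR ((1 - p) * tau))%:E
            * Bconv (fun y => (W y tau * (mu y tau) `^ p)%R) x)))%E).

Definition is_max_ssol (R : realType) (n : nat) (p a : R) (W : n.-tuple R -> R -> R)
  (w : n.-tuple R -> R -> R) : Prop :=
  is_ssol p a W w /\
  (forall v, is_ssol p a W v -> forall x t, 0 <= t -> v x t <= w x t).

Definition Jplus (R : realType) (n : nat) (s : R) : Prop :=
  if n == 1%N then s = 0 \/ 1 <= s else 0 <= s.

(* Main.v *)
Require Import Defs.
From HB Require Import structures.
From mathcomp Require Import all_boot all_order all_algebra.
From mathcomp Require Import all_classical all_reals all_analysis.
From mathcomp Require Import measurable_realfun ring lra.
Import Order.TTheory GRing.Theory Num.Theory.
Import numFieldNormedType.Exports.
Local Open Scope classical_set_scope.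
Local Open Scope ring_scope.
Set Implicit Arguments.
Unset Strict Implicit.
Unset Printing Implicit Defensive.

(* With mu = e^t u, an s-solution is a fixed point of
   mu = int_0^t B * (mu + Psi mu^p), where Psi = e^((1-p)t) W and W is a time
   shift of V. Put m = 1/(1-p) and rho = sigma m. Let mu be a solution which
   does not vanish for small times. Since p < 1, iterating the equation from
   the crude bound mu >= c e^(-eta |x|) gives the sharp bound
   mu >= (r t)^m |x|^rho near t = 0, with r = thl eps0 (1-p) l and l about
   lam(0), so that p Psi mu^(p-1) <= beta / t with beta < m: this is where
   p < eps0 thl / thu enters. Every solution is O(t^m (1 + |x|)^rho) locally
   in time, so for another solution nu the least D with
   nu - mu <= D t^m e^(L t) (M + |x|_1)^rho is finite; the equation replaces D
   by a smaller multiple of itself when L and M are large, hence nu <= mu, and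
   mu is maximal. A nontrivial solution u vanishes exactly up to
   kappa = inf {t | u(., t) <> 0} because mu is nondecreasing in t, and
   u(., . + kappa) is a solution for the shifted potential which does not
   vanish for small times, hence the maximal one. Conversely the maximal
   solution is nontrivial: the monotone iteration started at the subsolution
   (r min(t, T0))^m |x|^rho stays below a supersolution and converges. *)

(** Solutions are not unique because u^p is not Lipschitz at 0: the slope p Psi mu^(p-1) is infinite
    where mu vanishes and Psi does not, in particular at t = 0. The exponents m and rho are forced
    by m p + 1 = m and sigma + rho p = rho, so that t^m |x|^rho reproduces itself under the equation
    up to constants. Inserting the sharp lower bound makes |x|^sigma cancel and leaves the slope p
    thu lam(t) / (r t), close to th m / t with th = p thu / (thl eps0) < 1. The weight t^m tolerates
    exactly such a singularity, since int_0^t (beta / s) s^m ds = (beta / m) t^m. The linear term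
    and the slope away from t = 0 cost a factor 1 / L, and a large M brings the loss in convolving
    the weight close to 1. The kernel is infinite at the origin when n >= 2, so limits are taken
    through Fatou's lemma, and continuity in x comes from lower semicontinuity of an integral and of
    its complement. *)

(** * One-dimensional integrals: monotonicity, translation and reflection *)

Section Integral.
Context {R : realType}.
Local Notation mu := (@lebesgue_measure R).
Local Open Scope ereal_scope.

(* No measurability is needed: the integral of a nonnegative function is
   defined as a supremum over the simple functions below it. *)
Import HBNNSimple.

Lemma le_integral_ge0 d (T : measurableType d) (nu : {measure set T -> \bar R})
    (D : set T) (f g : T -> \bar R) :
  (forall x, D x -> 0 <= f x) -> (forall x, D x -> f x <= g x) ->
  \int[nu]_(x in D) f x <= \int[nu]_(x in D) g x.
Proof.
move=> f0 fg; rewrite !ge0_integralE//; last first.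
  by move=> x Dx; rewrite (le_trans (f0 _ Dx)) ?fg.
apply: ereal_sup_le => _ [h hf <-].
exists h => // x; by apply: (le_trans (hf x)); apply: lee_restrict.
Qed.

Lemma integral_le_subset (D E : set R) (f : R -> \bar R) :
  (forall x, E x -> 0 <= f x) -> D `<=` E ->
  \int[mu]_(x in D) f x <= \int[mu]_(x in E) f x.
Proof.
move=> f0 DE; rewrite [leLHS]integral_mkcond [leRHS]integral_mkcond.
apply: le_integral_ge0 => x _; rewrite /patch.
  by case: ifPn => // xD; apply/f0/DE; rewrite inE in xD.
case: ifPn => [xD|_]; last by case: ifPn => // xE; apply: f0; rewrite inE in xE.
by rewrite mem_set//; apply: DE; rewrite inE in xD.
Qed.

(** The image of Lebesgue measure under x -> c + x or x -> c - x has the right value on half-open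
    intervals, which determines it. The boolean selects between translation and reflection; under
    the latter the closed end changes sides. *)
Lemma integral_affine (f : R -> \bar R) (c : R) (b : bool) :
  measurable_fun [set: R] f -> (forall x, 0 <= f x) ->
  \int[mu]_x f (c + (-1) ^+ b * x)%R = \int[mu]_x f x.
Proof.
move=> mf f0; pose phi (x : measurableTypeR R) : measurableTypeR R := (c + (-1) ^+ b * x)%R.
have mphi : measurable_fun setT phi.
  by apply: measurable_funD => //; exact: measurable_funM.
have E A : measurable A -> pushforward mu phi A = mu A.
  move=> mA; apply/esym/lebesgue_measure_unique => //= _ [[x y]] _ <-.
  rewrite /pushforward.
  have -> : phi @^-1` `]x, y] =
      if b then `[(c - y)%R, (c - x)%R[%classic else `](x - c)%R, (y - c)%R]%classic.
    apply/seteqP; split => z; rewrite /phi/=; case: b {mphi phi} => /=;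
    rewrite !in_itv/= ?expr1 ?expr0 ?mul1r ?mulN1r => /andP[? ?];
    apply/andP; split; lra.
  case: b {mphi phi}; rewrite !lebesgue_measure_itv/= !lte_fin.
    rewrite ltrD2l ltrN2; case: ifPn => // _.
    by rewrite -!EFinB; congr EFin; lra.
  rewrite ltrD2r; case: ifPn => // _; rewrite -!EFinB; congr EFin; lra.
transitivity (\int[pushforward mu phi]_x f x).
  by rewrite (ge0_integral_pushforward mphi)//.
by apply: eq_measure_integral => //= A mA _; exact: E.
Qed.

Lemma integral_shift (f : R -> \bar R) (c : R) :
  measurable_fun [set: R] f -> (forall x, 0 <= f x) ->
  \int[mu]_x f (c + x)%R = \int[mu]_x f x.
Proof.
move=> mf f0; rewrite -(integral_affine c false mf f0).
by apply: eq_integral => x _; rewrite expr0 mul1r.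
Qed.

End Integral.

(** * The iterated integral: measurability, linearity, Fatou, Tonelli, reflection *)

Section IntRn.
Context {R : realType}.
Local Notation mu := (@lebesgue_measure R).
Local Open Scope ereal_scope.

Lemma intRn_ge0 n (f : n.-tuple R -> \bar R) :
  (forall y, 0 <= f y) -> 0 <= intRn f.
Proof. by elim: n f => [|n IH] f f0 /=; [|apply: integral_ge0 => t _; exact: IH]. Qed.

Lemma le_intRn n (f g : n.-tuple R -> \bar R) :
  (forall y, 0 <= f y) -> (forall y, f y <= g y) -> intRn f <= intRn g.
Proof.
elim: n f g => [|n IH] f g f0 fg //=.
by apply: le_integral_ge0 => t _; [exact: intRn_ge0|exact: IH].
Qed.

Lemma eq_intRn n (f g : n.-tuple R -> \bar R) : f =1 g -> intRn f = intRn g.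
Proof. by move=> /funext ->. Qed.

Lemma measurable_cons_tuple d (X : measurableType d) n :
  measurable_fun [set: (X * R) * n.-tuple R]
    (fun z => (z.1.1, cons_tuple z.1.2 z.2)).
Proof.
apply: measurable_fun_pair => /=.
  exact: (measurableT_comp measurable_fst measurable_fst).
apply: measurable_cons => //.
exact: (measurableT_comp measurable_snd measurable_fst).
Qed.

Lemma measurable_integralR d (X : measurableType d) (f : X -> R -> \bar R) :
  measurable_fun [set: X * R] (fun z => f z.1 z.2) ->
  (forall x t, 0 <= f x t) ->
  measurable_fun [set: X] (fun x => \int[mu]_t f x t).
Proof.
move=> mf f0.
pose F (z : X * measurableTypeR R) := f z.1 z.2.
have mF : measurable_fun setT F by exact: mf.
exact: (@measurable_fun_fubini_tonelli_F _ _ X (measurableTypeR R) R mu F mF (fun z => f0 z.1 z.2)).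
Qed.

(** The parameter space is arbitrary because the induction moves the first coordinate into it: the
    inner integral is a measurable function on [X * R]. *)
Lemma measurable_intRn d (X : measurableType d) n (f : X -> n.-tuple R -> \bar R) :
  measurable_fun [set: X * n.-tuple R] (fun z => f z.1 z.2) ->
  (forall x y, 0 <= f x y) ->
  measurable_fun [set: X] (fun x => intRn (f x)).
Proof.
elim: n d X f => [|n IH] d X f mf f0 /=.
  by apply: (measurableT_comp mf (g := fun x => (x, [tuple]))); exact: measurable_fun_pair.
pose F (z : X * R) := intRn (fun y => f z.1 (cons_tuple z.2 y)).
have mF : measurable_fun [set: X * R] F.
  apply: IH => //.
  exact: (measurableT_comp mf (@measurable_cons_tuple d X n)).
by apply: measurable_integralR => // x t; exact: intRn_ge0.
Qed.

Lemma measurable_intRn_cons n (f : n.+1.-tuple R -> \bar R) :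
  measurable_fun setT f -> (forall y, 0 <= f y) ->
  measurable_fun [set: R] (fun t => intRn (fun y => f (cons_tuple t y))).
Proof.
move=> mf f0; apply: measurable_intRn => //.
apply: (measurableT_comp mf) => /=.
exact: measurable_cons.
Qed.

Lemma measurable_cons1 n (f : n.+1.-tuple R -> \bar R) (t : R) :
  measurable_fun setT f -> measurable_fun setT (fun y => f (cons_tuple t y)).
Proof. by move=> mf; apply: (measurableT_comp mf); exact: measurable_cons. Qed.

Lemma intRnD n (f g : n.-tuple R -> \bar R) :
  measurable_fun setT f -> measurable_fun setT g ->
  (forall y, 0 <= f y) -> (forall y, 0 <= g y) ->
  intRn (fun y => f y + g y) = intRn f + intRn g.
Proof.
elim: n f g => [|n IH] f g mf mg f0 g0 //=.
rewrite -ge0_integralD//; first last.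
- exact: measurable_intRn_cons.
- by move=> t _; exact: intRn_ge0.
- exact: measurable_intRn_cons.
- by move=> t _; exact: intRn_ge0.
apply: eq_integral => t _; rewrite IH//; exact: measurable_cons1.
Qed.

Lemma intRnZ n (k : R) (f : n.-tuple R -> \bar R) : (0 <= k)%R ->
  measurable_fun setT f -> (forall y, 0 <= f y) ->
  intRn (fun y => k%:E * f y) = k%:E * intRn f.
Proof.
move=> k0; elim: n f => [|n IH] f mf f0 //=.
rewrite -ge0_integralZl_EFin//; first last.
- exact: measurable_intRn_cons.
- by move=> t _; exact: intRn_ge0.
apply: eq_integral => t _; rewrite IH//; exact: measurable_cons1.
Qed.

Lemma intRn0 n : intRn (fun _ : n.-tuple R => 0) = 0.
Proof.
elim: n => //= n IH; under eq_integral do rewrite IH; exact: integral0.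
Qed.

Lemma fatou_intRn n (f : nat -> n.-tuple R -> \bar R) :
  (forall k, measurable_fun setT (f k)) -> (forall k y, 0 <= f k y) ->
  intRn (fun y => limn_einf (f ^~ y)) <= limn_einf (fun k => intRn (f k)).
Proof.
have l0 (T : Type) (h : nat -> T -> \bar R) y : (forall k y, 0 <= h k y) -> 0 <= limn_einf (h ^~ y).
  move=> h0; rewrite limn_einf_lim; apply: lime_ge; first exact: is_cvg_einfs.
  by apply: nearW => k; apply: le_ereal_inf_tmp => _ [j _ <-].
elim: n f => [|n IH] f mf f0 //=.
apply: (@le_trans _ _ (\int[mu]_t limn_einf (fun k => intRn (fun y => f k (cons_tuple t y))))).
  apply: le_integral_ge0 => t _; first by apply: intRn_ge0 => y; exact: l0.
  by apply: IH => // k; exact: measurable_cons1.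
apply: fatou => // [k|k t _]; first exact: measurable_intRn_cons.
exact: intRn_ge0.
Qed.

Lemma tsub_cons n (s t : R) (x y : n.-tuple R) :
  tsub (cons_tuple s x) (cons_tuple t y) = cons_tuple (s - t)%R (tsub x y).
Proof.
apply: eq_from_tnth => i; rewrite /tsub !tnth_mktuple.
case: (unliftP ord0 i) => [j|] ->; last by rewrite !tnth0.
by rewrite !tnthS tnth_mktuple.
Qed.

(** Each coordinate is reflected separately. This symmetry lets a convolution be written with the
    kernel at y and the function at x - y. *)
Lemma intRn_reflect n (f : n.-tuple R -> \bar R) (x : n.-tuple R) :
  measurable_fun setT f -> (forall y, 0 <= f y) ->
  intRn (fun y => f (tsub x y)) = intRn f.
Proof.
elim: n f x => [|n IH] f x mf f0 /=; first by rewrite [tsub _ _]tuple0.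
have [s [z ->]] : exists s z, x = cons_tuple s z.
  by exists (thead x), [tuple of behead x]; apply: val_inj => /=; rewrite {1}(tuple_eta x).
under eq_integral => t _.
  under eq_intRn do rewrite tsub_cons.
  rewrite (IH (fun y => f (cons_tuple (s - t)%R y)) z (measurable_cons1 _ mf))//.
  over.
rewrite -[RHS](integral_affine s true (measurable_intRn_cons mf f0))//; last first.
  by move=> t; exact: intRn_ge0.
by apply: eq_integral => t _; rewrite expr1 mulN1r.
Qed.

Lemma intRn_tonelli n (D : set R) (f : R -> n.-tuple R -> \bar R) :
  measurable D ->
  measurable_fun [set: R * n.-tuple R] (fun z => f z.1 z.2) ->
  (forall s y, 0 <= f s y) ->
  intRn (fun y => \int[mu]_(s in D) f s y) = \int[mu]_(s in D) intRn (f s).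
Proof.
move=> mD mf f0.
(* Extending [f] by 0 off [D] turns the outer integral into one over the whole line, so that the
   induction exchanges two full integrals. *)
pose g s y := if s \in D then f s y else 0.
have g0 s y : 0 <= g s y by rewrite /g; case: ifP.
have mg : measurable_fun [set: R * n.-tuple R] (fun z => g z.1 z.2).
  apply: measurable_fun_ifT => //=.
  apply: (measurableT_comp _ (measurable_fst)) => /=.
  by apply: (measurable_fun_bool true); rewrite setTI preimage_mem_true.
transitivity (intRn (fun y => \int[mu]_s g s y)).
  by apply: eq_intRn => y; rewrite integral_mkcond; apply: eq_integral.
transitivity (\int[mu]_s intRn (g s)); last first.
  rewrite [RHS]integral_mkcond; apply: eq_integral => s _.
  rewrite /patch /g; case: ifPn => // _; exact: intRn0.
move: {f mf f0} g g0 mg; elim: n => [|n IH] g g0 mg //=.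
pose G t s := intRn (fun y => g s (cons_tuple t y)).
have mh : measurable_fun [set: (R * R) * n.-tuple R]
    (fun z => g z.1.1 (cons_tuple z.1.2 z.2)).
  exact: (measurableT_comp mg (@measurable_cons_tuple _ R n)).
transitivity (\int[mu]_t \int[mu]_s G t s).
  apply: eq_integral => t _; rewrite IH//.
  apply: (measurableT_comp mg (g := fun z : R * n.-tuple R => (z.1, cons_tuple (t : R) z.2))) => /=.
  apply: measurable_fun_pair => //.
  exact: measurable_cons.
apply: (@fubini_tonelli _ _ (measurableTypeR R) (measurableTypeR R) R mu mu
  (fun z : R * R => G z.1 z.2)).
- pose H (z : R * R) := intRn (fun y => g z.1 (cons_tuple z.2 y)).
  have mH : measurable_fun setT H by apply: measurable_intRn => // z; exact: intRn_ge0.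
  apply: (measurableT_comp mH (g := fun z : R * R => (z.2, z.1))).
  exact: measurable_fun_pair.
- by move=> z; exact: intRn_ge0.
Qed.

Lemma intRn_prod n (g : R -> R) (c : R) : measurable_fun setT g ->
  (forall t, (0 <= g t)%R) -> \int[mu]_t (g t)%:E = c%:E ->
  intRn (fun y : n.-tuple R => (\prod_(i < n) g (tnth y i))%:E) = (c ^+ n)%:E.
Proof.
move=> mg g0 gc; elim: n => [|n IH] /=; first by rewrite big_ord0 expr0.
have mp : measurable_fun setT (fun y : n.-tuple R => (\prod_(i < n) g (tnth y i))%:E).
  apply/measurable_EFinP/measurable_prod => i _.
  exact: (measurableT_comp mg (measurable_tnth _)).
under eq_integral => t _.
  under eq_intRn => y.
    rewrite big_ord_recl tnth0; under eq_bigr do rewrite tnthS.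
    rewrite EFinM; over.
  rewrite intRnZ// ?IH//; last by move=> y; rewrite lee_fin prodr_ge0.
  rewrite muleC; over.
rewrite ge0_integralZl_EFin//.
- by rewrite gc -EFinM exprS mulrC.
- by move=> t _; rewrite lee_fin.
- exact/measurable_EFinP.
- rewrite exprn_ge0// -lee_fin -gc; apply: integral_ge0 => t _; by rewrite lee_fin.
Qed.

(** Keeping only a box needs no measurability of [f]; this is how pointwise lower bounds on the
    kernel become lower bounds on convolutions. *)
Lemma intRn_box_ge n (f : n.-tuple R -> \bar R) (b : 'I_n -> R) (h c : R) :
  (0 <= c)%R -> (0 <= h)%R ->
  (forall y, 0 <= f y) ->
  (forall y, (forall i, (b i <= tnth y i <= b i + h)%R) -> c%:E <= f y) ->
  (c * h ^+ n)%:E <= intRn f.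
Proof.
move=> c0 h0; elim: n f b => [|n IH] f b f0 fb /=.
  by rewrite expr0 mulr1 fb// => -[].
pose b' (i : 'I_n) := b (lift ord0 i).
apply: (@le_trans _ _ (\int[mu]_(t in `[b ord0, (b ord0 + h)%R]) (c * h ^+ n)%:E)).
  rewrite integral_cst//= lebesgue_measure_itv/= lte_fin.
  case: ifPn => [_|]; first by rewrite -EFinB -EFinM exprSr mulrA addrAC subrr add0r.
  rewrite -leNgt gerDl => h1.
  by have -> : h = 0%R by [apply: le_anti; rewrite h0 h1]; rewrite exprS mul0r mulr0 mule0.
apply: (@le_trans _ _ (\int[mu]_(t in `[b ord0, (b ord0 + h)%R]) intRn (fun y => f (cons_tuple t y)))).
  apply: le_integral_ge0 => t /=; first by move=> _; rewrite lee_fin mulr_ge0// exprn_ge0.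
  rewrite in_itv/= => tb; apply: (IH _ b') => // y yb; apply: fb => i.
  case: (unliftP ord0 i) => [j|] ->; last by rewrite tnth0.
  by rewrite tnthS; exact: yb.
by apply: integral_le_subset => // t _; exact: intRn_ge0.
Qed.

End IntRn.

(** * Norms and measurability on R^n *)

Section Tuples.
Context {R : realType} {n : nat}.
Implicit Types x y z : n.-tuple R.

(** The sum norm is used next to the Euclidean one because e^(c l1) is a product over the
    coordinates, which lets Gaussian integrals factor. *)
Definition l1 x : R := \sum_(i < n) `|tnth x i|.

Lemma l1_ge0 x : 0 <= l1 x.
Proof. exact: sumr_ge0. Qed.

Lemma eunorm_ge0 x : 0 <= eunorm x.
Proof. exact: sqrtr_ge0. Qed.

Lemma tnth_le_eunorm x i : `|tnth x i| <= eunorm x.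
Proof.
rewrite -sqrtr_sqr ler_wsqrtr// (bigD1 i)//= lerDl.
by apply: sumr_ge0 => j _; exact: sqr_ge0.
Qed.

Lemma eunorm_le_l1 x : eunorm x <= l1 x.
Proof.
rewrite -(ger0_norm (l1_ge0 x)) -sqrtr_sqr ler_wsqrtr// expr2 {1}/l1 mulr_suml.
apply: ler_sum => i _; rewrite -real_normK ?num_real// expr2 ler_wpM2l//.
by rewrite /l1 (bigD1 i)//= lerDl sumr_ge0.
Qed.

Lemma l1_le_eunorm x : l1 x <= n%:R * eunorm x.
Proof.
apply: (@le_trans _ _ (\sum_(i < n) eunorm x)).
  by apply: ler_sum => i _; exact: tnth_le_eunorm.
by rewrite sumr_const card_ord mulr_natl.
Qed.

Lemma l1_tsub x y : l1 (tsub x y) <= l1 x + l1 y.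
Proof.
rewrite /l1 -big_split/=; apply: ler_sum => i _.
by rewrite tnth_mktuple ler_normB.
Qed.

Lemma tsubK x y : tsub x (tsub x y) = y.
Proof.
by apply: eq_from_tnth => i; rewrite !tnth_mktuple opprB addrC subrK.
Qed.

Lemma eudist_ge0 x y : 0 <= eudist x y.
Proof. exact: eunorm_ge0. Qed.

Lemma measurable_l1 : measurable_fun setT (@l1).
Proof.
apply: measurable_sum => i; apply: measurableT_comp => //.
exact: measurable_tnth.
Qed.

Lemma measurable_eunorm : measurable_fun setT (@eunorm R n).
Proof.
apply: (measurableT_comp (f := @Num.sqrt R)).
  exact: continuous_measurable_fun (@sqrt_continuous R).
apply: measurable_sum => i; apply: measurable_funX; exact: measurable_tnth.
Qed.

Lemma measurable_tsub :
  measurable_fun [set: n.-tuple R * n.-tuple R] (fun w => tsub w.1 w.2).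
Proof.
apply/measurable_fun_tnthP => i.
rewrite (_ : _ \o _ = fun w : n.-tuple R * n.-tuple R => tnth w.1 i - tnth w.2 i).
  apply: measurable_funB.
    exact: (measurableT_comp (measurable_tnth i) measurable_fst).
  exact: (measurableT_comp (measurable_tnth i) measurable_snd).
by apply/funext => w /=; rewrite tnth_mktuple.
Qed.

(* Open sets are countable unions of rational boxes. *)
Lemma lsc_measurable (f : n.-tuple R -> R) :
  (forall x c, c < f x -> exists2 d : R, 0 < d & forall y, eudist y x < d -> c < f y) ->
  measurable_fun setT f.
Proof.
move=> fl; apply: (measurability _ (RGenOInfty.measurableE R)) => // _ [_ [c ->] <-].
rewrite setTI.
pose box (u : n.-tuple rat * nat) : set (n.-tuple R) :=
  [set y | forall i, `|tnth y i - ratr (tnth u.1 i)| < u.2.+1%:R^-1].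
pose F u := if `[< box u `<=` [set y | c < f y] >] then box u else set0.
have -> : f @^-1` `]c, +oo[ = \bigcup_u F u.
  apply/seteqP; split => x /=; rewrite in_itv/= andbT; last first.
    by move=> [u _]; rewrite /F; case: asboolP => // sub /sub.
  move=> /fl[d d0 fd].
  (* Two points of a box differ by less than 2 / (k + 1) in each coordinate, so this [k] keeps a box
     containing x inside the ball of radius [d]. *)
  have [k kd] : exists k : nat, n.+1%:R * (k.+1%:R^-1 *+ 2) < d.
    have [k /= hk] := @ltr_add_invr R 0 (d / (n.+1%:R * 2)) ltac:(rewrite divr_gt0//).
    exists k; move: hk; rewrite add0r ltr_pdivlMr// => hk.
    rewrite -mulr_natr; apply: le_lt_trans hk; rewrite le_eqVlt; apply/orP; left; apply/eqP; ring.
  have k0 : 0 < k.+1%:R^-1 :> R by rewrite invr_gt0.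
  have qx i : exists q : rat, `|tnth x i - ratr q| < k.+1%:R^-1.
    set e := k.+1%:R^-1 in k0 *.
    have /rat_in_itvoo[q] : tnth x i - e < tnth x i + e by lra.
    rewrite in_itv/= => /andP[q1 q2]; exists q.
    by rewrite ltr_norml; apply/andP; split; lra.
  have [q qP] := choice qx.
  exists (mktuple q, k) => //; rewrite /F; case: asboolP => [_|[]].
    by move=> i /=; rewrite tnth_mktuple.
  move=> y yb /=; apply: fd; apply: le_lt_trans kd.
  rewrite /eudist; apply: (le_trans (eunorm_le_l1 _)).
  apply: (@le_trans _ _ (\sum_(i < n) (k.+1%:R^-1 *+ 2))); last first.
    rewrite sumr_const card_ord -[leLHS]mulr_natl ler_wpM2r ?ler_nat// mulrn_wge0//.
  apply: ler_sum => i _; rewrite tnth_mktuple.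
  have := yb i; have := qP i; rewrite /= tnth_mktuple => h1 h2.
  rewrite (_ : _ - _ = (tnth y i - ratr (q i)) - (tnth x i - ratr (q i))); last by ring.
  by rewrite (le_trans (ler_normB _ _))// mulr2n lerD// ltW.
apply: countable_bigcupT_measurable; first exact: countableP.
move=> u; rewrite /F; case: asboolP => // _.
rewrite (_ : box u = \bigcap_(i in setT) [set y | `|tnth y i - ratr (tnth u.1 i)| < u.2.+1%:R^-1]); last first.
  by apply/seteqP; split => y yb i; [move=> _; exact: yb|exact: (yb i I)].
apply: fin_bigcap_measurable => // i _.
rewrite -[X in measurable X]setTI.
have mb : measurable_fun setT (fun y : n.-tuple R => `|tnth y i - ratr (tnth u.1 i)|).
  apply: (measurableT_comp (f := @Num.norm R R)) => //.
  by apply: measurable_funB => //; exact: measurable_tnth.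
have := mb measurableT `]-oo, u.2.+1%:R^-1[%classic.
rewrite (_ : _ @^-1` `]-oo, _[ = [set y | `|tnth y i - ratr (tnth u.1 i)| < u.2.+1%:R^-1]).
  by apply.
by apply/seteqP; split => y /=; rewrite in_itv.
Qed.

End Tuples.

(** * Joint measurability in time and space *)

Section TuplesCons.
Context {R : realType}.

Lemma eunorm_cons n (h : R) (t : n.-tuple R) :
  eunorm (cons_tuple h t) = Num.sqrt (h ^+ 2 + eunorm t ^+ 2).
Proof.
rewrite /eunorm sqr_sqrtr; last by apply: sumr_ge0 => i _; exact: sqr_ge0.
rewrite big_ord_recl tnth0; congr (Num.sqrt (_ + _)).
by apply: eq_bigr => i _; rewrite tnthS.
Qed.

(** Time and space are packed into one tuple of length n + 1, where [lsc_measurable] applies. Taking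
    the positive part of the time extends a function controlled only for t >= 0 continuously to all
    times. *)
Lemma measurable_joint_continuous n (f : n.-tuple R -> R -> R) :
  (forall x t, 0 <= t -> forall e : R, 0 < e -> exists2 d : R, 0 < d &
     forall y s, 0 <= s -> eudist y x < d -> `|s - t| < d -> `|f y s - f x t| < e) ->
  measurable_fun [set: R * n.-tuple R] (fun z => f z.2 (Num.max z.1 0)).
Proof.
move=> fc; pose g (w : n.+1.-tuple R) := f [tuple of behead w] (Num.max (thead w) 0).
suff mg : measurable_fun setT g.
  rewrite (_ : (fun _ => _) = g \o (fun z : R * n.-tuple R => cons_tuple z.1 z.2)).
    by apply: (measurableT_comp mg); exact: measurable_cons.
  apply/funext => -[h t]; rewrite /g /= theadE.
  by congr (f _ _); apply: val_inj.
apply: lsc_measurable => w c cw.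
have m0 (v : n.+1.-tuple R) : 0 <= Num.max (thead v) 0 by rewrite le_max lexx orbT.
have [d d0 fd] := fc [tuple of behead w] _ (m0 w) (g w - c) ltac:(lra).
exists d => // v vd.
have [vd1 vd2] : `|thead v - thead w| < d /\
    eudist [tuple of behead v] [tuple of behead w] < d.
  move: vd; rewrite /eudist [in X in eunorm (tsub X _)](tuple_eta v) [in X in eunorm (tsub _ X)](tuple_eta w).
  rewrite (_ : tsub _ _ = cons_tuple (thead v - thead w) (tsub [tuple of behead v] [tuple of behead w])); last first.
    exact: tsub_cons.
  rewrite eunorm_cons => vd; split; apply: le_lt_trans vd.
    by rewrite -sqrtr_sqr ler_wsqrtr// lerDl sqr_ge0.
  rewrite -{1}(ger0_norm (eunorm_ge0 _)) -sqrtr_sqr ler_wsqrtr// lerDr sqr_ge0//.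
have := fd [tuple of behead v] _ (m0 v) vd2.
have -> : `|Num.max (thead v) 0 - Num.max (thead w) 0| < d.
  apply: le_lt_trans vd1; rewrite /Num.max; case: ifPn; case: ifPn;
  rewrite ?ltNge ?negbK => h1 h2; rewrite ?subrr ?normr0// ?ler_norml; try (apply/andP; split);
  have := ler_norm (thead v - thead w); have := ler_norm (- (thead v - thead w)); rewrite normrN; lra.
rewrite -/(g v) -/(g w) => /(_ isT); rewrite ltr_norml => /andP[]; lra.
Qed.

End TuplesCons.

(** * Gaussian integrals in one variable *)

Section HeatKernel.
Context {R : realType}.
Local Notation mu := (@lebesgue_measure R).

Definition heat1 (s t : R) : R := (4 * pi * s) `^ (- 2^-1) * expR (- (t ^+ 2 / (4 * s))).

Lemma heat1_ge0 s t : 0 <= heat1 s t.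
Proof. by rewrite mulr_ge0 ?powR_ge0 ?expR_ge0. Qed.

(** Completing the square: l t - t^2 / (4s) = l^2 s - (t - 2sl)^2 / (4s), and the last term belongs
    to the normal density of mean 2sl and variance 2s. *)
Lemma heat1_tilt (s l t : R) : 0 < s ->
  heat1 s t * expR (l * t) = expR (l ^+ 2 * s) * normal_pdf (2 * s * l) (Num.sqrt (2 * s)) t.
Proof.
move=> s0; have s20 : Num.sqrt (2 * s) != 0 by rewrite gt_eqF// sqrtr_gt0 mulr_gt0.
rewrite normal_pdfE// /normal_peak /normal_fun /heat1 sqr_sqrtr ?mulr_ge0 ?ltW//.
have -> : (4 * pi * s) `^ (- 2^-1) = (Num.sqrt (2 * s * pi *+ 2))^-1 :> R.
  rewrite powRN powR12_sqrt; last by rewrite !mulr_ge0 ?pi_ge0// ltW.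
  by congr (Num.sqrt _)^-1; rewrite -mulr_natr; ring.
rewrite mulrCA -mulrA -!expRD; congr (_ * expR _).
rewrite -mulr_natr; field.
by rewrite gt_eqF.
Qed.

Lemma integral_heat1_tilt (s l : R) : 0 < s ->
  (\int[mu]_t (heat1 s t * expR (l * t))%:E = (expR (l ^+ 2 * s))%:E)%E.
Proof.
move=> s0; under eq_integral do rewrite heat1_tilt// EFinM.
rewrite ge0_integralZl_EFin ?expR_ge0//.
- by rewrite integral_normal_pdf mule1.
- by move=> t _; rewrite lee_fin normal_pdf_ge0.
- by apply/measurable_EFinP; exact: measurable_normal_pdf.
Qed.

Lemma measurable_heat1 s : measurable_fun setT (heat1 s).
Proof.
apply: measurable_funM => //; apply: measurableT_comp => //.
by apply: measurableT_comp => //; exact: measurable_funM.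
Qed.

Lemma integral_heat1 (s : R) : 0 < s -> (\int[mu]_t (heat1 s t)%:E = 1%:E)%E.
Proof.
move=> s0; have := integral_heat1_tilt 0 s0.
rewrite expr0n mul0r expR0 => <-; apply: eq_integral => t _.
by rewrite mul0r expR0 mulr1.
Qed.

(** The bound is e^(l|t|) <= e^(lt) + e^(-lt). The value is named as a real [c] because the product
    formula [intRn_prod] needs a finite factor. *)
Lemma integral_heat1_abs (s l : R) : 0 < s ->
  exists2 c : R, (\int[mu]_t (heat1 s t * expR (l * `|t|))%:E = c%:E)%E & 0 <= c <= 2 * expR (l ^+ 2 * s).
Proof.
move=> s0; pose J := (\int[mu]_t (heat1 s t * expR (l * `|t|))%:E)%E.
have J0 : (0 <= J)%E.
  by apply: integral_ge0 => t _; rewrite lee_fin mulr_ge0 ?heat1_ge0 ?expR_ge0.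
have mt (k : R) : measurable_fun setT (fun t => (heat1 s t * expR (k * t))%:E).
  apply/measurable_EFinP; apply: measurable_funM; first exact: measurable_heat1.
  by apply: measurableT_comp => //; exact: measurable_funM.
have J1 : (J <= (2 * expR (l ^+ 2 * s))%:E)%E.
  apply: (@le_trans _ _ (\int[mu]_t ((heat1 s t * expR (l * t))%:E + (heat1 s t * expR ((- l) * t))%:E)))%E.
    apply: le_integral_ge0 => t _; first by rewrite lee_fin mulr_ge0 ?heat1_ge0 ?expR_ge0.
    rewrite -EFinD lee_fin -mulrDr ler_wpM2l ?heat1_ge0//.
    have [t0|t0] := ger0P t; first by rewrite lerDl expR_ge0.
    by rewrite mulrN mulNr lerDr expR_ge0.
  rewrite ge0_integralD//.
  - by rewrite !integral_heat1_tilt// sqrrN -EFinD lee_fin mulr2n mulrDl !mul1r.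
  - by move=> t _; rewrite lee_fin mulr_ge0 ?heat1_ge0 ?expR_ge0.
  - exact: mt.
  - by move=> t _; rewrite lee_fin mulr_ge0 ?heat1_ge0 ?expR_ge0.
  - exact: mt.
have Jf : J \is a fin_num by rewrite ge0_fin_numE// (le_lt_trans J1)// ltry.
exists (fine J); first by rewrite fineK.
by rewrite -!lee_fin fineK// J0.
Qed.

Lemma integral_expN (r : R) : 0 < r ->
  (\int[mu]_(s in `]0%R, +oo[) (expR (- (r * s)))%:E <= (r^-1)%:E)%E.
Proof.
move=> r0; have := integral_exponential_pdf r0.
set J := (\int[mu]_(s in `]0%R, +oo[) _)%E => J1.
have J0 : (0 <= J)%E by apply: integral_ge0 => t _; rewrite lee_fin expR_ge0.
have : (r%:E * J <= 1)%E.
  rewrite -J1 -ge0_integralZl_EFin ?(ltW r0)//.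
  - rewrite [leLHS]integral_mkcond; apply: le_integral_ge0 => t _.
      by rewrite /patch; case: ifP => // _; rewrite -EFinM lee_fin mulr_ge0 ?expR_ge0 ?ltW.
    rewrite /patch; case: ifPn => [|_]; last by rewrite lee_fin exponential_pdf_ge0// ltW.
    rewrite inE/= in_itv/= andbT => t0; rewrite -EFinM lee_fin exponential_pdfE ?(ltW t0)//.
    by rewrite mulNr.
  - apply/measurable_EFinP; apply: measurable_funTS; apply: measurableT_comp => //.
    by apply: measurableT_comp => //; exact: measurable_funM.
case: J J0 {J1} => [j| |] //; first by rewrite -EFinM !lee_fin => _ rj; rewrite -[leRHS]mul1r ler_pdivlMr// mulrC.
by rewrite gt0_muley ?lte_fin.
Qed.

Lemma measurable_EFin_if d (T : measurableType d) (b : T -> bool) (f : T -> R) :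
  measurable_fun setT b -> measurable_fun setT f ->
  measurable_fun setT (fun z => if b z then (f z)%:E else 0%E).
Proof. by move=> mb mf; apply: measurable_fun_ifT => //; exact/measurable_EFinP. Qed.

Lemma measurable_inv : measurable_fun [set: R] (@GRing.inv R).
Proof.
(* Powers of the absolute value are known to be measurable; at x = 0 both sides are 0, by the
   convention for the inverse and because the sign vanishes. *)
have -> : (@GRing.inv R) = (fun x : R => Num.sg x * `|x| `^ (-1)).
  apply/funext => x; rewrite powR_inv1 ?normr_ge0//.
  have [x0|x0|->] := ltrgt0P x.
  - by rewrite gtr0_sg// mul1r.
  - by rewrite ltr0_sg// mulN1r invrN opprK.
  - by rewrite invr0 mulr0.
apply: measurable_funM; last first.
  by apply: (measurableT_comp (measurable_powR (-1))).
rewrite (_ : Num.sg = fun x : R => if (x < 0)%R then -1 else if (0 < x)%R then 1 else 0).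
  apply: measurable_fun_ifT => //; first exact: measurable_fun_ltr.
  by apply: measurable_fun_ifT => //; exact: measurable_fun_ltr.
apply/funext => x; have [x0|x0|->] := ltrgt0P x.
- by rewrite gtr0_sg.
- by rewrite ltr0_sg.
- by rewrite sgr0.
Qed.

End HeatKernel.

(** * The Bessel kernel: mass and exponential moments *)

Section BesselKernel.
Context {R : realType} {n : nat}.
Local Notation mu := (@lebesgue_measure R).
Implicit Types x y z : n.-tuple R.

Definition heat (s : R) z : R :=
  (4 * pi * s) `^ (- (n%:R) / 2) * expR (- s - (eunorm z) ^+ 2 / (4 * s)).

Lemma BkerE z : Bker z = (\int[mu]_(s in `]0%R, +oo[) (heat s z)%:E)%E.
Proof. by []. Qed.

Lemma heat_ge0 s z : 0 <= heat s z.
Proof. by rewrite mulr_ge0 ?powR_ge0 ?expR_ge0. Qed.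

Lemma Bker_ge0 z : (0 <= Bker z)%E.
Proof. by apply: integral_ge0 => s _; rewrite lee_fin heat_ge0. Qed.

Lemma heat_prod (s : R) z : 0 < s -> heat s z = expR (- s) * \prod_(i < n) heat1 s (tnth z i).
Proof.
move=> s0; rewrite /heat /heat1 big_split/= prodr_const card_ord.
rewrite -(powR_mulrn n (powR_ge0 _ _)) -powRrM -expR_sum.
rewrite mulrCA -expRD; congr (_ `^ _ * expR _); first by rewrite !mulNr mulrC.
congr (_ + _); rewrite sumrN -mulr_suml sqr_sqrtr//.
by apply: sumr_ge0 => i _; exact: sqr_ge0.
Qed.

Lemma heat_exp_prod (s l : R) y : 0 < s -> heat s y * expR (l * l1 y) =
  expR (- s) * \prod_(i < n) (heat1 s (tnth y i) * expR (l * `|tnth y i|)).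
Proof.
move=> s0; rewrite heat_prod// -mulrA [in RHS]big_split/=; congr (_ * (_ * _)).
by rewrite -expR_sum /l1 mulr_sumr.
Qed.

Lemma measurable_heat : measurable_fun [set: R * n.-tuple R] (fun w => heat w.1 w.2).
Proof.
apply: measurable_funM.
  apply: (measurableT_comp (measurable_powR _)).
  by apply: measurable_funM.
apply: measurableT_comp => //; apply: measurable_funB.
  exact: measurableT_comp.
apply: measurable_funM.
  apply: measurable_funX; exact: (measurableT_comp measurable_eunorm measurable_snd).
apply: (measurableT_comp measurable_inv).
exact: measurable_funM.
Qed.

Lemma measurable_pos : measurable_fun [set: R] (fun s => s \in (`]0, +oo[%classic : set R)).
Proof. by apply: (measurable_fun_bool true); rewrite setTI preimage_mem_true. Qed.

Lemma Bker_mkcond z :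
  Bker z = (\int[mu]_s (if s \in (`]0%R, +oo[%classic : set R) then (heat s z)%:E else 0))%E.
Proof. by rewrite BkerE integral_mkcond; apply: eq_integral => s _. Qed.

Lemma measurable_Bker : measurable_fun [set: n.-tuple R] (@Bker R n).
Proof.
have -> : @Bker R n = fun z => (\int[mu]_s (if s \in (`]0%R, +oo[%classic : set R) then (heat s z)%:E else 0))%E.
  by apply/funext => z; rewrite Bker_mkcond.
apply: measurable_integralR => [|z s]; last by case: ifP => // _; rewrite lee_fin heat_ge0.
apply: measurable_EFin_if; first exact: (measurableT_comp measurable_pos measurable_snd).
apply: (measurableT_comp measurable_heat (g := fun w => (w.2, w.1))).
exact: measurable_fun_pair.
Qed.

Lemma measurable_Bker_tsub :
  measurable_fun [set: n.-tuple R * n.-tuple R] (fun w => Bker (tsub w.1 w.2)).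
Proof. exact: (measurableT_comp measurable_Bker measurable_tsub). Qed.

(** By Tonelli the moment is the integral over s of e^(-s) times an n-fold product of
    one-dimensional moments [c s]; the last hypothesis says that e^(-s) beats their growth with rate
    [r] to spare. *)
Lemma intRn_Bker_exp (c : R -> R) (l K r : R) : 0 < r ->
  0 <= K ->
  (forall s, 0 < s -> (\int[mu]_t (heat1 s t * expR (l * `|t|))%:E = (c s)%:E)%E) ->
  (forall s, 0 < s -> expR (- s) * c s ^+ n <= K * expR (- (r * s))) ->
  (intRn (fun y : n.-tuple R => Bker y * (expR (l * l1 y))%:E) <= (K / r)%:E)%E.
Proof.
move=> r0 K0 cs cK.
pose F (s : R) y := if s \in (`]0%R, +oo[%classic : set R) then (heat s y * expR (l * l1 y))%:E else 0%E.
have F0 s y : (0 <= F s y)%E.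
  by rewrite /F; case: ifP => // _; rewrite lee_fin mulr_ge0 ?heat_ge0 ?expR_ge0.
have mF : measurable_fun [set: R * n.-tuple R] (fun w => F w.1 w.2).
  apply: measurable_EFin_if; first exact: (measurableT_comp measurable_pos measurable_fst).
  apply: measurable_funM; first exact: measurable_heat.
  apply: measurableT_comp => //; apply: measurable_funM => //.
  exact: (measurableT_comp measurable_l1 measurable_snd).
have -> : intRn (fun y : n.-tuple R => (Bker y * (expR (l * l1 y))%:E)%E) =
    intRn (fun y => (\int[mu]_(s in setT) F s y)%E).
  apply: eq_intRn => y; rewrite Bker_mkcond muleC -ge0_integralZl_EFin ?expR_ge0//.
  - apply: eq_integral => s _; rewrite /F; case: ifP => _; last by rewrite mule0.
    by rewrite -EFinM mulrC.
  - by move=> s _; case: ifP => // _; rewrite lee_fin heat_ge0.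
  - apply: measurable_EFin_if; first exact: measurable_pos.
    apply: (measurableT_comp measurable_heat (g := fun w => (w, y))).
    exact: measurable_fun_pair.
rewrite intRn_tonelli//.
apply: (@le_trans _ _ (\int[mu]_(s in `]0%R, +oo[) (K%:E * (expR (- (r * s)))%:E)))%E.
  rewrite [leRHS]integral_mkcond; apply: le_integral_ge0 => s _; first exact: intRn_ge0.
  rewrite /patch /F; case: ifPn => [|_]; last by rewrite intRn0.
  rewrite inE/= in_itv/= andbT => s0.
  under eq_intRn => y.
    rewrite (heat_exp_prod l y s0) EFinM; over.
  have m1 : measurable_fun setT (fun t => heat1 s t * expR (l * `|t|)).
    apply: measurable_funM; first exact: measurable_heat1.
    apply: measurableT_comp => //; apply: measurable_funM => //.
  rewrite intRnZ ?expR_ge0//.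
  - rewrite (intRn_prod n m1 _ (cs _ s0)); last by move=> t; rewrite mulr_ge0 ?heat1_ge0 ?expR_ge0.
    by rewrite -!EFinM lee_fin cK.
  - apply/measurable_EFinP/measurable_prod => i _.
    exact: (measurableT_comp m1 (measurable_tnth i)).
  - by move=> y; rewrite lee_fin prodr_ge0// => i _; rewrite mulr_ge0 ?heat1_ge0 ?expR_ge0.
rewrite ge0_integralZl_EFin//.
- by rewrite EFinM lee_wpmul2l ?lee_fin// integral_expN.
- apply/measurable_EFinP; apply: measurable_funTS; apply: measurableT_comp => //.
  by apply: measurableT_comp => //; exact: measurable_funM.
Qed.

Lemma Bker_mass : (intRn (fun y : n.-tuple R => Bker y) <= 1%:E)%E.
Proof.
have := @intRn_Bker_exp (fun=> 1) 0 1 1 ltr01 ler01.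
rewrite divr1 => h; apply: le_trans (h _ _).
- apply: le_intRn => y; first exact: Bker_ge0.
  by rewrite mul0r expR0 mule1.
- move=> s s0; rewrite -(integral_heat1 s0); apply: eq_integral => t _.
  by rewrite mul0r expR0 mulr1.
- by move=> s s0; rewrite expr1n mulr1 !mul1r.
Qed.

Lemma Bker_exp_moment : exists2 l : R, 0 < l &
  exists2 J : R, 0 <= J & (intRn (fun y : n.-tuple R => Bker y * (expR (l * l1 y))%:E) <= J%:E)%E.
Proof.
(* This gives n l^2 <= 1/2, so (2 e^(l^2 s))^n <= 2^n e^(s/2) is absorbed by e^(-s) with rate 1/2
   left. *)
pose l : R := n.+1%:R^-1.
have l0 : 0 < l by rewrite invr_gt0.
have nl : n%:R * l ^+ 2 <= 2^-1.
  rewrite /l exprVn ler_pdivrMr ?exprn_gt0// -natrX.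
  rewrite ler_pdivlMl// -natrM ler_nat.
  by rewrite -[n.+1]addn1 sqrnD muln1 leq_addl.
have /choice[c cP] : forall s : R, exists c : R, 0 < s ->
    (\int[mu]_t (heat1 s t * expR (l * `|t|))%:E = c%:E)%E /\ 0 <= c <= 2 * expR (l ^+ 2 * s).
  move=> s; have [s0|s0] := ltrP 0 s; last by exists 0.
  by have [c h1 h2] := integral_heat1_abs l s0; exists c.
exists l => //; exists (2 ^+ n / 2^-1); first by rewrite mulr_ge0.
apply: (@intRn_Bker_exp c) => //.
- by move=> s s0; have [] := cP s s0.
- move=> s s0; have [_ /andP[c0 c1]] := cP s s0.
  apply: (@le_trans _ _ (expR (- s) * (2 * expR (l ^+ 2 * s)) ^+ n)).
    by rewrite ler_wpM2l ?expR_ge0// lerXn2r// nnegrE// mulr_ge0 ?expR_ge0.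
  rewrite exprMn mulrCA ler_wpM2l ?exprn_ge0// -expRM_natl -expRD ler_expR.
  have := ler_wpM2r (ltW s0) nl; lra.
Qed.

(** The threshold on p leaves no room for a fixed constant, so convolving a slowly varying weight
    must cost only 1 + e. The finite moment of rate [l] is interpolated: with v = l l1(y) / 2 and th
    <= 1, e^(th v) <= 1 + th v e^(th v) <= 1 + th e^(2v). *)
Lemma Bker_exp_small (e : R) : 0 < e -> exists2 c : R, 0 < c &
  (intRn (fun y : n.-tuple R => Bker y * (expR (c * l1 y))%:E) <= (1 + e)%:E)%E.
Proof.
move=> e0; have [l l0 [J J0 hJ]] := Bker_exp_moment.
pose th : R := Num.min 1 (e / (J + 1)).
have J1 : 0 < J + 1 by lra.
have th0 : 0 < th by rewrite lt_min ltr01 divr_gt0.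
have th1 : th <= 1 by rewrite ge_min lexx.
have the : th * J <= e.
  have : th <= e / (J + 1) by rewrite ge_min lexx orbT.
  rewrite ler_pdivlMr// => h; nra.
exists (th * (l / 2)); first by rewrite mulr_gt0// divr_gt0.
apply: (@le_trans _ _ (intRn (fun y : n.-tuple R => Bker y + th%:E * (Bker y * (expR (l * l1 y))%:E)))%E).
  apply: le_intRn => y; first by rewrite mule_ge0 ?Bker_ge0// lee_fin expR_ge0.
  rewrite muleCA -[X in (_ <= X + _)%E]mule1 -ge0_muleDr ?lee01//; last by rewrite -EFinM lee_fin mulr_ge0 ?expR_ge0 ?ltW.
  rewrite lee_wpmul2l ?Bker_ge0// -EFinM -EFinD lee_fin.
  set v := l / 2 * l1 y.
  have v0 : 0 <= v by rewrite mulr_ge0 ?l1_ge0// divr_ge0// ltW.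
  rewrite -mulrA -/v (_ : l * l1 y = v + v); last by rewrite /v; field.
  have h1 : expR (th * v) <= 1 + th * v * expR (th * v).
    have := expR_ge1Dx (- (th * v)); rewrite expRN => h.
    have E0 := expR_gt0 (th * v).
    have : (1 - th * v) * expR (th * v) <= 1.
      by rewrite -ler_pdivlMr// mul1r.
    lra.
  apply: (le_trans h1); rewrite lerD2l -mulrA ler_wpM2l ?(ltW th0)// expRD.
  apply: ler_pM => //; rewrite ?expR_ge0//.
    by have := expR_ge1Dx v; lra.
  rewrite ler_expR; nra.
rewrite intRnD.
- rewrite EFinD leeD ?Bker_mass// intRnZ ?(ltW th0)//.
  + by apply: (@le_trans _ _ (th%:E * J%:E)%E); rewrite ?lee_wpmul2l ?lee_fin ?(ltW th0)// -EFinM lee_fin.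
  + apply: emeasurable_funM; first exact: measurable_Bker.
    apply/measurable_EFinP; apply: measurableT_comp => //; apply: measurable_funM => //.
    exact: measurable_l1.
  + by move=> y; rewrite mule_ge0 ?Bker_ge0// lee_fin expR_ge0.
- exact: measurable_Bker.
- apply: emeasurable_funM => //.
  apply: emeasurable_funM; first exact: measurable_Bker.
  apply/measurable_EFinP; apply: measurableT_comp => //; apply: measurable_funM => //.
  exact: measurable_l1.
- exact: Bker_ge0.
- by move=> y; rewrite !mule_ge0 ?Bker_ge0// lee_fin ?expR_ge0 ?ltW.
Qed.

End BesselKernel.

(** * Lower limits of sequences *)

Section LimInf.
Context {R : realType}.
Implicit Types (u : nat -> \bar R).

Lemma limn_einf_ge u (l : \bar R) : (\forall k \near \oo, (l <= u k)%E) -> (l <= limn_einf u)%E.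
Proof.
move=> [N _ h]; rewrite limn_einf_lim; apply: lime_ge; first exact: is_cvg_einfs.
near=> k; apply: le_ereal_inf_tmp => _ [j /= kj <-].
apply: h => /=; apply: leq_trans kj.
by near: k; exists N.
Unshelve. all: by end_near. Qed.

Lemma limn_einf_le u (c : \bar R) : (forall k, (u k <= c)%E) -> (limn_einf u <= c)%E.
Proof.
move=> h; rewrite limn_einf_lim; apply: lime_le; first exact: is_cvg_einfs.
apply: nearW => k; apply: (le_trans _ (h k)); apply: ereal_inf_lbound.
by exists k => /=.
Qed.

Lemma cvg_sumr (I : Type) (r : seq I) (f : I -> nat -> R) (l : I -> R) :
  (forall i, f i @ \oo --> l i) ->
  \sum_(i <- r) f i k @[k --> \oo] --> \sum_(i <- r) l i.
Proof.
move=> fl; elim: r => [|i r IH].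
  by rewrite big_nil; under eq_fun do rewrite big_nil; exact: cvg_cst.
rewrite big_cons; under eq_fun do rewrite big_cons.
exact: cvgD.
Qed.

End LimInf.

(** * Convolution with the kernel and polynomial weights *)

Section Conv.
Context {R : realType} {n : nat}.
Local Notation mu := (@lebesgue_measure R).
Implicit Types (x y z : n.-tuple R) (phi psi : n.-tuple R -> R).

Lemma Bconv_ge0 phi x : (forall y, 0 <= phi y) -> (0 <= Bconv phi x)%E.
Proof. by move=> f0; apply: intRn_ge0 => y; rewrite mule_ge0 ?Bker_ge0 ?lee_fin. Qed.

Lemma le_Bconv phi psi x : (forall y, 0 <= phi y) -> (forall y, phi y <= psi y) ->
  (Bconv phi x <= Bconv psi x)%E.
Proof.
move=> f0 fg; apply: le_intRn => y; first by rewrite mule_ge0 ?Bker_ge0 ?lee_fin.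
by rewrite lee_wpmul2l ?Bker_ge0 ?lee_fin.
Qed.

Lemma measurable_Bker_tsub1 x : measurable_fun setT (fun y => Bker (tsub x y)).
Proof.
apply: (measurableT_comp measurable_Bker_tsub (g := fun y => (x, y))).
exact: measurable_fun_pair.
Qed.

Lemma measurable_Bconv1 phi x : measurable_fun setT phi ->
  measurable_fun setT (fun y => (Bker (tsub x y) * (phi y)%:E)%E).
Proof.
move=> mf; apply: emeasurable_funM; first exact: measurable_Bker_tsub1.
exact/measurable_EFinP.
Qed.

Lemma BconvD phi psi x : measurable_fun setT phi -> measurable_fun setT psi ->
  (forall y, 0 <= phi y) -> (forall y, 0 <= psi y) ->
  (Bconv (fun y => phi y + psi y)%R x = Bconv phi x + Bconv psi x)%E.
Proof.
move=> mf mg f0 g0; rewrite /Bconv -intRnD//; last 4 first.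
- exact: measurable_Bconv1.
- exact: measurable_Bconv1.
- by move=> y; rewrite mule_ge0 ?Bker_ge0 ?lee_fin.
- by move=> y; rewrite mule_ge0 ?Bker_ge0 ?lee_fin.
by apply: eq_intRn => y; rewrite EFinD ge0_muleDr ?lee_fin.
Qed.

Lemma BconvZ (k : R) phi x : 0 <= k -> measurable_fun setT phi ->
  (forall y, 0 <= phi y) ->
  (Bconv (fun y => k * phi y)%R x = k%:E * Bconv phi x)%E.
Proof.
move=> k0 mf f0; rewrite /Bconv -intRnZ//; last 2 first.
- exact: measurable_Bconv1.
- by move=> y; rewrite mule_ge0 ?Bker_ge0 ?lee_fin.
by apply: eq_intRn => y; rewrite EFinM muleCA.
Qed.

Lemma measurable_tsub1 x : measurable_fun setT (tsub x).
Proof.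
apply: (measurableT_comp measurable_tsub (g := fun y => (x, y))).
exact: measurable_fun_pair.
Qed.

Lemma Bconv_reflect phi x : measurable_fun setT phi -> (forall y, 0 <= phi y) ->
  Bconv phi x = intRn (fun y => (Bker y * (phi (tsub x y))%:E)%E).
Proof.
move=> mf f0; rewrite /Bconv -(intRn_reflect x (f := fun y => (Bker y * (phi (tsub x y))%:E)%E)).
- by apply: eq_intRn => y; rewrite tsubK.
- apply: emeasurable_funM; first exact: measurable_Bker.
  by apply/measurable_EFinP/(measurableT_comp mf); exact: measurable_tsub1.
- by move=> y; rewrite mule_ge0 ?Bker_ge0 ?lee_fin.
Qed.

(** Enlarging [M] flattens this weight of degree [b]: for b >= 0 its logarithm is Lipschitz in the
    sum norm with constant b / M. *)
Definition wt (M b : R) y : R := (M + l1 y) `^ b.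

Lemma wt_gt0 M b y : 1 <= M -> 0 < wt M b y.
Proof. by move=> M1; rewrite powR_gt0// (lt_le_trans ltr01)// (le_trans M1)// lerDl l1_ge0. Qed.

Lemma measurable_wt M b : measurable_fun setT (wt M b).
Proof.
apply: (measurableT_comp (measurable_powR b)); apply: measurable_funD => //.
exact: measurable_l1.
Qed.

(** M + |y| <= (M + |z|)(1 + |y - z| / M), followed by 1 + v <= e^v. *)
Lemma wt_shift (M b : R) y z : 1 <= M -> 0 <= b ->
  wt M b y <= expR (b / M * l1 (tsub y z)) * wt M b z.
Proof.
move=> M1 b0; have M0 : 0 < M by lra.
have lz := l1_ge0 z; have ly := l1_ge0 y; have ld := l1_ge0 (tsub y z).
have tri : l1 y <= l1 z + l1 (tsub y z).
  rewrite /l1 -big_split/=; apply: ler_sum => i _; rewrite tnth_mktuple.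
  by rewrite -{1}(subrK (tnth z i) (tnth y i)) addrC ler_normD.
have h1 : M + l1 y <= (M + l1 z) * (1 + l1 (tsub y z) / M).
  have : l1 (tsub y z) <= (M + l1 z) * (l1 (tsub y z) / M).
    rewrite mulrCA ler_peMr// ler_pdivlMr// mul1r; lra.
  lra.
have d0 : 0 <= l1 (tsub y z) / M by rewrite divr_ge0// ltW.
rewrite (_ : b / M * _ = l1 (tsub y z) / M * b); last by ring.
rewrite expRM; apply: (@le_trans _ _ (((M + l1 z) * (1 + l1 (tsub y z) / M)) `^ b)).
  by rewrite ge0_ler_powR// nnegrE; nra.
rewrite powRM; [|lra|lra].
rewrite mulrC ler_wpM2r ?powR_ge0//; apply: ge0_ler_powR => //; rewrite ?nnegrE ?expR_ge0//; first lra.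
exact: expR_ge1Dx.
Qed.

(** Once b / M <= c, a shift costs at most e^(c l1), whose integral against the kernel is at most 1
    + e. *)
Lemma Bconv_wt_le (b e : R) : 0 <= b -> 0 < e ->
  exists2 M0, 1 <= M0 & forall M x, M0 <= M ->
    (Bconv (wt M b) x <= ((1 + e) * wt M b x)%:E)%E.
Proof.
move=> b0 e0; have [c c0 hc] := @Bker_exp_small R n e e0.
exists (Num.max 1 (b / c)); first by rewrite le_max lexx.
move=> M x; rewrite ge_max => /andP[M1 Mb].
have M0 : 0 < M by lra.
have bM : b / M <= c by rewrite ler_pdivrMr// mulrC -ler_pdivrMr.
rewrite Bconv_reflect; [|exact: measurable_wt|by move=> y; rewrite ltW// wt_gt0].
have me : measurable_fun setT (fun y => (Bker y * (expR (c * l1 y))%:E)%E).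
  apply: emeasurable_funM; first exact: measurable_Bker.
  apply/measurable_EFinP; apply: measurableT_comp => //; apply: measurable_funM => //.
  exact: measurable_l1.
apply: (@le_trans _ _ (intRn (fun y => ((wt M b x)%:E * (Bker y * (expR (c * l1 y))%:E))%E))).
  apply: le_intRn => y; first by rewrite mule_ge0 ?Bker_ge0// lee_fin ltW// wt_gt0.
  rewrite muleCA lee_wpmul2l ?Bker_ge0// -EFinM lee_fin.
  apply: (le_trans (wt_shift (tsub x y) x M1 b0)).
  rewrite mulrC ler_wpM2l ?(ltW (wt_gt0 _ _ _))// ler_expR.
  have -> : l1 (tsub (tsub x y) x) = l1 y.
    by apply: eq_bigr => i _; rewrite !tnth_mktuple addrAC subrr add0r normrN.
  by rewrite ler_wpM2r ?l1_ge0.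
rewrite intRnZ//.
- by rewrite mulrC EFinM lee_wpmul2l// lee_fin ltW// wt_gt0.
- by rewrite ltW// wt_gt0.
- by move=> y; rewrite mule_ge0 ?Bker_ge0// lee_fin expR_ge0.
Qed.

(** Continuity of the convolved weight without any modulus of continuity of the kernel; it supplies
    the upper half of [duhamel_continuous]. *)
Lemma Bconv_wt_shift (M b : R) x y : 1 <= M -> 0 <= b ->
  (Bconv (wt M b) y <= (expR (b * l1 (tsub y x)))%:E * Bconv (wt M b) x)%E.
Proof.
move=> M1 b0.
have w0 z : 0 <= wt M b z by rewrite ltW// wt_gt0.
rewrite !Bconv_reflect//; try exact: measurable_wt.
rewrite -intRnZ ?expR_ge0//.
- apply: le_intRn => z; first by rewrite mule_ge0 ?Bker_ge0 ?lee_fin.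
  rewrite muleCA lee_wpmul2l ?Bker_ge0// -EFinM lee_fin.
  apply: (le_trans (wt_shift (tsub y z) (tsub x z) M1 b0)).
  rewrite ler_wpM2r// ler_expR.
  have -> : l1 (tsub (tsub y z) (tsub x z)) = l1 (tsub y x).
    by apply: eq_bigr => i _; rewrite !tnth_mktuple; congr `|_|; ring.
  rewrite ler_wpM2r ?l1_ge0// ler_pdivrMr; last lra.
  by rewrite ler_peMr.
- apply: emeasurable_funM; first exact: measurable_Bker.
  apply/measurable_EFinP/(measurableT_comp (measurable_wt _ _)); exact: measurable_tsub1.
- by move=> z; rewrite mule_ge0 ?Bker_ge0 ?lee_fin.
Qed.

(** Only s in [1 + l, 2 + l] is kept in the subordination integral, l being the sum norm of z: there
    |z|^2 / (4s) <= l and s <= 2 + l, while ln(4 pi s) <= 4 pi s controls the prefactor. Adding the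
    three exponents gives [K]. *)
Lemma Bker_ge : exists2 K : R, 0 <= K & forall z, ((expR (- (K * (1 + l1 z))))%:E <= Bker z)%E.
Proof.
pose K : R := 4 * pi * n%:R + 2.
have pi0 := @pi_ge0 R; have n0 : 0 <= n%:R :> R by [].
have pn : 0 <= pi * n%:R :> R by rewrite mulr_ge0.
exists K; first by rewrite /K; lra.
move=> z; set l := l1 z; have l0 : 0 <= l by exact: l1_ge0.
apply: (@le_trans _ _ (\int[mu]_(s in `[(1 + l)%R, (2 + l)%R]) (expR (- (K * (1 + l))))%:E)%E).
  rewrite integral_cst//= lebesgue_measure_itv/= lte_fin ifT; last lra.
  by rewrite -EFinB (_ : 2 + l - (1 + l) = 1) ?mule1//; ring.
apply: (@le_trans _ _ (\int[mu]_(s in `[(1 + l)%R, (2 + l)%R]) (heat s z)%:E)%E); last first.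
  apply: integral_le_subset => s; first by rewrite lee_fin heat_ge0.
  by rewrite /= !in_itv/= => /andP[h _]; rewrite andbT; lra.
apply: le_integral_ge0 => s; first by rewrite lee_fin expR_ge0.
rewrite /= in_itv/= lee_fin => /andP[s1 s2].
have s0 : 0 < s by lra.
have p0 : 0 < 4 * pi * s by rewrite !mulr_gt0 ?pi_gt0.
rewrite /heat /powR gt_eqF// -expRD ler_expR.
have h1 : ln (4 * pi * s) <= 4 * pi * s.
  by rewrite -[leRHS]expRK ler_ln ?posrE ?expR_gt0//; have := expR_ge1Dx (4 * pi * s); lra.
have h2 : eunorm z ^+ 2 / (4 * s) <= l.
  rewrite ler_pdivrMr; last lra.
  have := eunorm_le_l1 z; rewrite -/l => h; have h0 := eunorm_ge0 z.
  rewrite expr2; nra.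
have h3 : n%:R / 2 * ln (4 * pi * s) <= 4 * pi * n%:R * (1 + l).
  apply: (@le_trans _ _ (n%:R / 2 * (4 * pi * s))); first by rewrite ler_wpM2l// divr_ge0.
  have : pi * n%:R * s <= pi * n%:R * (2 + l) by rewrite ler_wpM2l.
  have : 0 <= pi * n%:R * l by rewrite mulr_ge0.
  lra.
rewrite /K mulNr; move: h2 h3; lra.
Qed.

(** Fatou in the subordination variable also covers a value +oo at the origin. The factor [c] is
    carried along because the inequality is used on integrands of convolutions. *)
Lemma Bker_lsc0 (z_ : nat -> n.-tuple R) z (c : R) : 0 <= c ->
  (forall i, tnth (z_ k) i @[k --> \oo] --> tnth z i) ->
  (Bker z * c%:E <= limn_einf (fun k => Bker (z_ k) * c%:E))%E.
Proof.
move=> c0 zk.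
have mh z' : measurable_fun (`]0%R, +oo[%classic : set R) (fun s => (heat s z' * c)%:E).
  apply/measurable_EFinP; apply: measurable_funTS; apply: measurable_funM => //.
  apply: (measurableT_comp measurable_heat (g := fun s => (s, z'))).
  exact: measurable_fun_pair.
have E z' : (Bker z' * c%:E = \int[mu]_(s in `]0%R, +oo[) (heat s z' * c)%:E)%E.
  rewrite muleC BkerE -ge0_integralZl_EFin//.
  - by apply: eq_integral => s _; rewrite -EFinM mulrC.
  - by move=> s _; rewrite lee_fin heat_ge0.
  - apply/measurable_EFinP; apply: measurable_funTS.
    apply: (measurableT_comp measurable_heat (g := fun s => (s, z'))).
    exact: measurable_fun_pair.
have E2 : (fun k => (Bker (z_ k) * c%:E)%E) =
  fun k => (\int[mu]_(s in `]0%R, +oo[) (heat s (z_ k) * c)%:E)%E.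
  by apply/funext => k; exact: E.
rewrite E2 E.
apply: le_trans (fatou _ _ _ _) => //=;
  try by [move=> k; exact: mh|move=> k s _; rewrite lee_fin mulr_ge0 ?heat_ge0].
apply: le_integral_ge0 => s; first by rewrite lee_fin mulr_ge0 ?heat_ge0.
rewrite /= in_itv/= andbT => s0.
suff : (heat s (z_ k) * c)%:E @[k --> \oo] --> (heat s z * c)%:E.
  by move=> /cvg_limn_einf_sup[-> _].
apply: cvg_EFin; first exact: nearW.
apply: cvgM; last exact: cvg_cst.
apply: cvgM; first exact: cvg_cst.
apply: (cvg_comp _ expR); last exact: continuous_expR.
apply: cvgB; first exact: cvg_cst.
apply: cvgM; last exact: cvg_cst.
rewrite /eunorm.
have e z' : Num.sqrt (\sum_(i < n) tnth z' i ^+ 2) ^+ 2 = \sum_(i < n) tnth z' i ^+ 2.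
  by rewrite sqr_sqrtr// sumr_ge0// => i _; exact: sqr_ge0.
rewrite e; under eq_fun do rewrite e.
by apply: cvg_sumr => i; exact: cvgM.
Qed.

Lemma Bker_lsc (x_ : nat -> n.-tuple R) x y (c : R) : 0 <= c ->
  (forall i, tnth (x_ k) i @[k --> \oo] --> tnth x i) ->
  (Bker (tsub x y) * c%:E <= limn_einf (fun k => Bker (tsub (x_ k) y) * c%:E))%E.
Proof.
move=> c0 xk; apply: (Bker_lsc0 (z_ := fun k => tsub (x_ k) y)) => // i.
under eq_fun do rewrite tnth_mktuple.
by rewrite tnth_mktuple; apply: cvgB => //; exact: cvg_cst.
Qed.

End Conv.

(** * Time integrals of powers and exponentials *)

Section TimeIntegrals.
Context {R : realType}.
Local Notation mu := (@lebesgue_measure R).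

Lemma integral_shift_itv (f : R -> \bar R) (s t c : R) :
  measurable_fun [set: R] f -> (forall x, 0 <= f x)%E ->
  (\int[mu]_(x in `[s, t]) f (c + x)%R = \int[mu]_(x in `[(c + s)%R, (c + t)%R]) f x)%E.
Proof.
move=> mf f0; rewrite [LHS]integral_mkcond [RHS]integral_mkcond.
rewrite -(@integral_shift _ (f \_ `[c + s, c + t]) c); last 2 first.
- exact/(measurable_restrictT _ _).1/measurable_funTS.
- by move=> x; apply: erestrict_ge0.
apply: eq_integral => x _; rewrite /patch !mem_setE.
by congr (if _ then _ else _); rewrite !in_itv/= !lerD2l.
Qed.

Lemma integral_powR (a b r : R) : 0 < a -> a < b -> 0 <= r ->
  (\int[mu]_(x in `[a, b]) (x `^ r)%:E = ((b `^ (r + 1) - a `^ (r + 1)) / (r + 1))%:E)%E.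
Proof.
move=> a0 ab r0; have r1 : r + 1 != 0 by rewrite gt_eqF// ltr_wpDl.
have d (q x : R) : 0 < x -> derivable (@powR R ^~ q) x (1 : R).
  by move=> x0; apply: derivable_powR; rewrite in_itv/= x0.
have dc (q x : R) : 0 < x -> {for x, continuous (@powR R ^~ q)}.
  by move=> x0; apply/differentiable_continuous/derivable1_diffP/d.
pose F (x : R) : R := (r + 1)^-1 * x `^ (r + 1).
have dF (x : R) : 0 < x -> derivable F x (1 : R).
  by move=> x0; apply: derivableM => //; exact: d.
have cF (x : R) : 0 < x -> {for x, continuous F}.
  by move=> x0; apply/differentiable_continuous/derivable1_diffP/dF.
rewrite (@continuous_FTC2 _ (@powR R ^~ r) F)//.
- by rewrite -EFinB /F -mulrBr mulrC.
- apply: continuous_in_subspaceT => x; rewrite inE/= in_itv/= => /andP[ax _].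
  by apply: dc; lra.
- split.
  + by move=> x; rewrite in_itv/= => /andP[ax _]; apply: dF; lra.
  + by apply: cvg_at_right_filter; exact: cF.
  + by apply: cvg_at_left_filter; apply: cF; lra.
- move=> x; rewrite in_itv/= => /andP[ax _].
  have x0 : 0 < x by lra.
  rewrite /F derive1E deriveM//; last exact: d.
  rewrite derive_cst scaler0 addr0 -derive1E powR_derive1 ?in_itv/= ?x0//.
  rewrite addrK; change (_ = _) with ((r + 1)^-1 * ((r + 1) * x `^ r) = x `^ r).
  by rewrite mulKf.
Qed.

(** Lets [d] tend to 0: if A exceeded C t^q, the point b with C b^q = A would lie beyond t, and the
    midpoint between them would contradict the hypothesis. *)
Lemma powR_right_closed (A C t q : R) : 0 <= t -> 0 < q -> 0 <= C ->
  (forall d : R, 0 < d -> A <= C * (t + d) `^ q) -> A <= C * t `^ q.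
Proof.
move=> t0 q0 C0 h; rewrite leNgt; apply/negP => hA.
have tq0 := powR_ge0 t q.
have [C1|C1] := eqVneq C 0.
  by have := h 1 ltr01; rewrite C1 !mul0r in hA *; lra.
have Cp : 0 < C by rewrite lt_neqAle eq_sym C1.
pose b := (A / C) `^ q^-1.
have AC0 : 0 <= A / C by rewrite divr_ge0//; nra.
have tAC : t `^ q < A / C by rewrite ltr_pdivlMr// mulrC.
have bq : b `^ q = A / C by rewrite /b -powRrM mulVf ?gt_eqF// powRr1.
have tb : t < b.
  rewrite ltNge; apply/negP => bt; move: tAC; rewrite -bq ltNge => /negP; apply.
  by rewrite ge0_ler_powR ?nnegrE ?powR_ge0// ltW.
have := h ((b - t) / 2) ltac:(lra); rewrite mulrC -ler_pdivrMr// -bq leNgt => /negP; apply.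
rewrite gt0_ltr_powR ?nnegrE ?powR_ge0//; lra.
Qed.

(** The mirror image of [powR_right_closed]; A >= 0 provides the root of A / C and settles t = 0,
    where the last hypothesis is void. *)
Lemma powR_left_closed (A C t q : R) : 0 <= t -> 0 < q -> 0 <= C -> 0 <= A ->
  (forall d : R, 0 < d -> d < t -> C * (t - d) `^ q <= A) -> C * t `^ q <= A.
Proof.
move=> t0 q0 C0 A0 h; rewrite leNgt; apply/negP => hA.
have tq0 := powR_ge0 t q.
have Cp : 0 < C by rewrite lt_neqAle C0 andbT; apply/eqP => C1; move: hA; rewrite -C1; lra.
pose b := (A / C) `^ q^-1.
have AC0 : 0 <= A / C by rewrite divr_ge0.
have b0 : 0 <= b by exact: powR_ge0.
have tAC : A / C < t `^ q by rewrite ltr_pdivrMr// mulrC.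
have bq : b `^ q = A / C by rewrite /b -powRrM mulVf ?gt_eqF// powRr1.
have tb : b < t.
  rewrite ltNge; apply/negP => bt; move: tAC; rewrite -bq ltNge => /negP; apply.
  by rewrite ge0_ler_powR ?nnegrE ?powR_ge0// ltW.
have := h ((t - b) / 2) ltac:(lra) ltac:(lra).
rewrite mulrC -ler_pdivlMr// -bq leNgt => /negP; apply.
rewrite gt0_ltr_powR ?nnegrE//; lra.
Qed.

(** Powers are differentiated at positive points only, so the fundamental theorem is applied on
    [d, u] with u = t - s, and then [d] tends to 0. *)
Lemma integral_powR_ge (s t r : R) : 0 <= r -> s <= t ->
  (((t - s) `^ (r + 1) / (r + 1))%:E <= \int[mu]_(x in `[s, t]) ((x - s) `^ r)%:E)%E.
Proof.
move=> r0 st.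
have r1 : 0 < r + 1 by lra.
have -> : (\int[mu]_(x in `[s, t]) ((x - s) `^ r)%:E = \int[mu]_(x in `[0%R, (t - s)%R]) (x `^ r)%:E)%E.
  have := @integral_shift_itv (fun x => (x `^ r)%:E) s t (- s).
  rewrite addNr [(- s + t)%R]addrC => <-.
  - by apply: eq_integral => x _; rewrite addrC.
  - by apply/measurable_EFinP; exact: measurable_powR.
  - by move=> x; rewrite lee_fin powR_ge0.
move: (t - s) (subr_ge0 s t) => u; rewrite st => u0.
set J := (\int[mu]_(x in _) _)%E.
have J0 : (0 <= J)%E by apply: integral_ge0 => x _; rewrite lee_fin powR_ge0.
have h (d : R) : 0 < d -> d < u -> (((u `^ (r + 1) - d `^ (r + 1)) / (r + 1))%:E <= J)%E.
  move=> d0 du; rewrite -integral_powR//; apply: integral_le_subset.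
    by move=> x _; rewrite lee_fin powR_ge0.
  by move=> x; rewrite /= !in_itv/= => /andP[? ?]; apply/andP; split; lra.
case: J J0 h => [j| |] //; rewrite ?leey// !lee_fin => j0 h.
have [->|un0] := eqVneq u 0; first by rewrite powR0 ?gt_eqF// mul0r.
have up : 0 < u by rewrite lt_neqAle eq_sym un0.
have : u `^ (r + 1) - (r + 1) * j <= 1 * 0 `^ (r + 1).
  apply: powR_right_closed => // d d0; rewrite add0r mul1r.
  have [du|ud] := ltP d u.
    by have := h d d0 du; rewrite lee_fin ler_pdivrMr// mulrC; lra.
  have : u `^ (r + 1) <= d `^ (r + 1) by rewrite ge0_ler_powR ?nnegrE// ?ltW.
  have : 0 <= (r + 1) * j by rewrite mulr_ge0// ltW.
  lra.
rewrite powR0 ?gt_eqF// mulr0 ler_pdivrMr// mulrC; lra.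
Qed.

Lemma integral_powR_le (e t r : R) : 0 <= r -> 0 <= e -> 0 <= t ->
  (\int[mu]_(x in `[0%R, t]) ((x + e) `^ r)%:E <= ((t + e) `^ (r + 1) / (r + 1))%:E)%E.
Proof.
move=> r0 e0 t0; have r1 : 0 < r + 1 by lra.
set J := (\int[mu]_(x in _) _)%E.
have J0 : (0 <= J)%E by apply: integral_ge0 => x _; rewrite lee_fin powR_ge0.
have h (d : R) : 0 < d -> (J <= (((t + e + d) `^ (r + 1)) / (r + 1))%:E)%E.
  move=> d0.
  apply: (@le_trans _ _ (\int[mu]_(x in `[0%R, t]) (((e + d / 2) + x) `^ r)%:E))%E.
    apply: le_integral_ge0 => x; first by rewrite lee_fin powR_ge0.
    rewrite /= in_itv/= lee_fin => /andP[x0 _]; rewrite ge0_ler_powR ?nnegrE//; lra.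
  rewrite (@integral_shift_itv (fun x => (x `^ r)%:E)); last 2 first.
  - by apply/measurable_EFinP; exact: measurable_powR.
  - by move=> x; rewrite lee_fin powR_ge0.
  apply: (@le_trans _ _ (\int[mu]_(x in `[(e + d / 2)%R, (t + e + d)%R]) (x `^ r)%:E))%E.
    apply: integral_le_subset; first by move=> x _; rewrite lee_fin powR_ge0.
    by move=> x; rewrite /= !in_itv/= => /andP[? ?]; apply/andP; split; lra.
  rewrite integral_powR//; [|lra|lra].
  by rewrite lee_fin ler_pM2r ?invr_gt0// lerBlDr lerDl powR_ge0.
case: J J0 h => [j| |] // j0 h; last by have := h 1 ltr01.
rewrite lee_fin ler_pdivlMr// -[leRHS]mul1r; apply: powR_right_closed => //; first lra.
by move=> d d0; have := h d d0; rewrite lee_fin ler_pdivlMr// mul1r.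
Qed.

Lemma integral_expR_le (L t : R) : 0 < L -> 0 <= t ->
  (\int[mu]_(x in `[0%R, t]) (expR (L * x))%:E <= (expR (L * t) / L)%:E)%E.
Proof.
move=> L0 t0.
have [<-|tn0] := eqVneq 0 t.
  by rewrite set_itv1 integral_set1// lee_fin divr_ge0 ?expR_ge0 ?ltW.
have tp : 0 < t by rewrite lt_neqAle tn0.
pose F (x : R) : R := L^-1 * expR (L * x).
have dF (x : R) : is_derive x 1 F (expR (L * x)).
  rewrite /F; apply: is_derive_eq; rewrite /GRing.scale/=.
  field.
  by rewrite gt_eqF.
have cF x : {for x, continuous F}.
  by apply/differentiable_continuous/derivable1_diffP/ex_derive.
rewrite (@continuous_FTC2 _ (fun x => expR (L * x)) F)//.
- rewrite -EFinB lee_fin /F mulrC lerBlDr lerDl mulr_ge0 ?expR_ge0// invr_ge0 ltW//.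
- apply: continuous_subspaceT => x; apply: (cvg_comp _ expR); last exact: continuous_expR.
  by apply: cvgM; [exact: cvg_cst|exact: cvg_id].
- split.
  + by move=> x _; exact: ex_derive.
  + by apply: cvg_at_right_filter; exact: cF.
  + by apply: cvg_at_left_filter; exact: cF.
- by move=> x _; rewrite derive1E derive_val.
Qed.

(** The exponential is frozen at its final value and the power integrates to a factor 1 / (r + 1),
    as the singular rate requires. *)
Lemma integral_powR_expR_le (e t r L : R) : 0 <= r -> 0 <= e -> 0 <= t -> 0 < L ->
  (\int[mu]_(x in `[0%R, t]) ((x + e) `^ r * expR (L * x))%:E
    <= (expR (L * t) * ((t + e) `^ (r + 1) / (r + 1)))%:E)%E.
Proof.
move=> r0 e0 t0 L0; rewrite EFinM.
apply: (@le_trans _ _ (\int[mu]_(x in `[0%R, t]) ((expR (L * t))%:E * ((x + e) `^ r)%:E))%E).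
  apply: le_integral_ge0 => x; first by rewrite lee_fin mulr_ge0 ?powR_ge0 ?expR_ge0.
  rewrite /= in_itv/= => /andP[x0 xt]; rewrite -EFinM lee_fin mulrC ler_wpM2r ?powR_ge0//.
  by rewrite ler_expR ler_wpM2l// ltW.
rewrite ge0_integralZl_EFin ?expR_ge0//.
- by rewrite lee_wpmul2l ?lee_fin ?expR_ge0// integral_powR_le.
- by move=> x _; rewrite lee_fin powR_ge0.
- apply/measurable_EFinP; apply: measurable_funTS.
  by apply: (measurableT_comp (measurable_powR r)); exact: measurable_funD.
Qed.

(** The power is frozen instead, and the exponential integrates to a factor 1 / L, small for large
    [L]. *)
Lemma integral_powR_expR_le2 (e t r L : R) : 0 <= r -> 0 <= e -> 0 <= t -> 0 < L ->
  (\int[mu]_(x in `[0%R, t]) ((x + e) `^ r * expR (L * x))%:E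
    <= ((t + e) `^ r * (expR (L * t) / L))%:E)%E.
Proof.
move=> r0 e0 t0 L0; rewrite EFinM.
apply: (@le_trans _ _ (\int[mu]_(x in `[0%R, t]) (((t + e) `^ r)%:E * (expR (L * x))%:E))%E).
  apply: le_integral_ge0 => x; first by rewrite lee_fin mulr_ge0 ?powR_ge0 ?expR_ge0.
  rewrite /= in_itv/= => /andP[x0 xt]; rewrite -EFinM lee_fin ler_wpM2r ?expR_ge0//.
  by rewrite ge0_ler_powR ?nnegrE//; lra.
rewrite ge0_integralZl_EFin ?powR_ge0//.
- by rewrite lee_wpmul2l ?lee_fin ?powR_ge0// integral_expR_le.
- apply/measurable_EFinP; apply: measurable_funTS.
  by apply: measurableT_comp => //; exact: measurable_funM.
Qed.

End TimeIntegrals.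

(** * The Duhamel operator: order, linearity, measurability, Fatou *)

Section Duhamel.
Context {R : realType} {n : nat}.
Local Notation mu := (@lebesgue_measure R).
Implicit Types (x y z : n.-tuple R) (f g h : n.-tuple R -> R -> R).

Definition duhamel f x (t : R) : \bar R :=
  (\int[mu]_(tau in `[0%R, t]) Bconv (f^~ tau) x)%E.

(* Only times t >= 0 matter, hence the composition with [Num.max _ 0]. *)
Definition tmeas f := measurable_fun [set: R * n.-tuple R] (fun w => f w.2 (Num.max w.1 0)).

Definition tnneg f := forall y t, 0 <= t -> 0 <= f y t.

Lemma max0_ge0 (t : R) : 0 <= Num.max t 0.
Proof. by rewrite le_max lexx orbT. Qed.

Lemma measurable_max0 : measurable_fun [set: R] (fun t : R => Num.max t 0).
Proof. exact: measurable_maxr. Qed.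

Lemma tmeasD f g : tmeas f -> tmeas g -> tmeas (fun y t => f y t + g y t).
Proof. by move=> mf mg; exact: measurable_funD. Qed.

Lemma tmeasM f g : tmeas f -> tmeas g -> tmeas (fun y t => f y t * g y t).
Proof. by move=> mf mg; exact: measurable_funM. Qed.

Lemma tmeas_powR f (p : R) : tmeas f -> tmeas (fun y t => f y t `^ p).
Proof. by move=> mf; exact: (measurableT_comp (measurable_powR p) mf). Qed.

Lemma tmeas_time (k : R -> R) : measurable_fun [set: R] k -> tmeas (fun _ t => k t).
Proof.
move=> mk; apply: (measurableT_comp mk (g := fun w : R * n.-tuple R => Num.max w.1 0)).
exact: (measurableT_comp measurable_max0 measurable_fst).
Qed.

Lemma tmeas_space (k : n.-tuple R -> R) : measurable_fun setT k -> tmeas (fun y _ => k y).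
Proof. by move=> mk; exact: (measurableT_comp mk measurable_snd). Qed.

Lemma tmeas_slice f t : tmeas f -> 0 <= t -> measurable_fun setT (f^~ t).
Proof.
move=> mf t0.
have := measurableT_comp mf (g := fun y : n.-tuple R => (t, y)).
rewrite (_ : _ \o _ = f^~ t); first by apply; exact: measurable_fun_pair.
by apply/funext => y /=; rewrite max_l.
Qed.

Lemma measurable_Bconv_joint f : tmeas f -> tnneg f ->
  measurable_fun [set: R * n.-tuple R] (fun w => Bconv (f^~ (Num.max w.1 0)) w.2).
Proof.
move=> mf f0; apply: (measurable_intRn
  (f := fun (w : R * n.-tuple R) y => (Bker (tsub w.2 y) * (f y (Num.max w.1 0))%:E)%E)).
  apply: emeasurable_funM.
    apply: (measurableT_comp measurable_Bker_tsub
      (g := fun w : (R * n.-tuple R) * n.-tuple R => (w.1.2, w.2))).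
    apply: measurable_fun_pair => //.
    exact: (measurableT_comp measurable_snd measurable_fst).
  apply/measurable_EFinP; apply: (measurableT_comp mf
    (g := fun w : (R * n.-tuple R) * n.-tuple R => (w.1.1, w.2))).
  apply: measurable_fun_pair => //.
  exact: (measurableT_comp measurable_fst measurable_fst).
by move=> w y; rewrite mule_ge0 ?Bker_ge0// lee_fin f0// max0_ge0.
Qed.

Lemma measurable_Bconv_max f x : tmeas f -> tnneg f ->
  measurable_fun [set: R] (fun t => Bconv (f^~ (Num.max t 0)) x).
Proof.
move=> mf f0; apply: (measurableT_comp (measurable_Bconv_joint mf f0) (g := fun t => (t, x))).
exact: measurable_fun_pair.
Qed.

Lemma measurable_Bconv_time f x (D : set R) : measurable D -> tmeas f -> tnneg f ->
  (forall t, D t -> 0 <= t) -> measurable_fun D (fun t => Bconv (f^~ t) x).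
Proof.
move=> mD mf f0 D0; have := measurable_funTS (measurable_Bconv_max x mf f0) (D := D).
apply: eq_measurable_fun => t; rewrite inE => /D0 t0.
by rewrite max_l.
Qed.

Lemma itv0_ge0 (s t : R) : 0 <= s -> forall u, `[s, t]%classic u -> 0 <= u.
Proof. by move=> s0 u; rewrite /= in_itv/= => /andP[su _]; exact: le_trans su. Qed.

Lemma duhamel_ge0 f x t : tnneg f -> (0 <= duhamel f x t)%E.
Proof.
move=> f0; apply: integral_ge0 => s /(itv0_ge0 (lexx 0)) s0.
by apply: Bconv_ge0 => y; exact: f0.
Qed.

Lemma le_duhamel f g x t : tnneg f ->
  (forall y s, 0 <= s <= t -> f y s <= g y s) -> (duhamel f x t <= duhamel g x t)%E.
Proof.
move=> f0 fg; apply: le_integral_ge0 => s /= st.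
  by apply: Bconv_ge0 => y; apply: f0; exact: itv0_ge0 st.
move: st; rewrite in_itv/= => st; apply: le_Bconv => y; last exact: fg.
by apply: f0; case/andP: st.
Qed.

Lemma eq_duhamel f g x t :
  (forall y s, 0 <= s <= t -> f y s = g y s) -> duhamel f x t = duhamel g x t.
Proof.
move=> fg; apply: eq_integral => s; rewrite inE/= in_itv/= => st.
by congr Bconv; apply/funext => y; exact: fg.
Qed.

Lemma duhamelD f g x t : tmeas f -> tnneg f -> tmeas g -> tnneg g ->
  (duhamel (fun y s => f y s + g y s)%R x t = duhamel f x t + duhamel g x t)%E.
Proof.
move=> mf f0 mg g0; rewrite /duhamel -ge0_integralD//; last 4 first.
- by move=> s st; apply: Bconv_ge0 => y; apply: f0; exact: itv0_ge0 st.
- by apply: measurable_Bconv_time => // s; exact: itv0_ge0.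
- by move=> s st; apply: Bconv_ge0 => y; apply: g0; exact: itv0_ge0 st.
- by apply: measurable_Bconv_time => // s; exact: itv0_ge0.
apply: eq_integral => s; rewrite inE/= => /(itv0_ge0 (lexx 0)) s0.
rewrite BconvD//; try exact: tmeas_slice.
- by move=> y; exact: f0.
- by move=> y; exact: g0.
Qed.

Lemma duhamel_le f x t (k : R -> R) : tnneg f ->
  (forall s, 0 <= s <= t -> (Bconv (f^~ s) x <= (k s)%:E)%E) ->
  (duhamel f x t <= \int[mu]_(s in `[0%R, t]) (k s)%:E)%E.
Proof.
move=> f0 fk; apply: le_integral_ge0 => s /=; rewrite in_itv/= => st; last exact: fk.
by apply: Bconv_ge0 => y; apply: f0; case/andP: st.
Qed.

Lemma duhamel_ge f x s t (k : R -> R) : tnneg f -> 0 <= s ->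
  (forall u, s <= u <= t -> 0 <= k u) ->
  (forall u, s <= u <= t -> ((k u)%:E <= Bconv (f^~ u) x)%E) ->
  (\int[mu]_(u in `[s, t]) (k u)%:E <= duhamel f x t)%E.
Proof.
move=> f0 s0 k0 fk.
apply: (@le_trans _ _ (\int[mu]_(u in `[s, t]) Bconv (f^~ u) x)%E).
  by apply: le_integral_ge0 => u /=; rewrite in_itv/= => st; rewrite ?lee_fin; [exact: k0|exact: fk].
apply: integral_le_subset => u /=; rewrite !in_itv/= => /andP[u0 ut].
  by apply: Bconv_ge0 => y; exact: f0.
by rewrite ut (le_trans s0).
Qed.

Lemma duhamel_nd f x s t : tnneg f -> s <= t -> (duhamel f x s <= duhamel f x t)%E.
Proof.
move=> f0 st; apply: integral_le_subset => u /=; rewrite !in_itv/= => /andP[u0 ut].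
  by apply: Bconv_ge0 => y; exact: f0.
by rewrite u0 (le_trans ut).
Qed.

Lemma duhamel0 f x : duhamel f x 0 = 0%E.
Proof. by rewrite /duhamel set_itv1 integral_set1. Qed.

(** The time interval is split at s. This is the Lipschitz bound in time and, for s = 0, the
    finiteness of the integral. *)
Lemma duhamel_incr f x (s t C : R) : tmeas f -> tnneg f -> 0 <= s <= t ->
  (forall u : R, s <= u <= t -> (Bconv (f^~ u) x <= C%:E)%E) ->
  (duhamel f x t <= duhamel f x s + (C * (t - s))%:E)%E.
Proof.
move=> mf f0 /andP[s0 st] fC.
have E : `[0, t]%classic = (`[0, s]%classic `|` `]s, t]%classic) :> set R.
  apply/seteqP; split => u /=; rewrite !in_itv/=.
    by move=> /andP[u0 ut]; have [us|su] := leP u s; [left|right]; rewrite ?u0 ?us ?su ?ut.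
  by case=> /andP[? ?]; apply/andP; split; lra.
rewrite /duhamel E ge0_integral_setU//=.
- rewrite leeD2l//; apply: (@le_trans _ _ (\int[mu]_(u in `]s, t]) C%:E)%E).
    apply: le_integral_ge0 => u /=; rewrite in_itv/= => /andP[su ut].
      by apply: Bconv_ge0 => y; apply: f0; lra.
    by apply: fC; rewrite ut ltW.
  rewrite integral_cst//= lebesgue_measure_itv/= lte_fin.
  case: ifPn => [_|]; first by rewrite -EFinB -EFinM.
  by rewrite -leNgt => ts; rewrite mule0 (_ : t = s) ?subrr ?mulr0//; lra.
- rewrite -E; apply: measurable_Bconv_time => //; exact: itv0_ge0.
- move=> u us; have u0 : 0 <= u by case: us; rewrite in_itv/= => /andP[? ?]; lra.
  by apply: Bconv_ge0 => y; exact: f0.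
- apply/disj_setPRL => u /=; rewrite !in_itv/= => /andP[su _] /andP[_ us].
  by move: su; rewrite ltNge us.
Qed.

Lemma measurable_duhamel f : tmeas f -> tnneg f ->
  measurable_fun [set: R * n.-tuple R] (fun w => duhamel f w.2 (Num.max w.1 0)).
Proof.
move=> mf f0.
pose F (w : R * n.-tuple R) (s : R) : \bar R :=
  if (0 <= s) && (s <= Num.max w.1 0) then Bconv (f^~ (Num.max s 0)) w.2 else 0%E.
have -> : (fun w => duhamel f w.2 (Num.max w.1 0)) = (fun w => \int[mu]_s F w s)%E.
  apply/funext => w; rewrite /duhamel integral_mkcond; apply: eq_integral => s _.
  rewrite /patch /F mem_setE in_itv/=; case: ifPn => // /andP[s0 _].
  by rewrite max_l.
apply: measurable_integralR; last first.
  move=> w s; rewrite /F; case: ifP => // _; apply: Bconv_ge0 => y.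
  by apply: f0; exact: max0_ge0.
apply: measurable_fun_ifT => //.
  apply: measurable_and; apply: measurable_fun_ler => //.
  apply: (measurableT_comp measurable_max0
    (g := fun w : (R * n.-tuple R) * R => w.1.1)).
  exact: (measurableT_comp measurable_fst measurable_fst).
apply: (measurableT_comp (measurable_Bconv_joint mf f0)
  (g := fun w : (R * n.-tuple R) * R => (w.2, w.1.2))).
apply: measurable_fun_pair => //.
exact: (measurableT_comp measurable_snd measurable_fst).
Qed.

(** Functions and base points vary together: a constant sequence of functions gives lower
    semicontinuity in x, a constant sequence of points the limit of the monotone iteration. *)
Lemma fatou_duhamel (f_ : nat -> n.-tuple R -> R -> R) g (x_ : nat -> n.-tuple R) x t :
  (forall k, tmeas (f_ k)) -> (forall k, tnneg (f_ k)) -> tnneg g ->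
  (forall y s, 0 <= s <= t ->
     (Bker (tsub x y) * (g y s)%:E <= limn_einf (fun k => Bker (tsub (x_ k) y) * (f_ k y s)%:E))%E) ->
  (duhamel g x t <= limn_einf (fun k => duhamel (f_ k) (x_ k) t))%E.
Proof.
move=> mf f0 g0 gf.
apply: (@le_trans _ _ (\int[mu]_(s in `[0%R, t]) limn_einf (fun k => Bconv ((f_ k)^~ s) (x_ k)))%E).
  apply: le_integral_ge0 => s /=; rewrite in_itv/= => st; have /andP[s0 _] := st.
    by apply: Bconv_ge0 => y; exact: g0.
  rewrite /Bconv; apply: le_trans (fatou_intRn _ _).
  - apply: le_intRn => y; last exact: gf.
    by rewrite mule_ge0 ?Bker_ge0// lee_fin g0.
  - by move=> k; apply: measurable_Bconv1; exact: tmeas_slice.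
  - by move=> k y; rewrite mule_ge0 ?Bker_ge0// lee_fin f0.
apply: fatou => // [k|k s /(itv0_ge0 (lexx 0)) s0].
  by apply: measurable_Bconv_time => // s; exact: itv0_ge0.
by apply: Bconv_ge0 => y; exact: f0.
Qed.

Lemma duhamel_lsc f x t (c : R) : tmeas f -> tnneg f ->
  (c%:E < duhamel f x t)%E ->
  exists2 d : R, 0 < d & forall y, eudist y x < d -> (c%:E < duhamel f y t)%E.
Proof.
move=> mf f0 cx; apply: contrapT => H.
have /choice[x_ xP] : forall k : nat, exists y, eudist y x < k.+1%:R^-1 /\ (duhamel f y t <= c%:E)%E.
  move=> k; apply: contrapT => Hk; apply: H; exists (k.+1%:R^-1); first by rewrite invr_gt0.
  move=> y yx; rewrite ltNge; apply/negP => h; apply: Hk; by exists y.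
have xk i : tnth (x_ k) i @[k --> \oo] --> tnth x i.
  apply/cvgrPdist_lt => e e0.
  have : \forall k \near \oo, k.+1%:R^-1 < e.
    have := @cvg_harmonic R => /cvgrPdist_lt/(_ e e0).
    by apply: filterS => k /=; rewrite sub0r normrN ger0_norm ?invr_ge0.
  apply: filterS => k ke; rewrite distrC.
  have [h1 _] := xP k; apply: le_lt_trans (lt_trans h1 ke).
  by have := tnth_le_eunorm (tsub (x_ k) x) i; rewrite tnth_mktuple.
suff : (duhamel f x t <= c%:E)%E by rewrite leNgt cx.
apply: (@le_trans _ _ (limn_einf (fun k => duhamel f (x_ k) t))).
  apply: (fatou_duhamel (f_ := fun=> f)) => // y s /andP[s0 _].
  by apply: Bker_lsc => //; exact: f0.
by apply: limn_einf_le => k; have [] := xP k.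
Qed.

(** (1 - u) e^u <= 1 for every u, and the hypothesis says (1 + e)(1 - u) >= 1. *)
Lemma expR_le_inv (u e : R) : 0 < e -> u * (1 + e) <= e -> expR u <= 1 + e.
Proof.
move=> e0 ue.
have h1 : (1 - u) * expR u <= 1.
  have := expR_ge1Dx (- u); rewrite expRN => h.
  by rewrite -ler_pdivlMr ?expR_gt0// mul1r.
have E0 := expR_gt0 u.
have : (1 + e) * ((1 - u) * expR u) <= 1 + e by nra.
rewrite mulrA; have : expR u <= (1 + e) * (1 - u) * expR u by rewrite ler_peMl//; lra.
lra.
Qed.

Lemma wt_le (M b a : R) x : 1 <= M -> 0 <= b -> b <= a ->
  wt M b x <= (M + n%:R) `^ b * (1 + eunorm x) `^ a.
Proof.
move=> M1 b0 ba; have e0 := eunorm_ge0 x; have l0 := l1_ge0 x.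
have n0 : 0 <= n%:R :> R by [].
apply: (@le_trans _ _ (((M + n%:R) * (1 + eunorm x)) `^ b)).
  rewrite ge0_ler_powR ?nnegrE//; [lra|rewrite mulr_ge0; lra|].
  have := l1_le_eunorm x; nra.
rewrite powRM; [|lra|lra].
by rewrite ler_wpM2l ?powR_ge0// ler_powR//; lra.
Qed.

Lemma fine_leZ (k : R) (u v : \bar R) : u \is a fin_num -> v \is a fin_num ->
  (u <= k%:E * v)%E -> fine u <= k * fine v.
Proof. by move=> uf vf; rewrite -lee_fin EFinM !fineK. Qed.

Lemma fine_leD (k : R) (u v : \bar R) : u \is a fin_num -> v \is a fin_num ->
  (u <= v + k%:E)%E -> fine u <= fine v + k.
Proof. by move=> uf vf; rewrite -lee_fin EFinD !fineK. Qed.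

Lemma fine_lt_EFin (k : R) (u : \bar R) : u \is a fin_num ->
  (k%:E < u)%E -> k < fine u.
Proof. by move=> uf; rewrite -lte_fin fineK. Qed.

Lemma divD1_mul_le (e g : R) : 0 <= g -> 0 <= e -> e / (g + 1) * g <= e.
Proof. by move=> g0 e0; rewrite mulrAC ler_pdivrMr ?ler_wpM2l//; lra. Qed.

Lemma dist_lt_of_sums (fx fy hx hy gx gy e : R) : fx + hx = gx -> fy + hy = gy ->
  fx - e / 3 < fy -> hx - e / 3 < hy -> gy <= gx + e / 3 -> 0 < e -> `|fy - fx| < e.
Proof. by move=> <- <- *; rewrite ltr_norml; apply/andP; split; lra. Qed.

(** * Regularity of Duhamel integrals of functions below a weight *)

Section Regularity.
Variables (f : n.-tuple R -> R -> R) (a b M K : R).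
Hypotheses (mf : tmeas f) (f0 : tnneg f) (b0 : 0 <= b) (ba : b <= a) (M1 : 1 <= M) (K0 : 0 <= K).
Hypothesis BK : forall x, (Bconv (wt M b) x <= (K * wt M b x)%:E)%E.
Hypothesis fC : forall T : R, 0 <= T -> exists2 C : R, 0 <= C &
  forall y (s : R), 0 <= s <= T -> f y s <= C * wt M b y.

Let w0 y : 0 <= wt M b y.
Proof. by rewrite ltW// wt_gt0. Qed.

Let Bf (T C : R) x : 0 <= C -> (forall y (s : R), 0 <= s <= T -> f y s <= C * wt M b y) ->
  forall s : R, 0 <= s <= T -> (Bconv (f^~ s) x <= (C * (K * wt M b x))%:E)%E.
Proof.
move=> C0 h s sT.
apply: (@le_trans _ _ (Bconv (fun y => C * wt M b y) x)).
  by apply: le_Bconv => y; [apply: f0; case/andP: sT|exact: h].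
rewrite BconvZ//; last exact: measurable_wt.
by rewrite EFinM lee_wpmul2l ?lee_fin.
Qed.

Lemma duhamel_fin_num x t : 0 <= t -> duhamel f x t \is a fin_num.
Proof.
move=> t0; have [C C0 h] := fC t0.
rewrite ge0_fin_numE ?duhamel_ge0//.
apply: (@le_lt_trans _ _ (duhamel f x 0 + (C * (K * wt M b x) * (t - 0))%:E)%E).
  by apply: duhamel_incr; rewrite ?lexx ?t0//; exact: Bf.
by rewrite duhamel0 add0e ltry.
Qed.

(** Lower semicontinuity holds for the integrals of [f] and of [H] = C w - f alike, and these add up
    to the integral of the weight, which is upper semicontinuous by [Bconv_wt_shift]. Hence both are
    continuous. *)
Lemma duhamel_continuous x (t e : R) : 0 <= t -> 0 < e -> exists2 d : R, 0 < d &
  forall y, eudist y x < d -> `|fine (duhamel f y t) - fine (duhamel f x t)| < e.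
Proof.
move=> t0 e0; have [C C0 h] := fC t0.
pose W (y : n.-tuple R) (_ : R) : R := C * wt M b y.
(* The bound on [f] is known only up to time t; truncation at 0 keeps the difference nonnegative
   later on. *)
pose H y (s : R) := Num.max (C * wt M b y - f y s) 0.
have mw : tmeas W.
  by apply: tmeas_space; apply: measurable_funM => //; exact: measurable_wt.
have mH : tmeas H.
  apply: measurable_maxr => //; apply: measurable_funB => //.
have H0 : tnneg H by move=> y s s0; exact: max0_ge0.
have w00 : tnneg W by move=> y s _; rewrite mulr_ge0.
have G y : (duhamel f y t + duhamel H y t = duhamel W y t)%E.
  rewrite -duhamelD//; apply: eq_duhamel => z s st; rewrite /H max_l; first by rewrite addrC subrK.
  by rewrite subr_ge0 h.
have GE y : duhamel W y t = ((C * t)%:E * Bconv (wt M b) y)%E.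
  rewrite /duhamel /W BconvZ//; last exact: measurable_wt.
  rewrite integral_cst//= lebesgue_measure_itv/= lte_fin; case: ifPn => [_|].
    by rewrite sube0 muleAC EFinM.
  by rewrite -leNgt => t1; rewrite (_ : t = 0) ?mulr0 ?mule0 ?mul0e//; lra.
have Gfin y : duhamel W y t \is a fin_num.
  rewrite GE fin_numM// ge0_fin_numE ?Bconv_ge0//.
  by apply: le_lt_trans (BK y) _; rewrite ltry.
have ffin y : duhamel f y t \is a fin_num by exact: duhamel_fin_num.
have Hfin y : duhamel H y t \is a fin_num.
  rewrite ge0_fin_numE ?duhamel_ge0//.
  by apply: le_lt_trans (_ : (duhamel W y t < +oo)%E);
    rewrite ?ltey_eq ?Gfin// -G leeDr// duhamel_ge0.
have Gr y : fine (duhamel f y t) + fine (duhamel H y t) =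
    fine (duhamel W y t).
  by rewrite -fineD// G.
set g := fun y => fine (duhamel W y t) in Gr.
have g0 : 0 <= g x by rewrite fine_ge0// duhamel_ge0.
have [d1 d10 D1] : exists2 d : R, 0 < d & forall y, eudist y x < d ->
    fine (duhamel f x t) - e / 3 < fine (duhamel f y t).
  have [|d d0 D] := @duhamel_lsc f x t (fine (duhamel f x t) - e / 3) mf f0.
    by rewrite -[X in (_ < X)%E](fineK (ffin x)) lte_fin; lra.
  by exists d => // y /D; exact: fine_lt_EFin.
have [d2 d20 D2] : exists2 d : R, 0 < d & forall y, eudist y x < d ->
    fine (duhamel H x t) - e / 3 < fine (duhamel H y t).
  have [|d d0 D] := @duhamel_lsc H x t (fine (duhamel H x t) - e / 3) mH H0.
    by rewrite -[X in (_ < X)%E](fineK (Hfin x)) lte_fin; lra.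
  by exists d => // y /D; exact: fine_lt_EFin.
pose eta := e / 3 / (g x + 1).
have eta0 : 0 < eta by rewrite !divr_gt0//; lra.
(* A distance below eta / q gives b l1(y - x) (1 + eta) <= eta, the hypothesis of [expR_le_inv]. *)
pose q := (b * n%:R + 1) * (1 + eta).
have q0 : 0 < q by rewrite mulr_gt0// ?ltr_wpDl ?mulr_ge0//; lra.
have D3 y : eudist y x < eta / q -> g y <= g x + e / 3.
  rewrite ltr_pdivlMr// => yx.
  have ed := eudist_ge0 y x.
  have hexp : expR (b * l1 (tsub y x)) <= 1 + eta.
    apply: expR_le_inv => //.
    have l1n := l1_le_eunorm (tsub y x); rewrite -/(eudist y x) in l1n.
    have : b * l1 (tsub y x) <= b * (n%:R * eudist y x) by rewrite ler_wpM2l.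
    move=> hb; apply: (@le_trans _ _ (b * (n%:R * eudist y x) * (1 + eta))).
      by rewrite ler_wpM2r//; lra.
    apply: le_trans (ltW yx); rewrite /q; nra.
  have : (duhamel W y t <=
     (1 + eta)%:E * duhamel W x t)%E.
    rewrite !GE muleCA lee_wpmul2l ?lee_fin ?mulr_ge0//.
    apply: (le_trans (Bconv_wt_shift x y M1 b0)); rewrite lee_wpmul2r ?lee_fin//.
    exact: Bconv_ge0.
  move=> /(fine_leZ (Gfin y) (Gfin x)) hg.
  apply: (le_trans hg); rewrite -/(g x) mulrDl mul1r lerD2l.
  by apply: divD1_mul_le => //; rewrite divr_ge0// ltW.
exists (Num.min d1 (Num.min d2 (eta / q))).
  by rewrite !lt_min d10 d20 divr_gt0.
move=> y; rewrite !lt_min => /andP[yd1 /andP[yd2 yd3]].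
exact: (dist_lt_of_sums (Gr x) (Gr y) (D1 y yd1) (D2 y yd2) (D3 y yd3) e0).
Qed.

Lemma duhamel_Zinf : Zinf a (fun x t => fine (duhamel f x t)).
Proof.
pose A := (M + n%:R) `^ b.
have A0 : 0 <= A by exact: powR_ge0.
have wA x : wt M b x <= A * (1 + eunorm x) `^ a by exact: wt_le.
split.
  move=> t'; move: (t' : R) => {t'} t t0.
  split; first by move=> x e e0; exact: duhamel_continuous.
  have [C C0 h] := fC t0.
  (* 2^a comes from 1 + |x| <= 2 |x| once |x| >= 1. *)
  exists (C * K * t * A * 2 `^ a), 1 => x x1.
  rewrite ger0_norm ?fine_ge0 ?duhamel_ge0//.
  rewrite -lee_fin fineK ?duhamel_fin_num//.
  apply: (@le_trans _ _ (duhamel f x 0 + (C * (K * wt M b x) * (t - 0))%:E)%E).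
    by apply: duhamel_incr; rewrite ?lexx ?t0//; exact: Bf.
  rewrite duhamel0 add0e lee_fin subr0.
  have -> : C * (K * wt M b x) * t = C * K * t * wt M b x by ring.
  rewrite -!mulrA; do 3 (rewrite ler_wpM2l//).
  apply: (le_trans (wA x)); rewrite ler_wpM2l// -powRM ?ler0n ?eunorm_ge0//.
  apply: ge0_ler_powR; rewrite ?nnegrE ?addr_ge0 ?mulr_ge0 ?eunorm_ge0//.
    exact: le_trans b0 ba.
  by rewrite mulr2n mulrDl mul1r lerD2r.
move=> t'; move: (t' : R) => {t'} t0 t00 e e0.
have T0 : 0 <= t0 + 1 by lra.
have [C C0 h] := fC T0.
have ACK : 0 <= A * C * K by rewrite !mulr_ge0.
(* The 1 keeps t inside [0, t0 + 1], where [C] is valid; the quotient makes A C K |t - t0| at most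
   [e]. *)
exists (Num.min 1 (e / (A * C * K + 1))); first by rewrite lt_min ltr01 divr_gt0//; lra.
move=> t'; move: (t' : R) => {t'} t t1; rewrite lt_min => /andP[td1 td2] x.
have P0 : 0 <= (1 + eunorm x) `^ a by exact: powR_ge0.
have key (s u : R) : 0 <= s -> s <= u -> u <= t0 + 1 -> u - s < e / (A * C * K + 1) ->
    `|fine (duhamel f x u) - fine (duhamel f x s)| <= e * (1 + eunorm x) `^ a.
  move=> s0 su uT us.
  have u0 : 0 <= u by lra.
  have h1 : (duhamel f x s <= duhamel f x u)%E by exact: duhamel_nd.
  have h2 : (duhamel f x u <= duhamel f x s + (C * (K * wt M b x) * (u - s))%:E)%E.
    apply: duhamel_incr; rewrite ?s0 ?su// => v /andP[sv vu].
    by apply: (Bf (T := t0 + 1)) => //; apply/andP; split; lra.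
  have fs := duhamel_fin_num x s0; have fu := duhamel_fin_num x u0.
  have {}h1 := fine_le fs fu h1.
  have {}h2 := fine_leD fu fs h2.
  rewrite ger0_norm ?subr_ge0//.
  have h3 : C * (K * wt M b x) * (u - s) <= (A * C * K) * (u - s) * (1 + eunorm x) `^ a.
    have : C * K * (u - s) * wt M b x <= C * K * (u - s) * (A * (1 + eunorm x) `^ a).
      by rewrite ler_wpM2l// !mulr_ge0// subr_ge0.
    lra.
  have h4 : (A * C * K) * (u - s) <= e.
    have : (A * C * K + 1) * (u - s) < e by rewrite mulrC -ltr_pdivlMr//; lra.
    have : 0 <= u - s by lra.
    lra.
  have := ler_wpM2r P0 h4; lra.
have [tt0|t0t] := leP t t0.
  rewrite distrC; apply: key => //; first lra.
  by move: td2; rewrite distrC ger0_norm ?subr_ge0.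
move: td1 td2; rewrite ger0_norm; last lra.
by move=> td1 td2; apply: key; lra.
Qed.

End Regularity.
End Duhamel.

(** * Lower bounds outside the unit ball and limits of geometric means *)

Section Profiles.
Context {R : realType} {n : nat}.
Local Notation mu := (@lebesgue_measure R).
Implicit Types (x y z : n.-tuple R).

(** The potential is bounded below only where |y| >= 1, so the unit ball is discarded in the lower
    estimates. *)
Definition outside (G : n.-tuple R -> R) y : R := if 1 <= eunorm y then G y else 0.

Lemma measurable_outside G : measurable_fun setT G -> measurable_fun setT (outside G).
Proof.
move=> mG; apply: measurable_fun_ifT => //.
by apply: measurable_fun_ler => //; exact: measurable_eunorm.
Qed.

Lemma outside_ge0 G y : (forall y, 0 <= G y) -> 0 <= outside G y.
Proof. by move=> G0; rewrite /outside; case: ifP. Qed.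

Lemma measurable_eunorm_powR (b : R) : measurable_fun setT (fun y : n.-tuple R => eunorm y `^ b).
Proof. exact: (measurableT_comp (measurable_powR b) measurable_eunorm). Qed.

Lemma Bconv_outside_eunorm (e b : R) x :
  ((e * eunorm x `^ b)%:E <= intRn (fun y => if (1 <= eudist x y)%R
      then (Bker y * (eudist x y `^ b)%:E)%E else 0%E))%E ->
  ((e * eunorm x `^ b)%:E <= Bconv (outside (fun y => eunorm y `^ b)%R) x)%E.
Proof.
move=> h; apply: (le_trans h); rewrite Bconv_reflect; last 2 first.
- by apply: measurable_outside; exact: measurable_eunorm_powR.
- by move=> y; apply: outside_ge0 => z; exact: powR_ge0.
apply: le_intRn => y; first by case: ifP => // _; rewrite mule_ge0 ?Bker_ge0 ?lee_fin ?powR_ge0.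
by rewrite /outside /eudist; case: ifP => // _; rewrite mule0.
Qed.

(** For each x some unit box of y at bounded distance from 0 satisfies |x - y| >= 1; there the
    kernel is bounded below and the exponential loses a bounded factor. Uniformity in h <= eta is
    needed because the iteration changes the decay rate at each step. *)
Lemma Bconv_outside_exp (eta : R) : (0 < n)%N -> 0 <= eta ->
  exists2 e : R, 0 < e & forall (h : R) x, 0 <= h <= eta ->
    ((e * expR (- (h * l1 x)))%:E <= Bconv (outside (fun y => expR (- (h * l1 y)))) x)%E.
Proof.
move=> n0 eta0; have [K K0 hK] := @Bker_ge R n.
pose N : R := 2 * n%:R.
have N0 : 0 <= N by rewrite mulr_ge0.
exists (expR (- (K * (1 + N))) * expR (- (eta * N))); first by rewrite mulr_gt0 ?expR_gt0.
move=> h x /andP[h0 he].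
have mG : measurable_fun setT (fun y : n.-tuple R => expR (- (h * l1 y))).
  apply: measurableT_comp => //; apply: measurableT_comp => //.
  by apply: measurable_funM => //; exact: measurable_l1.
rewrite Bconv_reflect; last 2 first.
- exact: measurable_outside.
- by move=> y; apply: outside_ge0 => z; exact: expR_ge0.
(* y_i ranges over [1, 2] if x_i <= 0 and over [-2, -1] otherwise, so |x_i - y_i| >= 1 and l1(y) <=
   2n = [N]. *)
pose b (i : 'I_n) : R := if tnth x i <= 0 then 1 else -2.
have := @intRn_box_ge R n (fun y => (Bker y * (outside (fun y => expR (- (h * l1 y))) (tsub x y))%:E)%E)
  b 1 (expR (- (K * (1 + N))) * expR (- (eta * N)) * expR (- (h * l1 x))).
rewrite expr1n mulr1; apply => //.
- by move=> y; rewrite mule_ge0 ?Bker_ge0// lee_fin outside_ge0// => z; exact: expR_ge0.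
move=> y yb.
have yN : l1 y <= N.
  rewrite /l1 /N mulr_natr -[X in _ <= _ *+ X](card_ord n) -sumr_const.
  apply: ler_sum => i _; have := yb i; rewrite /b.
  by case: ifP => _ /andP[h1 h2]; rewrite ler_norml; apply/andP; split; lra.
have xy1 : 1 <= eunorm (tsub x y).
  apply: le_trans (tnth_le_eunorm _ (Ordinal n0)); rewrite tnth_mktuple.
  have := yb (Ordinal n0); rewrite /b; set u := tnth x _; set v := tnth y _.
  case: ifPn => [u0|]; last rewrite -ltNge => u0; move=> /andP[h1 h2].
    by rewrite distrC; apply: le_trans (ler_norm _); lra.
  by apply: le_trans (ler_norm _); lra.
rewrite /outside xy1 -mulrA EFinM; apply: lee_pmul.
- by rewrite lee_fin expR_ge0.
- by rewrite lee_fin mulr_ge0 ?expR_ge0.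
- apply: le_trans (hK y); rewrite lee_fin ler_expR lerN2 ler_wpM2l//; lra.
- rewrite lee_fin -expRD ler_expR.
  have := l1_tsub x y; have := l1_ge0 y; have := l1_ge0 (tsub x y) => a1 a2 a3.
  have : h * l1 (tsub x y) <= h * (l1 x + N) by rewrite ler_wpM2l//; lra.
  have : h * N <= eta * N by rewrite ler_wpM2r.
  lra.
Qed.

Lemma geometric_closed (p g w A : R) : 0 < p -> p < 1 ->
  (forall k : nat, g + p ^+ k * w <= A) -> g <= A.
Proof.
move=> p0 p1 h; rewrite leNgt; apply/negP => gA.
have [w0|w0] := leP 0 w.
  have := h 0%N; rewrite expr0 mul1r; lra.
have e0 : 0 < (g - A) / (- w) by rewrite divr_gt0//; lra.
have : p ^+ k @[k --> \oo] --> 0 by apply: cvg_expr; rewrite ger0_norm// ltW.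
move=> /cvgrPdist_lt/(_ _ e0)[k _ /(_ k (leqnn k))] /=.
rewrite sub0r normrN ger0_norm ?exprn_ge0 ?(ltW p0)// ltr_pdivlMr; last lra.
have := h k; lra.
Qed.

(** For g > 0, A^q g^(1-q) = g (A/g)^q >= g + q g ln(A/g), and the last term vanishes as q = p^k
    tends to 0. *)
Lemma powR_interp_closed (p A g M : R) : 0 < p -> p < 1 -> 0 < A -> 0 <= g -> 0 <= M ->
  (forall k : nat, A `^ (p ^+ k) * g `^ (1 - p ^+ k) <= M) -> g <= M.
Proof.
move=> p0 p1 A0 g0 M0 h.
have [->//|gn0] := eqVneq g 0.
have gp : 0 < g by rewrite lt_neqAle eq_sym gn0.
apply: (@geometric_closed p _ (g * ln (A / g))) => // k.
apply: le_trans (h k); set q := p ^+ k.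
have -> : A `^ q * g `^ (1 - q) = g * (A / g) `^ q.
  rewrite powRB ?gn0 ?implybT// powRr1 ?(ltW gp)//.
  rewrite powRM ?(ltW A0) ?invr_ge0 ?(ltW gp)//.
  have -> : g^-1 `^ q = (g `^ q)^-1.
    by rewrite -[g^-1]powR_inv1 ?(ltW gp)// -powRrM mulN1r powRN.
  by ring.
have Ag : 0 < A / g by rewrite divr_gt0.
rewrite mulrCA -{1}[g]mulr1 -mulrDr ler_wpM2l// /powR gt_eqF//.
exact: expR_ge1Dx.
Qed.

End Profiles.

(** * The integral equation and the iteration of lower bounds *)

Section Problem.
Context {R : realType} {n : nat}.
Local Notation mu := (@lebesgue_measure R).
Implicit Types (x y z : n.-tuple R).

Definition forcing (p : R) (Psi u : n.-tuple R -> R -> R) y (t : R) : R :=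
  u y t + Psi y t * u y t `^ p.

(** The equation for mu = e^t u with its two integrals merged; measurability is included because
    linearity and Fatou require it. *)
Definition dsol (p a : R) (Psi u : n.-tuple R -> R -> R) : Prop :=
  [/\ tmeas u, tnneg u, Zinf a u &
   forall x t, 0 <= t -> (u x t)%:E = duhamel (forcing p Psi u) x t].

Lemma tmeas_forcing p Psi u : tmeas Psi -> tmeas u -> tmeas (forcing p Psi u).
Proof. by move=> mP mu'; apply: tmeasD => //; apply: tmeasM => //; exact: tmeas_powR. Qed.

Lemma tnneg_forcing p Psi u : tnneg Psi -> tnneg u -> tnneg (forcing p Psi u).
Proof. by move=> P0 u0 y t t0; rewrite addr_ge0 ?u0// mulr_ge0 ?P0 ?powR_ge0. Qed.

Lemma le_forcing p Psi (u v : n.-tuple R -> R -> R) y t : 0 <= p -> 0 <= Psi y t ->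
  0 <= u y t -> u y t <= v y t -> forcing p Psi u y t <= forcing p Psi v y t.
Proof.
move=> p0 P0 u0 uv; rewrite lerD// ler_wpM2l// ge0_ler_powR ?nnegrE//.
exact: le_trans uv.
Qed.

Lemma dsol_nd p a Psi u x (s t : R) : tnneg Psi -> dsol p a Psi u ->
  0 <= s -> s <= t -> u x s <= u x t.
Proof.
move=> P0 [mu' u0 _ E] s0 st; rewrite -lee_fin !E//; last exact: le_trans st.
by apply: duhamel_nd => //; exact: tnneg_forcing.
Qed.

Lemma dsol0 p a Psi u x : dsol p a Psi u -> u x 0 = 0.
Proof. by move=> [_ _ _ E]; have := E x 0 (lexx 0); rewrite duhamel0 => -[]. Qed.

(** One step of the iteration: integration in time gains one power of t - s and the divisor r +
    1. *)
Lemma duhamel_outside_ge (f : n.-tuple R -> R -> R) (G : n.-tuple R -> R) (c r k s t : R) x :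
  tnneg f -> measurable_fun setT G -> (forall y, 0 <= G y) ->
  0 <= c -> 0 <= r -> 0 <= k -> 0 <= s -> s <= t ->
  (forall y u, s <= u <= t -> 1 <= eunorm y -> c * (u - s) `^ r * G y <= f y u) ->
  (k%:E <= Bconv (outside G) x)%E ->
  ((c * k * ((t - s) `^ (r + 1) / (r + 1)))%:E <= duhamel f x t)%E.
Proof.
move=> f0 mG G0 c0 r0 k0 s0 st fG kB.
have h1 : (\int[mu]_(u in `[s, t]) (c * k * (u - s) `^ r)%:E <= duhamel f x t)%E.
  apply: duhamel_ge => // u su; first by rewrite !mulr_ge0 ?powR_ge0.
  have cu0 : 0 <= c * (u - s) `^ r by rewrite mulr_ge0 ?powR_ge0.
  have u0 : 0 <= u by case/andP: su => su _; exact: le_trans su.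
  apply: (@le_trans _ _ (Bconv (fun y => c * (u - s) `^ r * outside G y) x)).
    rewrite BconvZ//; [|exact: measurable_outside|by move=> y; exact: outside_ge0].
    by rewrite mulrAC EFinM lee_wpmul2l ?lee_fin.
  apply: le_Bconv => y; first by rewrite mulr_ge0 ?outside_ge0.
  rewrite /outside; case: ifPn => [y1|_]; first exact: fG.
  by rewrite mulr0 f0.
apply: le_trans h1.
under eq_integral do rewrite EFinM.
rewrite ge0_integralZl_EFin ?mulr_ge0//.
- by rewrite EFinM lee_wpmul2l ?lee_fin ?mulr_ge0// integral_powR_ge.
- by move=> u _; rewrite lee_fin powR_ge0.
- apply/measurable_EFinP; apply: measurable_funTS.
  by apply: (measurableT_comp (measurable_powR r)); exact: measurable_funB.
Qed.

(* Iterating u >= duhamel (Psi * u^p) from a lower bound A improves it to the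
   geometric means A^(p^k) g^(1-p^k) of A and a stationary profile g. *)
Lemma lower_iteration (p a : R) Psi u (sigma thl l kap s T : R) (A B : n.-tuple R -> R) :
  0 < p -> p < 1 -> dsol p a Psi u -> tnneg Psi -> 0 <= s ->
  0 < thl -> 0 < l -> 0 < kap ->
  measurable_fun setT A -> measurable_fun setT B ->
  (forall y, 0 < A y) -> (forall y, 0 <= B y) ->
  (forall y t, s <= t <= T -> 1 <= eunorm y -> thl * l * eunorm y `^ sigma <= Psi y t) ->
  (forall x t, s <= t <= T -> A x <= u x t) ->
  (forall k x, ((kap * (A x `^ (p ^+ k.+1) * B x `^ (1 - p ^+ k.+1)))%:E <=
     Bconv (outside (fun y => eunorm y `^ sigma * (A y `^ (p ^+ k.+1) * B y `^ (p - p ^+ k.+1)))%R) x)%E) ->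
  forall x t, s <= t <= T ->
    (thl * l * kap * (1 - p) * (t - s)) `^ (1 - p)^-1 * B x <= u x t.
Proof.
move=> p0 p1 su P0 s0 th0 l0 k0 mA mB A0 B0 hP hA hB.
have [mu' u0 _ E] := su.
set m := (1 - p)^-1; set r := thl * l * kap * (1 - p).
have p1' : 0 < 1 - p by rewrite subr_gt0.
have m0 : 0 < m by rewrite invr_gt0.
have mE : m * p + 1 = m by rewrite /m; field; rewrite gt_eqF.
have r0 : 0 < r by rewrite !mulr_gt0.
have q1 k : 0 < p ^+ k <= 1 by rewrite exprn_gt0//= exprn_ile1// ltW.
have step k x t : s <= t <= T ->
    A x `^ (p ^+ k) * ((r * (t - s)) `^ m * B x) `^ (1 - p ^+ k) <= u x t.
  elim: k x t => [|k IH] x t st.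
    by rewrite expr0 subrr powRr0 mulr1 powRr1 ?(ltW (A0 _))// hA.
  have [st1 tT] : s <= t /\ t <= T by apply/andP.
  have t0 : 0 <= t by exact: le_trans st1.
  set q := p ^+ k.+1.
  have qk : p ^+ k * p = q by rewrite /q exprSr.
  have /andP[q0 qle] := q1 k.+1; rewrite -/q in q0 qle.
  have qp : q <= p by rewrite -qk ler_piMl// ?(ltW p0)//; case/andP: (q1 k).
  have pq0 : 0 <= p - q by rewrite subr_ge0.
  have rr0 : 0 <= m * (p - q) by rewrite mulr_ge0// ltW.
  have := @duhamel_outside_ge (forcing p Psi u)
    (fun y => eunorm y `^ sigma * (A y `^ q * B y `^ (p - q)))
    (thl * l * r `^ (m * (p - q))) (m * (p - q))
    (kap * (A x `^ q * B x `^ (1 - q))) s t x.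
  rewrite -E// lee_fin => h; apply: (le_trans _ (h _ _ _ _ _ _ _ _ _ _)) => //.
  (* By m p + 1 = m the new time exponent is exactly that of the next geometric mean. *)
  - have mq : m * (p - q) + 1 = m * (1 - q).
      by rewrite !mulrBr mulr1 -addrA [- _ + 1]addrC addrA mE.
    rewrite mq.
    have e0 : 0 <= m * (1 - q) by rewrite mulr_ge0 ?(ltW m0)// subr_ge0.
    rewrite powRM ?powR_ge0// -powRrM.
    have ts0 : 0 <= t - s by rewrite subr_ge0.
    have -> : (r * (t - s)) `^ (m * (1 - q)) = r * r `^ (m * (p - q)) * (t - s) `^ (m * (1 - q)).
      rewrite powRM ?(ltW r0)//; congr (_ * _).
      by rewrite -mq addrC powRD ?(gt_eqF r0) ?implybT// powRr1 ?(ltW r0).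
    set X1 := A x `^ q; set X2 := B x `^ _; set X3 := (t - s) `^ _; set X4 := r `^ _.
    have X0 : 0 <= X1 * X2 * X3 * X4 by rewrite !mulr_ge0 ?powR_ge0.
    have [qe|qn] := eqVneq (m * (1 - q)) 0.
      have q1' : q = 1 by move/eqP: qe; rewrite mulf_eq0 gt_eqF//= subr_eq0 => /eqP.
      by move: qp; rewrite q1' leNgt p1.
    have ep : 0 < m * (1 - q) by rewrite lt_neqAle eq_sym qn.
    (* Integration divides by m (1 - q) <= m, so the single constant [r], with divisor m, serves all
       steps. *)
    have : r <= thl * l * kap / (m * (1 - q)).
      rewrite /r ler_wpM2l ?mulr_ge0 ?(ltW th0) ?(ltW l0) ?(ltW k0)//.
      rewrite -[1 - p]invrK -/m lef_pV2 ?posrE//.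
      by rewrite ler_piMr ?(ltW m0)// lerBlDr lerDl ltW.
    move=> /(ler_wpM2r X0) hr; apply: le_trans (le_trans hr _).
      by rewrite le_eqVlt; apply/orP; left; apply/eqP; ring.
    by rewrite le_eqVlt; apply/orP; left; apply/eqP; ring.
  - exact: tnneg_forcing.
  - apply: measurable_funM; first exact: measurable_eunorm_powR.
    by apply: measurable_funM; [exact: (measurableT_comp (measurable_powR _) mA)|exact: (measurableT_comp (measurable_powR _) mB)].
  - by move=> y; rewrite !mulr_ge0 ?powR_ge0.
  - by rewrite !mulr_ge0 ?powR_ge0 ?(ltW th0) ?(ltW l0).
  - by rewrite !mulr_ge0 ?powR_ge0 ?(ltW k0).
  - move=> y v /andP[sv vt] y1.
    have v0 : 0 <= v by exact: le_trans sv.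
    have svT : s <= v <= T by rewrite sv (le_trans vt).
    have vs0 : 0 <= v - s by rewrite subr_ge0.
    have h1 := hP y v svT y1.
    have h2 : (A y `^ (p ^+ k) * ((r * (v - s)) `^ m * B y) `^ (1 - p ^+ k)) `^ p <= u y v `^ p.
      by rewrite ge0_ler_powR ?nnegrE ?mulr_ge0 ?powR_ge0 ?(ltW p0) ?u0// IH.
    have h3 : r `^ (m * (p - q)) * (v - s) `^ (m * (p - q)) * (A y `^ q * B y `^ (p - q)) <= u y v `^ p.
      apply: le_trans h2; rewrite powRM ?powR_ge0// -powRrM qk.
      rewrite -powRrM (_ : (1 - p ^+ k) * p = p - q); last by rewrite mulrBl mul1r qk.
      rewrite powRM ?powR_ge0// -powRrM powRM ?(ltW r0)//.
      by rewrite le_eqVlt; apply/orP; left; apply/eqP; ring.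
    have h4 := ler_pM _ _ h1 h3.
    rewrite /forcing; apply: (@le_trans _ _ (Psi y v * u y v `^ p)); last by rewrite lerDr u0.
    apply: le_trans (h4 _ _); rewrite ?mulr_ge0 ?powR_ge0 ?(ltW th0) ?(ltW l0)//.
    by rewrite le_eqVlt; apply/orP; left; apply/eqP; ring.
  - exact: hB.
move=> x t st; apply: (@powR_interp_closed _ p (A x)) => //.
- by rewrite mulr_ge0 ?powR_ge0.
- by apply: u0; case/andP: st => st _; exact: le_trans st.
- by move=> k; exact: step.
Qed.

(** Continuity makes [u] positive near x0 at time t0, monotonicity keeps it so afterwards, and the
    exponential lower bound on the kernel spreads it over the whole space. *)
Lemma dsol_exp_lower p a Psi u x0 (t0 s : R) : tnneg Psi -> dsol p a Psi u ->
  0 <= t0 -> t0 < s -> 0 < u x0 t0 ->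
  exists2 c : R, 0 < c & exists2 eta : R, 0 <= eta &
    forall x t, s <= t -> c * expR (- (eta * l1 x)) <= u x t.
Proof.
move=> P0 su t00 t0s ux0; have [mu' u0 [hBC _] E] := su.
have [K K0 hK] := @Bker_ge R n.
have [hc _] := hBC t0 t00.
have e0 : 0 < u x0 t0 / 2 by rewrite divr_gt0.
have [d d0 hd] := hc x0 _ e0.
(* The box of side [h] with corner x0 then lies in the ball of radius [d]. *)
pose h := d / n.+1%:R.
have h0 : 0 < h by rewrite divr_gt0.
have nh : n%:R * h < d.
  by rewrite /h mulrA ltr_pdivrMr// mulrC ltr_pM2l// ltr_nat.
pose m0 := u x0 t0 / 2.
pose c := expR (- (K * (1 + l1 x0 + d))) * m0.
have c0 : 0 < c by rewrite mulr_gt0 ?expR_gt0.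
have hn : 0 < h ^+ n by rewrite exprn_gt0.
exists (c * h ^+ n * (s - t0)); first by apply: (mulr_gt0 (mulr_gt0 c0 hn)); rewrite subr_gt0.
exists K => // x t st.
have s0 : 0 <= s by lra.
apply: (@le_trans _ _ (u x s)); last exact: dsol_nd su _ _.
have fge0 := tnneg_forcing p P0 u0.
rewrite -lee_fin E//.
apply: (@le_trans _ _ (\int[mu]_(v in `[t0, s]) (c * expR (- (K * l1 x)) * h ^+ n)%:E)%E).
  rewrite integral_cst//= lebesgue_measure_itv/= lte_fin t0s -EFinB -EFinM lee_fin.
  by rewrite le_eqVlt; apply/orP; left; apply/eqP; ring.
apply: duhamel_ge => // v /andP[tv vs]; first by rewrite !mulr_ge0 ?expR_ge0// ltW.
have v0 : 0 <= v by lra.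
apply: (intRn_box_ge (b := tnth x0)).
- by rewrite mulr_ge0 ?expR_ge0 ?(ltW c0).
- exact: ltW.
- by move=> y; rewrite mule_ge0 ?Bker_ge0// lee_fin fge0.
move=> y yb.
have ly : l1 (tsub y x0) <= n%:R * h.
  rewrite /l1 mulr_natl -[X in _ <= _ *+ X](card_ord n) -sumr_const.
  apply: ler_sum => i _; rewrite tnth_mktuple; have /andP[y1 y2] := yb i.
  by rewrite ler_norml; apply/andP; split; lra.
have yd : eudist y x0 < d by apply: le_lt_trans nh; apply: le_trans ly; exact: eunorm_le_l1.
have uy : m0 <= forcing p Psi u y v.
  apply: (@le_trans _ _ (u y v)); last by rewrite lerDl mulr_ge0 ?P0 ?powR_ge0.
  apply: (@le_trans _ _ (u y t0)); last exact: dsol_nd su _ _.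
  have := hd y yd; rewrite ltr_norml => /andP[]; rewrite /m0; lra.
have -> : c * expR (- (K * l1 x)) = expR (- (K * (1 + l1 x0 + d + l1 x))) * m0.
  by rewrite /c mulrAC -expRD; congr (expR _ * _); ring.
rewrite EFinM; apply: lee_pmul; rewrite ?lee_fin ?expR_ge0 ?(ltW e0)//.
apply: le_trans (hK _); rewrite lee_fin ler_expR lerN2 ler_wpM2l//.
have := l1_tsub x y.
have : l1 y <= l1 x0 + l1 (tsub y x0).
  rewrite /l1 -big_split/=; apply: ler_sum => i _; rewrite tnth_mktuple.
  by rewrite -{1}(subrK (tnth x0 i) (tnth y i)) addrC ler_normD.
lra.
Qed.

End Problem.

(** * Least constants, absorption and tangents *)

Section RealTools.
Context {R : realType}.
Local Notation mu := (@lebesgue_measure R).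

(** Pointwise bounds pass to the infimum of the constants, so the least one is admissible. This
    replaces a weighted supremum norm and allows [psi] to vanish, as it can at t = 0. *)
Lemma minimal_bound (Z : Type) (P : Z -> Prop) (A psi : Z -> R) :
  (forall z, P z -> 0 <= psi z) ->
  (exists2 D : R, 0 <= D & forall z, P z -> A z <= D * psi z) ->
  exists D0 : R, [/\ 0 <= D0, forall z, P z -> A z <= D0 * psi z &
    forall D, 0 <= D -> (forall z, P z -> A z <= D * psi z) -> D0 <= D].
Proof.
move=> psi0 [D1 D10 hD1].
pose S := [set D : R | 0 <= D /\ forall z, P z -> A z <= D * psi z].
have S1 : S D1 by [].
have Slb : lbound S 0 by move=> D [].
have hS : has_inf S by split; [exists D1|exists 0].
exists (inf S); split.
- by apply: lb_le_inf => //; exists D1.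
- move=> z Pz; have := psi0 z Pz; rewrite le_eqVlt => /predU1P[p0|p0].
    by rewrite -p0 mulr0; have := hD1 z Pz; rewrite -p0 mulr0.
  rewrite -ler_pdivrMr//; apply: lb_le_inf; first by exists D1.
  by move=> D [_ hD]; rewrite ler_pdivrMr// hD.
- by move=> D D0 hD; apply: ge_inf => //; exists 0.
Qed.

(** Dividing by D^p leaves D^(1-p) <= 2B; the resulting bound does not depend on how [D] was known
    to be finite. *)
Lemma self_improve_powR (D B p : R) : 0 < p -> p < 1 -> 0 <= D -> 0 <= B ->
  D <= D / 2 + B * D `^ p -> D <= (2 * B) `^ (1 - p)^-1.
Proof.
move=> p0 p1 D0 B0 h.
have [->|Dn0] := eqVneq D 0; first exact: powR_ge0.
have Dp : 0 < D by rewrite lt_neqAle eq_sym Dn0.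
have p1' : 0 < 1 - p by rewrite subr_gt0.
have h2 : D `^ (1 - p) <= 2 * B.
  rewrite powRB ?Dn0 ?implybT// powRr1// ler_pdivrMr ?powR_gt0//; lra.
have -> : D = (D `^ (1 - p)) `^ (1 - p)^-1 by rewrite -powRrM divff ?gt_eqF// powRr1.
by rewrite ge0_ler_powR ?nnegrE ?powR_ge0 ?mulr_ge0 ?invr_ge0// ltW.
Qed.

(** Concavity: the graph lies below its tangent at u. For w = v / u this is Young's inequality for
    w^p times 1 with exponents 1/p and 1/(1-p). *)
Lemma powR_tangent (p u v : R) : 0 < p -> p < 1 -> 0 < u -> u <= v ->
  v `^ p <= u `^ p + p * (v - u) / u `^ (1 - p).
Proof.
move=> p0 p1 u0 uv.
have p1' : 0 < 1 - p by rewrite subr_gt0.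
have v0 : 0 <= v by rewrite (le_trans (ltW u0)).
pose w := v / u; have w0 : 0 <= w by rewrite divr_ge0// ltW.
have hw : w `^ p <= p * w + (1 - p).
  have := @conjugate_powR R (w `^ p) 1 p^-1 (1 - p)^-1 (powR_ge0 _ _) ler01.
  rewrite !invr_gt0 !invrK => /(_ p0 p1').
  rewrite addrC subrK => /(_ erefl).
  by rewrite mulr1 powR1 -powRrM divff ?gt_eqF// powRr1// mul1r mulrC.
have vE : v = u * w by rewrite /w mulrC divfK ?gt_eqF.
have up : 0 < u `^ p by rewrite powR_gt0.
have -> : u `^ (1 - p) = u / u `^ p.
  by rewrite powRB ?(gt_eqF u0) ?implybT// powRr1// ltW.
rewrite {1}vE powRM ?(ltW u0)//.
have -> : u `^ p + p * (v - u) / (u / u `^ p) = u `^ p * (p * w + (1 - p)).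
  by rewrite vE; field; rewrite !gt_eqF.
by rewrite ler_wpM2l// ltW.
Qed.

(** The power [r1] pays 1 / L and the power [r2], which will be m p, pays 1 / (r2 + 1) = 1 / m. *)
Lemma integral_two_powers_le (c1 c2 r1 r2 e t L : R) :
  0 <= c1 -> 0 <= c2 -> 0 <= r1 -> 0 <= r2 -> 0 <= e -> 0 <= t -> 0 < L ->
  (\int[mu]_(x in `[0%R, t]) ((c1 * (x + e) `^ r1 + c2 * (x + e) `^ r2) * expR (L * x))%:E
   <= ((c1 * (t + e) `^ r1 / L + c2 * (t + e) `^ (r2 + 1) / (r2 + 1)) * expR (L * t))%:E)%E.
Proof.
move=> c10 c20 r10 r20 e0 t0 L0.
have mq r : measurable_fun (`[0%R, t]%classic : set R) (fun x => ((x + e) `^ r * expR (L * x))%:E).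
  apply/measurable_EFinP; apply: measurable_funTS; apply: measurable_funM.
    by apply: (measurableT_comp (measurable_powR r)); exact: measurable_funD.
  by apply: measurableT_comp => //; exact: measurable_funM.
have q0 r x : (0 <= ((x + e) `^ r * expR (L * x))%:E :> \bar R)%E.
  by rewrite lee_fin mulr_ge0 ?powR_ge0 ?expR_ge0.
have -> : (\int[mu]_(x in `[0%R, t]) ((c1 * (x + e) `^ r1 + c2 * (x + e) `^ r2) * expR (L * x))%:E =
   c1%:E * (\int[mu]_(x in `[0%R, t]) ((x + e) `^ r1 * expR (L * x))%:E) +
   c2%:E * (\int[mu]_(x in `[0%R, t]) ((x + e) `^ r2 * expR (L * x))%:E))%E.
  have Z r c : 0 <= c -> (c%:E * (\int[mu]_(x in `[0%R, t]) ((x + e) `^ r * expR (L * x))%:E) =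
      \int[mu]_(x in `[0%R, t]) (c%:E * ((x + e) `^ r * expR (L * x))%:E))%E.
    by move=> c0; rewrite ge0_integralZl_EFin//; exact: mq.
  rewrite !Z// -ge0_integralD//.
  - apply: eq_integral => x _; rewrite -!EFinM -EFinD; congr EFin; ring.
  - by move=> x _; rewrite mule_ge0.
  - by apply: emeasurable_funM => //; exact: mq.
  - by move=> x _; rewrite mule_ge0.
  - by apply: emeasurable_funM => //; exact: mq.
have -> : (c1 * (t + e) `^ r1 / L + c2 * (t + e) `^ (r2 + 1) / (r2 + 1)) * expR (L * t) =
  c1 * ((t + e) `^ r1 * (expR (L * t) / L)) + c2 * (expR (L * t) * ((t + e) `^ (r2 + 1) / (r2 + 1))).
  by ring.
rewrite EFinD; apply: leeD; rewrite EFinM lee_wpmul2l ?lee_fin//.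
  exact: integral_powR_expR_le2.
exact: integral_powR_expR_le.
Qed.

End RealTools.

(** * Weights and a global bound at fixed times *)

Section Weights.
Context {R : realType} {n : nat}.
Implicit Types (x y z : n.-tuple R).

Lemma wt_add (M b c : R) y : 1 <= M -> wt M b y * wt M c y = wt M (b + c) y.
Proof.
move=> M1; rewrite /wt powRD//; apply/implyP => _.
by rewrite gt_eqF// (lt_le_trans ltr01)// (le_trans M1)// lerDl l1_ge0.
Qed.

Lemma eunorm_powR_le_wt (M b : R) y : 1 <= M -> 0 <= b -> eunorm y `^ b <= wt M b y.
Proof.
move=> M1 b0; have := eunorm_le_l1 y; have := l1_ge0 y; have := eunorm_ge0 y => h1 h2 h3.
rewrite ge0_ler_powR ?nnegrE//; lra.
Qed.

(** Connectedness in time: the times with a global bound include 0, and continuity in the weighted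
    norm carries the bound past their supremum. Compactness of balls is avoided. *)
Lemma Zinf_bound (a : R) (u : n.-tuple R -> R -> R) (T : R) : Zinf a u -> 0 <= T ->
  (forall x, u x 0 = 0) -> exists2 C : R, 0 <= C & forall x, u x T <= C * (1 + eunorm x) `^ a.
Proof.
move=> [_ uZ] T0 u0.
pose Q (t : R) := exists2 C : R, 0 <= C & forall x, u x t <= C * (1 + eunorm x) `^ a.
pose S := [set t : R | 0 <= t <= T /\ Q t].
have S0 : S 0.
  split; first by rewrite lexx.
  by exists 0 => // x; rewrite u0 mul0r.
have hS : has_sup S by split; [exists 0|exists T => t [/andP[]]].
pose ts := sup S.
have ts0 : 0 <= ts by apply: ub_le_sup => //; exact: (proj2 hS).
have tsT : ts <= T by apply: ge_sup => //; [exists 0|move=> t [/andP[]]].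
have [d d0 hd] := uZ ts ts0 1 ltr01.
have ext t1 t2 : 0 <= t1 -> 0 <= t2 -> `|t1 - ts| < d -> `|t2 - ts| < d -> Q t1 -> Q t2.
  move=> t10 t20 h1 h2 [C C0 hC]; exists (C + 2); first by rewrite addr_ge0.
  move=> x; have := hd t1 t10 h1 x; have := hd t2 t20 h2 x; have := hC x.
  rewrite !mul1r !ler_norml mulrDl => k1 /andP[_ k2] /andP[k3 _]; lra.
have [t1 [/andP[t10 t1T] Qt1] ht1] := sup_adherent d0 hS; rewrite -/ts in ht1.
have t1s : t1 <= ts by apply: ub_le_sup; [exact: (proj2 hS)|split; rewrite ?t10].
have t1d : `|t1 - ts| < d by rewrite ltr_norml; apply/andP; split; lra.
have [Tts|tsT'] := leP T ts.
  have -> : T = ts by apply/eqP; rewrite eq_le Tts tsT.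
  by apply: (ext t1) => //; rewrite subrr normr0.
pose t2 := Num.min T (ts + d / 2).
have t2a : ts < t2 by rewrite lt_min tsT'/=; lra.
have t2b : t2 <= T by rewrite ge_min lexx.
have t2c : t2 <= ts + d / 2 by rewrite ge_min lexx orbT.
have t20 : 0 <= t2 by lra.
have Q2 : Q t2 by apply: (ext t1) => //; rewrite ltr_norml; apply/andP; split; lra.
have : t2 <= ts by apply: ub_le_sup; [exact: (proj2 hS)|split; rewrite ?t20].
lra.
Qed.

End Weights.

Lemma Zinf_ext (R : realType) (n : nat) (a : R) (u v : n.-tuple R -> R -> R) :
  (forall x (t : R), 0 <= t -> u x t = v x t) -> Zinf a v -> Zinf a u.
Proof.
move=> uv [h1 h2]; split.
  move=> t t0; have [c1 [C [R0 c2]]] := h1 t t0; split.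
    by move=> x e e0; have [d d0 hd] := c1 x e e0; exists d => // y yd; rewrite !uv//; exact: hd.
  by exists C, R0 => x xR; rewrite uv//; exact: c2.
move=> t0 t00 e e0; have [d d0 hd] := h2 t0 t00 e e0; exists d => // t t_ge0 td x.
by rewrite !uv//; exact: hd.
Qed.

(** For b = +oo the product is discontinuous at c = 0, but there the left side is 0 and the
    inequality trivial. *)
Lemma limn_einf_mulr_ge (R : realType) (b : \bar R) (f : nat -> R) (c : R) : (0 <= b)%E ->
  (forall k, 0 <= f k) -> f k @[k --> \oo] --> c ->
  (b * c%:E <= limn_einf (fun k => b * (f k)%:E))%E.
Proof.
move=> b0 f0 fc; have [->|cn0] := eqVneq c 0.
  rewrite mule0; apply: limn_einf_ge; apply: nearW => k.
  by rewrite mule_ge0 ?lee_fin.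
suff : (b * (f k)%:E @[k --> \oo] --> b * c%:E)%E.
  by move=> /cvg_limn_einf_sup[-> _].
apply: cvgeM.
- by case: b {b0} => [?||]; rewrite /mule_def.
- exact: cvg_cst.
- by apply: cvg_EFin => //; exact: nearW.
Qed.

(** * Bounds, comparison and existence for one potential *)

Section Estimates.
Context {R : realType} {n : nat}.
Local Notation mu := (@lebesgue_measure R).
Implicit Types (x y z : n.-tuple R).
Variables (p sigma thl thu eps0 a : R) (Psi : n.-tuple R -> R -> R) (lam lb : R -> R).
Hypotheses (n_gt0 : (0 < n)%N) (p0 : 0 < p) (p1 : p < 1) (sg0 : 0 <= sigma).
Hypotheses (thl0 : 0 < thl) (thu0 : 0 < thu) (eps00 : 0 < eps0).
Hypothesis (aH : sigma / (1 - p) <= a).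
Hypotheses (mPsi : tmeas Psi) (Psi0 : tnneg Psi).
Hypothesis PsiL : forall y (t : R), 0 <= t -> 1 <= eunorm y ->
  thl * lam t * eunorm y `^ sigma <= Psi y t.
Hypothesis PsiU : forall y (t : R), 0 <= t -> Psi y t <= thu * lam t * eunorm y `^ sigma.
Hypothesis lam0 : forall t : R, 0 <= t -> 0 < lam t.
Hypothesis lamlb : forall t : R, 0 <= t -> lam t <= lb t.
Hypothesis lb_nd : forall s t : R, 0 <= s -> s <= t -> lb s <= lb t.
(** Near t = 0, [lam] is constant up to a factor [q] as close to 1 as desired, so the sharp lower
    bound with [l] in place of [lam] loses only that factor. *)
Hypothesis lamloc : forall q : R, 1 < q -> exists2 T0 : R, 0 < T0 & exists2 l : R, 0 < l &
  forall t : R, 0 <= t <= T0 -> l <= lam t <= q * l.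
Hypothesis Heps : forall x (d : R), 0 <= d -> d <= sigma * p / (1 - p) ->
  ((eps0 * eunorm x `^ (sigma + d))%:E <=
   Bconv (outside (fun y => eunorm y `^ (sigma + d))%R) x)%E.

Local Notation m := (1 - p)^-1.
Local Notation rho := (sigma / (1 - p)).

Let p1' : 0 < 1 - p. Proof. by rewrite subr_gt0. Qed.
Let m0 : 0 < m. Proof. by rewrite invr_gt0. Qed.
Let mE : m * p + 1 = m. Proof. by field; rewrite gt_eqF. Qed.
Let rho0 : 0 <= rho. Proof. by rewrite divr_ge0// ltW. Qed.
Let rhoE : sigma + rho * p = rho. Proof. by field; rewrite gt_eqF. Qed.
Let a0 : 0 <= a. Proof. exact: le_trans aH. Qed.
Let lb0 t : 0 <= t -> 0 < lb t.
Proof. by move=> t0; rewrite (lt_le_trans (lam0 t0))// lamlb. Qed.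

(** Convolution hypothesis of [lower_iteration] with B = 1: the power q lowers the decay rate to eta
    q, and |y|^sigma >= 1 outside the unit ball. *)
Let outside_exp_step (c eta e q : R) x : 0 < c -> 0 <= eta -> 0 < q -> q <= 1 -> 0 <= e ->
  (forall (h : R) x, 0 <= h <= eta ->
    ((e * expR (- (h * l1 x)))%:E <= Bconv (outside (fun y => expR (- (h * l1 y)))) x)%E) ->
  ((e * ((c * expR (- (eta * l1 x))) `^ q * 1 `^ (1 - q)))%:E <=
    Bconv (outside (fun y => eunorm y `^ sigma *
      ((c * expR (- (eta * l1 y))) `^ q * 1 `^ (p - q)))%R) x)%E.
Proof.
move=> c0 eta0 q0 q1 e0 hB.
have E y : (c * expR (- (eta * l1 y))) `^ q = c `^ q * expR (- (eta * q * l1 y)).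
  rewrite powRM ?(ltW c0) ?expR_ge0// -expRM; congr (_ * expR _); ring.
have h0 : 0 <= eta * q <= eta by rewrite mulr_ge0 ?(ltW q0)//= ler_piMr.
have mG : measurable_fun setT (fun y : n.-tuple R => expR (- (eta * q * l1 y))).
  apply: measurableT_comp => //; apply: measurableT_comp => //.
  by apply: measurable_funM => //; exact: measurable_l1.
apply: (@le_trans _ _ (Bconv (fun y => c `^ q * outside (fun y => expR (- (eta * q * l1 y))) y) x)).
  rewrite BconvZ ?powR_ge0//; [|exact: measurable_outside|by move=> y; apply: outside_ge0 => z; exact: expR_ge0].
  rewrite powR1 mulr1 E mulrCA EFinM lee_wpmul2l ?lee_fin ?powR_ge0//.
  exact: hB.
apply: le_Bconv => y; first by rewrite mulr_ge0 ?powR_ge0// outside_ge0// => z; exact: expR_ge0.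
rewrite /outside; case: ifPn => y1; last by rewrite mulr0.
rewrite powR1 mulr1 E ler_peMl ?mulr_ge0 ?powR_ge0 ?expR_ge0//.
by rewrite -(powRr0 (eunorm y)) ler_powR.
Qed.

(** Convolution hypothesis for A constant and B = |x|^rho. The exponents that occur are sigma + d
    with d = rho (p - q) <= rho p = sigma p / (1 - p), within the range assumed for [eps0]. *)
Let outside_pow_step (C q : R) x : 0 < C -> 0 < q -> q <= p ->
  ((eps0 * (C `^ q * (eunorm x `^ rho) `^ (1 - q)))%:E <=
    Bconv (outside (fun y => eunorm y `^ sigma * (C `^ q * (eunorm y `^ rho) `^ (p - q)))%R) x)%E.
Proof.
move=> C0 q0 qp; pose d := rho * (p - q).
have d0 : 0 <= d by rewrite mulr_ge0// subr_ge0.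
have d1 : d <= sigma * p / (1 - p).
  rewrite (_ : sigma * p / (1 - p) = rho * p); last by ring.
  by rewrite ler_wpM2l// gerBl ltW.
have dE : rho * (1 - q) = sigma + d by rewrite /d -{1}rhoE; field; rewrite gt_eqF.
apply: (@le_trans _ _ (Bconv (fun y => C `^ q * outside (fun y => eunorm y `^ (sigma + d)) y) x)).
  rewrite BconvZ ?powR_ge0//; last 2 first.
  - by apply: measurable_outside; exact: measurable_eunorm_powR.
  - by move=> y; apply: outside_ge0 => z; exact: powR_ge0.
  rewrite mulrCA EFinM lee_wpmul2l ?lee_fin ?powR_ge0// -powRrM dE.
  exact: Heps.
apply: le_Bconv => y; first by rewrite mulr_ge0 ?powR_ge0// outside_ge0// => z; exact: powR_ge0.
rewrite /outside; case: ifPn => y1; last by rewrite mulr0.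
rewrite -powRrM -/d mulrCA powRD//; apply/implyP => _.
by rewrite gt_eqF// (lt_le_trans ltr01).
Qed.

(** Two rounds of iteration: the first, with an uncontrolled constant [e], removes the decay in
    space; the second starts from a constant and attains the sharp factor [eps0]. The waiting time
    [d] then tends to 0. *)
Lemma positive_lower (u : n.-tuple R -> R -> R) (T0 l : R) : dsol p a Psi u -> 0 < l ->
  (forall t : R, 0 <= t <= T0 -> l <= lam t) ->
  (forall s : R, 0 < s -> exists x0, exists2 t0 : R, 0 <= t0 < s & 0 < u x0 t0) ->
  forall x (t : R), 0 <= t <= T0 ->
    (thl * l * eps0 * (1 - p) * t) `^ m * eunorm x `^ rho <= u x t.
Proof.
move=> su l0 hl pos x t /andP[t0 tT]; have [_ u0 _ _] := su.
have r0 : 0 < thl * l * eps0 * (1 - p) by rewrite !mulr_gt0.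
set r := thl * l * eps0 * (1 - p) in r0 *.
rewrite powRM ?(ltW r0)// mulrAC; apply: powR_left_closed => //.
- by rewrite mulr_ge0 ?powR_ge0.
- exact: u0.
move=> d d0 dt.
have d20 : 0 < d / 2 by rewrite divr_gt0.
have d2d : d / 2 < d by lra.
have hP (s : R) : 0 <= s -> forall y v, s <= v <= T0 -> 1 <= eunorm y -> thl * l * eunorm y `^ sigma <= Psi y v.
  move=> s0 y v /andP[sv vT] y1; have v0 : 0 <= v by exact: le_trans sv.
  apply: (le_trans _ (PsiL v0 y1)); rewrite ler_wpM2r ?powR_ge0// ler_wpM2l ?(ltW thl0)//.
  by rewrite hl// v0.
have q01 k : 0 < p ^+ k.+1 /\ p ^+ k.+1 <= p.
  rewrite exprn_gt0//; split=> //; rewrite exprS ler_piMr ?(ltW p0)//.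
  by rewrite exprn_ile1// ltW.
have [x0 [t1 /andP[t10 t1d] ux]] := pos _ d20.
have [c c0 [eta eta0 hc]] := dsol_exp_lower Psi0 su t10 t1d ux.
have [e e0 he] := @Bconv_outside_exp R n eta n_gt0 eta0.
have mexp : measurable_fun setT (fun y : n.-tuple R => c * expR (- (eta * l1 y))).
  apply: measurable_funM => //; apply: measurableT_comp => //; apply: measurableT_comp => //.
  by apply: measurable_funM => //; exact: measurable_l1.
have h1 : forall y (v : R), d / 2 <= v <= T0 ->
    (thl * l * e * (1 - p) * (v - d / 2)) `^ m * 1 <= u y v.
  apply: (@lower_iteration _ _ p a Psi u sigma thl l e (d / 2) T0
    (fun y => c * expR (- (eta * l1 y))) (fun=> 1)) => //.
  - exact: ltW.
  - by move=> y; rewrite mulr_gt0 ?expR_gt0.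
  - by apply: hP; exact: ltW.
  - by move=> y v /andP[dv _]; exact: hc.
  - move=> k y; have [q0 qp] := q01 k.
    by apply: outside_exp_step => //; [exact: (le_trans qp (ltW p1))|exact: ltW].
(* Positive because the second round starts a time d / 2 after the first. *)
pose C0 := (thl * l * e * (1 - p) * (d - d / 2)) `^ m.
have C00 : 0 < C0 by rewrite powR_gt0// !mulr_gt0// subr_gt0.
have h2 : (r * (t - d)) `^ m * eunorm x `^ rho <= u x t.
  apply: (@lower_iteration _ _ p a Psi u sigma thl l eps0 d T0 (fun=> C0) (fun y => eunorm y `^ rho)) => //.
  - exact: ltW.
  - exact: measurable_eunorm_powR.
  - by move=> y; exact: powR_ge0.
  - by apply: hP; exact: ltW.
  - move=> y v /andP[dv vT]; apply: (@le_trans _ _ (u y d)).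
      have := h1 y d; rewrite mulr1; apply.
      by rewrite (ltW d2d) (le_trans dv).
    exact: (dsol_nd y Psi0 su (ltW d0) dv).
  - by move=> k y; have [q0 qp] := q01 k; exact: outside_pow_step.
  - by rewrite (ltW dt).
apply: le_trans h2; rewrite powRM ?(ltW r0) ?subr_ge0 ?(ltW dt)//.
by rewrite le_eqVlt; apply/orP; left; apply/eqP; ring.
Qed.

(** The assumed bound is fed into the equation: the linear term gains 1 / L, the reaction gains 1 /
    m = 1 - p, and |y|^sigma G^p <= G restores the profile. *)
Lemma super_step (v : n.-tuple R -> R -> R) (G : n.-tuple R -> R) (kB D e L Lam t : R) x :
  tnneg v -> measurable_fun setT G -> (forall y, 0 <= G y) ->
  (Bconv G x <= (kB * G x)%:E)%E -> 0 <= kB ->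
  (forall y, eunorm y `^ sigma * G y `^ p <= G y) ->
  0 <= D -> 0 <= e -> 0 < L -> 0 <= t -> (forall s : R, 0 <= s <= t -> lam s <= Lam) ->
  (forall y (s : R), 0 <= s <= t -> v y s <= D * (s + e) `^ m * expR (L * s) * G y) ->
  (duhamel (forcing p Psi v) x t <=
    (kB * (D / L + thu * Lam * D `^ p * (1 - p)) * (t + e) `^ m * expR (L * t) * G x)%:E)%E.
Proof.
move=> v0 mG G0 BG kB0 GG D0 e0 L0 t0 hLam hv.
have Lam0 : 0 <= Lam.
  by apply: le_trans (hLam 0 _); rewrite ?lexx ?t0//; exact/ltW/lam0.
pose c2 := thu * Lam * D `^ p.
have c20 : 0 <= c2 by rewrite !mulr_ge0 ?powR_ge0 ?(ltW thu0).
have mp0 : 0 <= m * p by rewrite mulr_ge0 ?(ltW m0) ?(ltW p0).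
pose k (s : R) := (D * (s + e) `^ m + c2 * (s + e) `^ (m * p)) * expR (L * s).
have k0 (s : R) : 0 <= k s.
  by rewrite mulr_ge0 ?expR_ge0// addr_ge0// mulr_ge0 ?powR_ge0.
have hf y (s : R) : 0 <= s <= t -> forcing p Psi v y s <= k s * G y.
  move=> st; have /andP[s0 _] := st.
  have se0 : 0 <= s + e by rewrite addr_ge0.
  rewrite /forcing /k mulrDl mulrDl lerD//; first exact: hv.
  apply: (@le_trans _ _ ((thu * Lam * eunorm y `^ sigma) * (D * (s + e) `^ m * expR (L * s) * G y) `^ p)).
    apply: ler_pM; rewrite ?powR_ge0 ?Psi0//.
      apply: (le_trans (PsiU y s0)); rewrite ler_wpM2r ?powR_ge0// ler_wpM2l ?(ltW thu0)//.
      exact: hLam.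
    by rewrite ge0_ler_powR ?nnegrE ?(ltW p0) ?v0 ?hv// !mulr_ge0 ?powR_ge0 ?expR_ge0.
  have X1 : 0 <= D * (s + e) `^ m by rewrite mulr_ge0 ?powR_ge0.
  rewrite (@powRM R _ _ p (mulr_ge0 X1 (expR_ge0 (L * s))) (G0 y)).
  rewrite (@powRM R _ _ p X1 (expR_ge0 (L * s))) (@powRM R _ _ p D0 (powR_ge0 _ _)) -powRrM.
  have hexp : expR (L * s) `^ p <= expR (L * s).
    rewrite -expRM ler_expR ler_piMr ?(ltW p1)//; apply: mulr_ge0 => //; exact: ltW.
  have := ler_pM (mulr_ge0 (powR_ge0 (eunorm y) sigma) (powR_ge0 (G y) p)) (powR_ge0 _ p) (GG y) hexp.
  have Y0 : 0 <= c2 * (s + e) `^ (m * p) by rewrite mulr_ge0 ?powR_ge0.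
  move=> /(ler_wpM2l Y0) hh; apply: le_trans (le_trans hh _);
    by rewrite le_eqVlt; apply/orP; left; apply/eqP; rewrite /c2; ring.
apply: (@le_trans _ _ (\int[mu]_(s in `[0%R, t]) ((kB * G x * D * (s + e) `^ m + kB * G x * c2 * (s + e) `^ (m * p)) * expR (L * s))%:E)%E).
  apply: duhamel_le; first exact: tnneg_forcing.
  move=> s st; have /andP[s0 _] := st.
  apply: (@le_trans _ _ (Bconv (fun y => k s * G y) x)).
    apply: le_Bconv => y; last exact: hf.
    exact: (tnneg_forcing p Psi0 v0).
  rewrite BconvZ//; apply: (@le_trans _ _ ((k s)%:E * (kB * G x)%:E)%E).
    by rewrite lee_wpmul2l ?lee_fin.
  rewrite -EFinM lee_fin /k le_eqVlt; apply/orP; left; apply/eqP; ring.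
apply: (le_trans (integral_two_powers_le _ _ _ _ _ _ _)) => //.
- exact: mulr_ge0 (mulr_ge0 kB0 (G0 x)) D0.
- exact: mulr_ge0 (mulr_ge0 kB0 (G0 x)) c20.
- exact: ltW.
rewrite mE lee_fin invrK /c2 le_eqVlt; apply/orP; left; apply/eqP; ring.
Qed.

Lemma wt_sublinear (M : R) y : 1 <= M -> eunorm y `^ sigma * wt M rho y `^ p <= wt M rho y.
Proof.
move=> M1; have -> : wt M rho y `^ p = wt M (rho * p) y by rewrite /wt -powRrM.
rewrite -[X in _ <= wt M X y]rhoE -wt_add//.
by rewrite ler_wpM2r ?powR_ge0// eunorm_powR_le_wt.
Qed.

(** A priori only growth like |x|^a is known, with no rate at t = 0. Adding [e] times the weight of
    degree [a] to the profile, and [e] to the time, makes the least constant finite; absorption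
    bounds it independently of [e], which then tends to 0. *)
Lemma upper_bound (u : n.-tuple R -> R -> R) (M T : R) : dsol p a Psi u -> 1 <= M -> 0 <= T ->
  (forall x, (Bconv (wt M rho) x <= (2 * wt M rho x)%:E)%E) ->
  (forall x, (Bconv (wt M a) x <= (2 * wt M a x)%:E)%E) ->
  exists2 D : R, 0 <= D & forall x (t : R), 0 <= t <= T -> u x t <= D * t `^ m * wt M rho x.
Proof.
move=> su M1 T0 B1 B2; have [mu' u0 uZ E] := su.
have [C C0 hC] := Zinf_bound uZ T0 (fun x => dsol0 x su).
have w0 b y : 0 <= wt M b y by rewrite ltW// wt_gt0.
(* [super_step] with kB = 2 and L = 4 yields the constant D / 2 + B D^p. *)
pose B := 2 * (thu * lb T * (1 - p)).
have B0 : 0 <= B by rewrite !mulr_ge0 ?(ltW thu0) ?(ltW p1') ?(ltW (lb0 T0)).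
pose Ds := (2 * B) `^ m * expR (4 * T).
have Ds0 : 0 <= Ds by rewrite mulr_ge0 ?powR_ge0 ?expR_ge0.
pose de := a - rho.
have de0 : 0 <= de by rewrite subr_ge0.
have key (e : R) x (t : R) : 0 < e -> 0 <= t <= T ->
    u x t <= Ds * (t + e) `^ m * (wt M rho x * (1 + e * wt M de x)).
  move=> e0 tT.
  pose G y := wt M rho y + e * wt M a y.
  have GE y : G y = wt M rho y * (1 + e * wt M de y).
    rewrite mulrDr mulr1 mulrCA wt_add// /de; congr (_ + e * wt M _ y); ring.
  have G0 y : 0 < G y by rewrite ltr_wpDr ?wt_gt0// mulr_ge0// ltW.
  have mG : measurable_fun setT G.
    apply: measurable_funD; first exact: measurable_wt.
    by apply: measurable_funM => //; exact: measurable_wt.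
  have BG y : (Bconv G y <= (2 * G y)%:E)%E.
    rewrite BconvD//; last 3 first.
    - exact: measurable_wt.
    - by apply: measurable_funM => //; exact: measurable_wt.
    - by move=> z; rewrite mulr_ge0// ltW.
    rewrite BconvZ ?(ltW e0)//; last exact: measurable_wt.
    rewrite /G mulrDr EFinD leeD// mulrCA EFinM lee_wpmul2l// lee_fin ltW//.
  have GG y : eunorm y `^ sigma * G y `^ p <= G y.
    rewrite GE; have X1 : 1 <= 1 + e * wt M de y by rewrite lerDl mulr_ge0// ltW.
    have X0 : 0 <= 1 + e * wt M de y by rewrite (le_trans ler01).
    rewrite powRM// mulrA; apply: ler_pM; rewrite ?mulr_ge0 ?powR_ge0//.
      exact: wt_sublinear.
    by rewrite ler1_powR// ltW.
  pose psi (z : n.-tuple R * R) := (z.2 + e) `^ m * expR (4 * z.2) * G z.1.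
  have [D0 [D00 hD0 Dmin]] : exists D0 : R, [/\ 0 <= D0,
      forall z : n.-tuple R * R, 0 <= z.2 <= T -> u z.1 z.2 <= D0 * psi z &
      forall D, 0 <= D -> (forall z : n.-tuple R * R, 0 <= z.2 <= T -> u z.1 z.2 <= D * psi z) -> D0 <= D].
    apply: minimal_bound => [z _|].
      by rewrite !mulr_ge0 ?powR_ge0 ?expR_ge0 ?(ltW (G0 _)).
    have ee0 : 0 < e `^ m by rewrite powR_gt0.
    exists (C / (e `^ m * e)); first by rewrite divr_ge0// mulr_ge0// ltW.
    move=> [y s] /= /andP[s0 sT].
    apply: (le_trans (dsol_nd y Psi0 su s0 sT)); apply: (le_trans (hC y)).
    have h1 : (1 + eunorm y) `^ a <= wt M a y.
      have := eunorm_le_l1 y; have := eunorm_ge0 y; have := l1_ge0 y => k1 k2 k3.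
      rewrite ge0_ler_powR ?nnegrE//; lra.
    have h2 : e * wt M a y <= G y by rewrite lerDr.
    have h3 : e `^ m <= (s + e) `^ m.
      by rewrite ge0_ler_powR ?nnegrE ?(ltW m0) ?addr_ge0 ?lerDr ?(ltW e0).
    have h4 : 1 <= expR (4 * s) by rewrite -[leLHS]expR0 ler_expR mulr_ge0.
    rewrite /psi /= -[leRHS]mulrA ler_wpM2l//.
    rewrite [leRHS]mulrC ler_pdivlMr ?mulr_gt0//.
    apply: (@le_trans _ _ (wt M a y * (e `^ m * e))).
      by rewrite ler_wpM2r// mulr_ge0// ltW.
    rewrite (_ : wt M a y * _ = e `^ m * (e * wt M a y)); last by ring.
    apply: ler_pM => //; rewrite ?(ltW ee0)//; first by rewrite mulr_ge0// ltW.
    rewrite -[leLHS]mulr1; apply: ler_pM => //; exact: ltW.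
  have D0le : D0 <= (2 * B) `^ m.
    apply: self_improve_powR => //; apply: Dmin.
      by apply: addr_ge0; [exact: divr_ge0|exact: mulr_ge0 B0 (powR_ge0 _ _)].
    move=> [y s] /= sT; have /andP[s0 sT'] := sT.
    rewrite -lee_fin E//.
    apply: (le_trans (@super_step u G 2 D0 e 4 (lb T) s y _ _ _ _ _ _ _ _ _ _ _ _)) => //.
    - by move=> z; exact: ltW.
    - exact: ltW.
    - move=> v /andP[v0 vs]; apply: (le_trans (lamlb v0)).
      by apply: lb_nd => //; exact: le_trans sT'.
    - move=> z v /andP[v0 vs]; have := hD0 (z, v); rewrite /psi /= !mulrA; apply.
      by rewrite v0 (le_trans vs).
    rewrite lee_fin /psi /B /= le_eqVlt; apply/orP; left; apply/eqP; by field.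
  have := hD0 (x, t) tT; rewrite /psi /= -GE => /le_trans; apply.
  rewrite mulrA ler_wpM2r ?(ltW (G0 _))// /Ds.
  have /andP[t0 tT'] := tT.
  have h1 : expR (4 * t) <= expR (4 * T) by rewrite ler_expR ler_wpM2l.
  have : D0 * expR (4 * t) <= (2 * B) `^ m * expR (4 * T) by apply: ler_pM; rewrite ?expR_ge0.
  move=> /(ler_wpM2r (powR_ge0 (t + e) m)) hh; apply: le_trans hh.
  by rewrite le_eqVlt; apply/orP; left; apply/eqP; ring.
exists Ds => // x t tT; have /andP[t0 _] := tT.
rewrite mulrAC; apply: powR_right_closed => //; first by rewrite mulr_ge0.
move=> d d0; pose W := wt M de x; have W0 : 0 <= W by exact: w0.
(* e <= 1 gives (t + e)(1 + e W) <= t + e (1 + t W + W) <= t + d; since m >= 1, the factor 1 + e W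
   may be moved under the power. *)
pose e := Num.min 1 (d / (1 + t * W + W)).
have q0 : 0 < 1 + t * W + W by rewrite ltr_wpDr// ltr_wpDr// mulr_ge0.
have e0 : 0 < e by rewrite lt_min ltr01 divr_gt0.
have e1 : e <= 1 by rewrite ge_min lexx.
have eq : e * (1 + t * W + W) <= d by rewrite -ler_pdivlMr// ge_min lexx orbT.
apply: (le_trans (key e x t e0 tT)); rewrite -/W.
have eW : 1 <= 1 + e * W by rewrite lerDl mulr_ge0// ltW.
have te0 : 0 <= t + e by rewrite addr_ge0// ltW.
have m1 : 1 <= m by rewrite -[leLHS]invr1 lef_pV2 ?posrE// gerBl ltW.
have h1 : (t + e) `^ m * (1 + e * W) <= (t + d) `^ m.
  apply: (@le_trans _ _ ((t + e) `^ m * (1 + e * W) `^ m)).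
    by rewrite ler_wpM2l ?powR_ge0// le1r_powR.
  have eW0 : 0 <= 1 + e * W by rewrite (le_trans ler01).
  rewrite -powRM//; apply: ge0_ler_powR; rewrite ?nnegrE ?(ltW m0) ?mulr_ge0//.
    by rewrite addr_ge0// ltW.
  have : e * e * W <= e * W by rewrite ler_wpM2r// ler_piMl// ltW.
  move: eq; rewrite !mulrDr !mulrDl; lra.
have : 0 <= Ds * wt M rho x by rewrite mulr_ge0.
move=> /(ler_wpM2l)/(_ _ _ h1) hh; apply: le_trans hh.
by rewrite le_eqVlt; apply/orP; left; apply/eqP; ring.
Qed.

(* With K bounding the reaction rate p Psi u^(p-1) away from t = 0, where it is
   beta / t, the difference of two solutions contracts in the norm of t^m e^(Lt). *)
Lemma dsol_le (u v : n.-tuple R -> R -> R) : p < eps0 * thl / thu ->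
  dsol p a Psi u -> dsol p a Psi v ->
  (forall s : R, 0 < s -> exists x0, exists2 t0 : R, 0 <= t0 < s & 0 < u x0 t0) ->
  forall x (t : R), 0 <= t -> v x t <= u x t.
Proof.
move=> pH su sv pos x T T_ge0.
have [mu' u0 _ Eu] := su; have [mv v0 _ Ev] := sv.
(* th < 1 is the smallness assumption on p. Existentials keep the constants opaque to the arithmetic
   tactics. *)
have [th thE] : exists th : R, th = p * thu / (thl * eps0) by exists (p * thu / (thl * eps0)).
have te0 : 0 < thl * eps0 by rewrite mulr_gt0.
have th0 : 0 < th by rewrite thE divr_gt0// mulr_gt0.
have th1 : th < 1.
  rewrite thE; by rewrite ltr_pdivrMr// mul1r; move: pH; rewrite ltr_pdivlMr// [eps0 * _]mulrC.
(* A quarter of the gap, so that g = (1 + e)^2 th <= th + 3e < 1; one factor 1 + e pays for the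
   oscillation of [lam] near 0, the other for convolving the weight. *)
have [e eE] : exists e : R, e = (1 - th) / 4 by exists ((1 - th) / 4).
have e0 : 0 < e by rewrite eE divr_gt0// subr_gt0.
have [g gE] : exists g : R, g = (1 + e) * (1 + e) * th by exists ((1 + e) * (1 + e) * th).
have g1 : g < 1.
  rewrite gE.
  have e1 : e <= 1 by lra.
  have : (1 + e) * (1 + e) <= 1 + 3 * e by nra.
  move=> /(ler_wpM2r (ltW th0)) /le_lt_trans; apply.
  have : e * th < e by rewrite gtr_pMr.
  lra.
have g0 : 0 <= g by rewrite gE !mulr_ge0 ?addr_ge0 ?(ltW e0) ?(ltW th0).
have q1 : 1 < 1 + e by rewrite ltrDl.
have [T0 T00 [l l0 hl]] := lamloc q1.
have [r rE] : exists r : R, r = thl * l * eps0 * (1 - p) by exists (thl * l * eps0 * (1 - p)).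
have r0 : 0 < r by rewrite rE !mulr_gt0.
have low : forall x (t : R), 0 <= t <= T0 -> (r * t) `^ m * eunorm x `^ rho <= u x t.
  by rewrite rE; apply: positive_lower => // t /hl /andP[].
have [K KE] : exists K : R, K = p * thu * lb T / (r * T0) by exists (p * thu * lb T / (r * T0)).
have K0 : 0 <= K by rewrite KE divr_ge0 ?mulr_ge0 ?(ltW p0) ?(ltW thu0) ?(ltW (lb0 _)) ?(ltW r0) ?(ltW T00).
have [be beE] : exists be : R, be = th * (1 + e) * m by exists (th * (1 + e) * m).
have be0 : 0 <= be by rewrite beE !mulr_ge0 ?addr_ge0 ?(ltW e0) ?(ltW th0) ?(ltW m0).
(* At y = 0 with sigma > 0 the lower profile vanishes and gives no rate; that point is treated
   separately. *)
have rate y (s : R) : 0 < s -> s <= T -> 0 < eunorm y \/ sigma = 0 ->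
    Psi y s * (p / u y s `^ (1 - p)) <= be / s + K /\ 0 < u y s.
  move=> s0 sT ys.
  have N0 : 0 < eunorm y `^ rho.
    case: ys => [y0|->]; first exact: powR_gt0.
    by rewrite mul0r powRr0.
  (* The sharp lower bound reaches only up to T0; afterwards monotonicity retains its value at T0,
     whence the bounded rate [K]. *)
  pose s' := Num.min s T0.
  have s'0 : 0 < s' by rewrite lt_min s0.
  have lo : (r * s') `^ m * eunorm y `^ rho <= u y s.
    apply: (@le_trans _ _ (u y s')).
      by apply: low; rewrite (ltW s'0) ge_min lexx orbT.
    by apply: (dsol_nd y Psi0 su (ltW s'0)); rewrite ge_min lexx.
  have rs0 : 0 < r * s' by rewrite mulr_gt0.
  have u_gt0 : 0 < u y s by apply: lt_le_trans lo; exact: mulr_gt0 (powR_gt0 _ rs0) N0.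
  split=> //.
  have up0 : 0 < u y s `^ (1 - p) by rewrite powR_gt0.
  have lo' : r * s' * eunorm y `^ sigma <= u y s `^ (1 - p).
    have -> : r * s' * eunorm y `^ sigma = ((r * s') `^ m * eunorm y `^ rho) `^ (1 - p).
      rewrite powRM ?powR_ge0// -!powRrM mulVf ?gt_eqF// powRr1 ?(ltW rs0)//.
      by rewrite divfK ?gt_eqF.
    apply: ge0_ler_powR; rewrite ?nnegrE ?u0 ?(ltW p1') ?(ltW s0)//.
    exact: mulr_ge0 (powR_ge0 _ _) (powR_ge0 _ _).
  have h1 : Psi y s * (p / u y s `^ (1 - p)) <= p * thu * lam s / (r * s').
    have -> : Psi y s * (p / u y s `^ (1 - p)) = p * Psi y s / u y s `^ (1 - p) by ring.
    rewrite ler_pdivrMr//; apply: (@le_trans _ _ (p * thu * lam s / (r * s') * (r * s' * eunorm y `^ sigma))).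
      have -> : p * thu * lam s / (r * s') * (r * s' * eunorm y `^ sigma) = p * (thu * lam s * eunorm y `^ sigma).
        by field; rewrite !gt_eqF.
      by rewrite ler_wpM2l ?(ltW p0)//; apply: PsiU; exact: ltW.
    rewrite ler_wpM2l// divr_ge0 ?mulr_ge0 ?(ltW p0) ?(ltW thu0) ?(ltW (lam0 _)) ?(ltW r0) ?(ltW s'0)//.
    exact: ltW.
  apply: (le_trans h1).
  have bs0 : 0 <= be / s by rewrite divr_ge0// ltW.
  have pt0 : 0 <= p * thu by rewrite mulr_ge0 ?(ltW p0) ?(ltW thu0).
  have [sT0|sT0] := leP s T0.
    have -> : s' = s by rewrite /s' min_l.
    apply: (@le_trans _ _ (be / s)); last by rewrite lerDl.
    rewrite beE thE ler_pdivrMr ?mulr_gt0//.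
    have -> : p * thu / (thl * eps0) * (1 + e) * m / s * (r * s) = p * thu * ((1 + e) * l).
      by rewrite rE; field; rewrite !gt_eqF.
    by rewrite ler_wpM2l//; have /andP[] := hl s ltac:(by rewrite (ltW s0)).
  have -> : s' = T0 by rewrite /s' min_r// ltW.
  apply: (@le_trans _ _ K); last by rewrite lerDr.
  rewrite KE ler_wpM2r ?invr_ge0 ?mulr_ge0 ?(ltW r0) ?(ltW T00)// ler_wpM2l//.
  by apply: (le_trans (lamlb (ltW s0))); apply: lb_nd => //; exact: ltW.
have [M1 M11 hM1] := @Bconv_wt_le R n rho e rho0 e0.
have [M2 M21 hM2] := @Bconv_wt_le R n rho 1 rho0 ltr01.
have [M3 M31 hM3] := @Bconv_wt_le R n a 1 a0 ltr01.
pose M := Num.max M1 (Num.max M2 M3).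
have MM1 : M1 <= M by rewrite le_max lexx.
have MM2 : M2 <= M by rewrite !le_max lexx orbT.
have MM3 : M3 <= M by rewrite !le_max lexx !orbT.
have M_ge1 : 1 <= M by exact: le_trans MM1.
have w0 y : 0 < wt M rho y by rewrite wt_gt0.
have [D1 D10 hD1] : exists2 D : R, 0 <= D & forall x (t : R), 0 <= t <= T -> v x t <= D * t `^ m * wt M rho x.
  by apply: upper_bound => // y; [exact: hM2|exact: hM3].
(* Makes (1 + e)(1 + K) / L = (1 - g) / 2; together with (1 + e) be / m = g the total factor is (1 +
   g) / 2 < 1. *)
have [L LE] : exists L : R, L = 2 * ((1 + e) * (1 + K)) / (1 - g) by exists (2 * ((1 + e) * (1 + K)) / (1 - g)).
have eK0 : 0 < (1 + e) * (1 + K) by rewrite mulr_gt0// ?ltr_wpDr ?(ltW e0).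
have g1' : 0 < 1 - g by rewrite subr_gt0.
have L0 : 0 < L by rewrite LE divr_gt0// mulr_gt0.
pose psi (z : n.-tuple R * R) := z.2 `^ m * expR (L * z.2) * wt M rho z.1.
have [D0 [D00 hD0 Dmin]] : exists D0 : R, [/\ 0 <= D0,
    forall z : n.-tuple R * R, 0 <= z.2 <= T -> v z.1 z.2 - u z.1 z.2 <= D0 * psi z &
    forall D, 0 <= D -> (forall z : n.-tuple R * R, 0 <= z.2 <= T -> v z.1 z.2 - u z.1 z.2 <= D * psi z) -> D0 <= D].
  apply: minimal_bound => [z _|].
    by rewrite !mulr_ge0 ?powR_ge0 ?expR_ge0 ?(ltW (w0 _)).
  exists D1 => // -[y s] /= sT; have /andP[s0 _] := sT.
  apply: (@le_trans _ _ (v y s)); first by rewrite gerBl u0.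
  apply: (le_trans (hD1 y s sT)); rewrite /psi /= mulrA ler_wpM2r ?(ltW (w0 _))//.
  rewrite mulrA ler_peMr ?mulr_ge0 ?powR_ge0//.
  by rewrite -[leLHS]expR0 ler_expR mulr_ge0// ltW.
have mp0 : 0 <= m * p by rewrite mulr_ge0 ?(ltW m0) ?(ltW p0).
have D0le : D0 <= (1 + g) / 2 * D0.
  apply: Dmin; first by rewrite mulr_ge0// divr_ge0// addr_ge0.
  move=> [y t] /= tT; have /andP[t0 tT'] := tT.
  pose k (s : R) := (D0 * (1 + K) * (s + 0) `^ m + D0 * be * (s + 0) `^ (m * p)) * expR (L * s).
  have DK0 : 0 <= D0 * (1 + K) by rewrite mulr_ge0// addr_ge0.
  have Db0 : 0 <= D0 * be by exact: mulr_ge0.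
  have k0 (s : R) : 0 <= k s.
    by rewrite mulr_ge0 ?expR_ge0// addr_ge0// mulr_ge0 ?powR_ge0.
  pose kw (z : n.-tuple R) (s : R) := k s * wt M rho z.
  have mk : measurable_fun [set: R] k.
    apply: measurable_funM; last by apply: measurableT_comp => //; exact: measurable_funM.
    by apply: measurable_funD; apply: measurable_funM => //;
       apply: (measurableT_comp (measurable_powR _)); exact: measurable_funD.
  have mkw : tmeas kw.
    by apply: tmeasM; [exact: tmeas_time|apply: tmeas_space; exact: measurable_wt].
  have kw0 : tnneg kw by move=> z s _; rewrite mulr_ge0// ltW.
  have hf z (s : R) : 0 <= s <= t -> forcing p Psi v z s <= forcing p Psi u z s + kw z s.
    move=> /andP[s0 st]; have sT : s <= T by exact: le_trans st tT'.
    (* The rate be / s says nothing at s = 0, but there both solutions vanish. *)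
    have [->|sn0] := eqVneq s 0.
      by rewrite /forcing !(dsol0 _ su) !(dsol0 _ sv) lerDl kw0.
    have sp : 0 < s by rewrite lt_neqAle eq_sym sn0.
    have ss : s `^ m / s = s `^ (m * p).
      have -> : s `^ m = s `^ (m * p) * s.
        by rewrite -[in LHS]mE powRD ?sn0 ?implybT// powRr1.
      by rewrite mulfK.
    have dz : v z s - u z s <= D0 * (s `^ m * expR (L * s) * wt M rho z).
      by apply: (hD0 (z, s)); rewrite s0.
    have X0 : 0 <= D0 * (s `^ m * expR (L * s) * wt M rho z).
      by rewrite !mulr_ge0 ?powR_ge0 ?expR_ge0 ?(ltW (w0 _)).
    have kwE : kw z s = D0 * (s `^ m * expR (L * s) * wt M rho z) +
        (be / s + K) * (D0 * (s `^ m * expR (L * s) * wt M rho z)).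
      rewrite /kw /k !addr0 -ss; field; rewrite gt_eqF//.
    have bK0 : 0 <= be / s + K by rewrite addr_ge0// divr_ge0.
    rewrite /forcing kwE.
    have hpart : Psi z s * v z s `^ p <= Psi z s * u z s `^ p +
        (be / s + K) * (D0 * (s `^ m * expR (L * s) * wt M rho z)).
      have [vu|uv] := leP (v z s) (u z s).
        apply: ler_wpDr; first exact: mulr_ge0.
        by rewrite ler_wpM2l ?Psi0// ge0_ler_powR ?nnegrE ?v0 ?u0// ltW.
      (* At the origin [Psi] vanishes if sigma is nonzero, so there is no reaction to bound; if
         sigma = 0 the profile is constant and the rate applies. *)
      have [z0|zn0] := eqVneq (eunorm z) 0.
        have [sg|sgn0] := eqVneq sigma 0; last first.
          have : Psi z s <= 0.
            by apply: (le_trans (PsiU z s0)); rewrite z0 powR0// mulr0.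
          move=> P1; have -> : Psi z s = 0 by apply: le_anti; rewrite P1 Psi0.
          by rewrite !mul0r add0r mulr_ge0.
        have [hr u_gt0] := rate z s sp sT (or_intror sg).
        have := powR_tangent p0 p1 u_gt0 (ltW uv); move=> /(ler_wpM2l (Psi0 z s0)) /le_trans; apply.
        rewrite mulrDr lerD2l.
        have -> : Psi z s * (p * (v z s - u z s) / u z s `^ (1 - p)) =
          Psi z s * (p / u z s `^ (1 - p)) * (v z s - u z s) by ring.
        apply: ler_pM => //; last by rewrite subr_ge0 ltW.
        by rewrite mulr_ge0 ?Psi0// divr_ge0 ?powR_ge0// ltW.
      have zp : 0 < eunorm z by rewrite lt_neqAle eq_sym zn0 eunorm_ge0.
      have [hr u_gt0] := rate z s sp sT (or_introl zp).
      have := powR_tangent p0 p1 u_gt0 (ltW uv); move=> /(ler_wpM2l (Psi0 z s0)) /le_trans; apply.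
      rewrite mulrDr lerD2l.
      have -> : Psi z s * (p * (v z s - u z s) / u z s `^ (1 - p)) =
        Psi z s * (p / u z s `^ (1 - p)) * (v z s - u z s) by ring.
      apply: ler_pM => //; last by rewrite subr_ge0 ltW.
      by rewrite mulr_ge0 ?Psi0// divr_ge0 ?powR_ge0// ltW.
    move: dz hpart; lra.
  have mfu := tmeas_forcing p mPsi mu'; have fu0 := tnneg_forcing p Psi0 u0.
  have hduh : (duhamel kw y t <= ((1 + g) / 2 * D0 * psi (y, t))%:E)%E.
    apply: (@le_trans _ _ (\int[mu]_(s in `[0%R, t])
      ((((1 + e) * wt M rho y) * (D0 * (1 + K)) * (s + 0) `^ m +
        ((1 + e) * wt M rho y) * (D0 * be) * (s + 0) `^ (m * p)) * expR (L * s))%:E)%E).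
      apply: duhamel_le => // s /andP[s0 _].
      rewrite /kw BconvZ//; [|exact: measurable_wt|by move=> z; exact: ltW].
      apply: (@le_trans _ _ ((k s)%:E * ((1 + e) * wt M rho y)%:E)%E).
        by rewrite lee_wpmul2l ?lee_fin// hM1.
      rewrite -EFinM lee_fin /k le_eqVlt; apply/orP; left; apply/eqP; ring.
    have ew0 : 0 <= (1 + e) * wt M rho y by rewrite mulr_ge0 ?addr_ge0 ?(ltW e0) ?(ltW (w0 _)).
    apply: (le_trans (integral_two_powers_le (mulr_ge0 ew0 DK0) (mulr_ge0 ew0 Db0) (ltW m0) mp0 (lexx 0) t0 L0)).
    rewrite mE lee_fin addr0 /psi /= le_eqVlt; apply/orP; left; apply/eqP.
    have -> : (1 + g) / 2 = (1 + e) * ((1 + K) / L + be / m).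
      have e1p : 0 < 1 + e by rewrite ltr_wpDr// ltW.
      have K1p : 0 < 1 + K by rewrite ltr_wpDr.
      have g1p : 0 < 1 - (1 + e) * (1 + e) * th by rewrite -gE.
      by rewrite LE beE gE; field; rewrite !gt_eqF.
    by ring.
  have := @le_duhamel _ _ (forcing p Psi v) (fun z s => forcing p Psi u z s + kw z s) y t
    (tnneg_forcing p Psi0 v0) hf.
  rewrite duhamelD// -Ev// -Eu// => /le_trans hv.
  rewrite lerBlDl -lee_fin EFinD; apply: hv.
  by rewrite leeD2l.
have D0E : D0 = 0.
  by apply: le_anti; rewrite D00 andbT; move: D0le; nra.
have := hD0 (x, T); rewrite /= lexx T_ge0 D0E mul0r subr_le0; exact.
Qed.

(** In the limit of the iteration one inequality of the equation is monotonicity and the other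
    Fatou; the bound by [S] gives convergence and, through [duhamel_Zinf], continuity of the
    limit. *)
Lemma dsol_exists : exists2 u, dsol p a Psi u & exists x0, exists2 t0 : R, 0 <= t0 & 0 < u x0 t0.
Proof.
have [M M1 hM] := @Bconv_wt_le R n rho 1 rho0 ltr01.
have BM x : (Bconv (wt M rho) x <= (2 * wt M rho x)%:E)%E by exact: hM.
have w0 y : 0 < wt M rho y by rewrite wt_gt0.
have [T0 T00 [l l0 hl]] := lamloc (ltr1n R 2).
have [r rE] : exists r : R, r = thl * l * eps0 * (1 - p) by exists (thl * l * eps0 * (1 - p)).
have r0 : 0 < r by rewrite rE !mulr_gt0.
(* D^(1-p) = dd: the first summand gives D / 2 + 2 thu (1 - p) D^p <= D, the invariance below [S],
   and the second places [v0] below [S]. *)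
have [dd ddE] : exists dd : R, dd = 4 * thu * (1 - p) + thl * eps0 * (1 - p).
  by exists (4 * thu * (1 - p) + thl * eps0 * (1 - p)).
have dd0 : 0 < dd by rewrite ddE addr_gt0// !mulr_gt0.
have [D DE] : exists D : R, D = dd `^ m by exists (dd `^ m).
have D0 : 0 < D by rewrite DE powR_gt0.
have Ddd : D `^ (1 - p) = dd by rewrite DE -powRrM mulVf ?gt_eqF// powRr1// ltW.
have DD : D / 2 + 2 * (thu * (1 - p) * D `^ p) <= D.
  have : D = D `^ p * dd.
    by rewrite -Ddd -powRD ?(gt_eqF D0) ?implybT// addrC subrK powRr1// ltW.
  have Dp : 0 <= D `^ p by exact: powR_ge0.
  have : D `^ p * (4 * thu * (1 - p)) <= D `^ p * dd.
    by rewrite ler_wpM2l// ddE lerDl ltW// !mulr_gt0.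
  lra.
(* The factor lb^m makes one formula serve all times, because (lb^m)^p lb = lb^m. *)
pose S (y : n.-tuple R) (t : R) : R := D * lb t `^ m * t `^ m * expR (4 * t) * wt M rho y.
pose Inv (w : n.-tuple R -> R -> R) := [/\ tmeas w, tnneg w & forall y (t : R), 0 <= t -> w y t <= S y t].
have Ssmall y (s t : R) : 0 <= s -> s <= t ->
    S y s <= D * lb t `^ m * (s + 0) `^ m * expR (4 * s) * wt M rho y.
  move=> s0 st; rewrite addr0 /S ler_wpM2r ?(ltW (w0 _))// ler_wpM2r ?expR_ge0//.
  rewrite ler_wpM2r ?powR_ge0// ler_wpM2l ?(ltW D0)//.
  apply: ge0_ler_powR; rewrite ?nnegrE ?(ltW m0) ?(ltW (lb0 _)) ?(le_trans s0 st)//.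
  exact: lb_nd.
have bnd w x (t : R) : Inv w -> 0 <= t -> (duhamel (forcing p Psi w) x t <= (S x t)%:E)%E.
  move=> [mw wn wS] t0.
  have lm0 : 0 <= D * lb t `^ m by rewrite mulr_ge0 ?powR_ge0// ltW.
  apply: (le_trans (@super_step w (wt M rho) 2 (D * lb t `^ m) 0 4 (lb t) t x _ _ _ _ _ _ _ _ _ _ _ _)) => //.
  - exact: measurable_wt.
  - by move=> y; exact: ltW.
  - by move=> y; exact: wt_sublinear.
  - by move=> s /andP[s0 st]; apply: (le_trans (lamlb s0)); exact: lb_nd.
  - by move=> y s /andP[s0 st]; apply: (le_trans (wS y s s0)); exact: Ssmall.
  rewrite addr0 lee_fin /S ler_wpM2r ?(ltW (w0 _))// ler_wpM2r ?expR_ge0// ler_wpM2r ?powR_ge0//.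
  have lbt := lb0 t0.
  have -> : (D * lb t `^ m) `^ p = D `^ p * lb t `^ (m * p).
    by rewrite powRM ?powR_ge0 ?(ltW D0)// -powRrM.
  have e1 : lb t `^ m = lb t `^ (m * p) * lb t.
    by rewrite -[in LHS]mE powRD ?(gt_eqF lbt) ?implybT// powRr1// ltW.
  have X0 : 0 <= lb t `^ (m * p) * lb t by rewrite mulr_ge0 ?powR_ge0// ltW.
  have := ler_wpM2r X0 DD; rewrite e1; lra.
have fin w x (t : R) : Inv w -> 0 <= t -> duhamel (forcing p Psi w) x t \is a fin_num.
  move=> Iw t0; have [mw wn wS] := Iw; rewrite ge0_fin_numE.
    by apply: le_lt_trans (bnd w x t Iw t0) _; rewrite ltry.
  by apply: duhamel_ge0; exact: tnneg_forcing.
pose step (w : n.-tuple R -> R -> R) x (t : R) := fine (duhamel (forcing p Psi w) x t).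
have Inv_step w : Inv w -> Inv (step w).
  move=> Iw; have [mw wn wS] := Iw; split.
  - apply: (measurableT_comp (fine_measurable measurableT)).
    by apply: measurable_duhamel; [exact: tmeas_forcing|exact: tnneg_forcing].
  - by move=> y t t0; rewrite /step fine_ge0// duhamel_ge0//; exact: tnneg_forcing.
  - by move=> y t t0; rewrite /step -lee_fin fineK ?fin//; exact: bnd.
(* Frozen after T0, since l <= lam is guaranteed only up to T0; Duhamel integrals keep increasing,
   so it remains a subsolution. *)
pose v0 (y : n.-tuple R) (t : R) := (r * Num.min t T0) `^ m * eunorm y `^ rho.
have minT (t : R) : 0 <= t -> 0 <= Num.min t T0 by move=> t0; rewrite le_min t0 ltW.
have Inv0 : Inv v0.
  split.
  - apply: tmeasM; last by apply: tmeas_space; exact: measurable_eunorm_powR.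
    apply: tmeas_powR; apply: tmeas_time; apply: measurable_funM => //.
    exact: measurable_minr.
  - by move=> y t t0; rewrite mulr_ge0 ?powR_ge0.
  - move=> y t t0; rewrite /v0 /S; apply: ler_pM; rewrite ?powR_ge0//; last exact: eunorm_powR_le_wt.
    apply: (@le_trans _ _ (D * lb t `^ m * t `^ m)); last first.
      rewrite ler_peMr ?mulr_ge0 ?powR_ge0 ?(ltW D0)//.
      by rewrite -[leLHS]expR0 ler_expR mulr_ge0.
    rewrite DE -powRM ?(ltW dd0) ?(ltW (lb0 t0))// -powRM ?mulr_ge0 ?(ltW dd0) ?(ltW (lb0 t0))//.
    apply: ge0_ler_powR; rewrite ?nnegrE ?(ltW m0) ?mulr_ge0 ?(ltW r0) ?(ltW dd0) ?(ltW (lb0 t0)) ?minT//.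
    apply: ler_pM; rewrite ?(ltW r0) ?minT//; last by rewrite ge_min lexx.
    have lle : l <= lb t.
      apply: (@le_trans _ _ (lam 0)); first by have /andP[] := hl 0 ltac:(by rewrite lexx ltW).
      by apply: (le_trans (lamlb (lexx 0))); exact: lb_nd.
    rewrite rE ddE.
    have c0 : 0 <= thl * eps0 * (1 - p) by rewrite !mulr_ge0 ?(ltW thl0) ?(ltW eps00) ?(ltW p1').
    have c1 : 0 <= 4 * thu * (1 - p) * lb t by rewrite !mulr_ge0 ?(ltW thu0) ?(ltW p1') ?(ltW (lb0 t0)).
    have := ler_wpM2l c0 lle; lra.
have sub0 x (t : R) : 0 <= t -> v0 x t <= step v0 x t.
  move=> t0; have [mv vn vS] := Inv0.
  rewrite /step -lee_fin fineK ?fin//.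
  pose s := Num.min t T0; have s0 : 0 <= s by exact: minT.
  have sT : s <= T0 by rewrite ge_min lexx orbT.
  apply: (@le_trans _ _ (duhamel (forcing p Psi v0) x s)); last first.
    by apply: duhamel_nd; [exact: tnneg_forcing|rewrite ge_min lexx].
  have d1 : 0 <= rho * p by rewrite mulr_ge0// ltW.
  have d2 : rho * p <= sigma * p / (1 - p) by rewrite le_eqVlt; apply/orP; left; apply/eqP; ring.
  have mp0 : 0 <= m * p by rewrite mulr_ge0 ?(ltW m0) ?(ltW p0).
  have := @duhamel_outside_ge R n (forcing p Psi v0) (fun y => eunorm y `^ (sigma + rho * p))
    (thl * l * r `^ (m * p)) (m * p) (eps0 * eunorm x `^ (sigma + rho * p)) 0 s x.
  move=> h; apply: (le_trans _ (h _ _ _ _ _ _ _ _ _ _)) => //.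
  - rewrite subr0 mE rhoE lee_fin /v0 -/s powRM ?(ltW r0)//.
    rewrite -[X in r `^ X]mE powRD ?(gt_eqF r0) ?implybT// powRr1 ?(ltW r0)//.
    rewrite [X in _ * X * _ * _ <= _]rE invrK le_eqVlt; apply/orP; left; apply/eqP; ring.
  - exact: tnneg_forcing.
  - exact: measurable_eunorm_powR.
  - by move=> y; exact: powR_ge0.
  - by rewrite !mulr_ge0 ?powR_ge0 ?(ltW thl0) ?(ltW l0).
  - by rewrite mulr_ge0 ?powR_ge0// ltW.
  - move=> y v /andP[v_ge0 vs] y1; rewrite subr0.
    have vT : v <= T0 by exact: le_trans sT.
    have v0E : v0 y v = (r * v) `^ m * eunorm y `^ rho by rewrite /v0 min_l.
    apply: (@le_trans _ _ (Psi y v * v0 y v `^ p)); last by rewrite /forcing lerDr vn.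
    apply: (@le_trans _ _ (thl * l * eunorm y `^ sigma * v0 y v `^ p)); last first.
      rewrite ler_wpM2r ?powR_ge0//; apply: (le_trans _ (PsiL v_ge0 y1)).
      rewrite ler_wpM2r ?powR_ge0// ler_wpM2l ?(ltW thl0)//.
      by have /andP[] := hl v ltac:(by rewrite v_ge0).
    rewrite v0E powRM ?powR_ge0// -!powRrM powRM ?(ltW r0)//.
    rewrite [eunorm y `^ (sigma + _)]powRD; last first.
      by rewrite (gt_eqF (lt_le_trans ltr01 y1)) implybT.
    rewrite le_eqVlt; apply/orP; left; apply/eqP; ring.
  - exact: Heps.
have [U [U0 US]] : exists U : nat -> n.-tuple R -> R -> R,
    U 0%N = v0 /\ forall k, U k.+1 = step (U k) by exists (fun k => iter k step v0).
have InvU k : Inv (U k).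
  by elim: k => [|k IH]; [rewrite U0; exact: Inv0|rewrite US; exact: (Inv_step _ IH)].
have le_step w w' x (t : R) : Inv w -> Inv w' -> (forall y (s : R), 0 <= s -> w y s <= w' y s) ->
    0 <= t -> step w x t <= step w' x t.
  move=> Iw Iw' ww t0; have [_ wn _] := Iw.
  apply: (fine_le (fin w x t Iw t0) (fin w' x t Iw' t0)).
  apply: le_duhamel; first exact: tnneg_forcing.
  by move=> y s /andP[s0 _]; apply: le_forcing; rewrite ?(ltW p0) ?Psi0 ?wn ?ww.
have UndS k : forall x (t : R), 0 <= t -> U k x t <= U k.+1 x t.
  elim: k => [|k IH] x t t0; first by rewrite US U0; exact: sub0.
  rewrite (US k.+1) [U k.+1 in leLHS]US.
  by apply: (le_step _ _ x t (InvU k) (InvU k.+1)).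
have Und x (t : R) : 0 <= t -> nondecreasing_seq (fun k => U k x t).
  by move=> t0; apply/nondecreasing_seqP => k; exact: UndS.
have Ucvg x (t : R) : 0 <= t -> cvgn (fun k => U k x t).
  move=> t0; apply: nondecreasing_is_cvgn; first exact: Und.
  by exists (S x t) => _ [k _ <-]; have [_ _] := InvU k; apply.
pose u x (t : R) := limn (fun k => U k x t).
have Ule k x (t : R) : 0 <= t -> U k x t <= u x t.
  by move=> t0; apply: nondecreasing_cvgn_le; [exact: Und|exact: Ucvg].
have Iu : Inv u.
  split.
  - have h1 k : measurable_fun [set: R * n.-tuple R] (fun w => U k w.2 (Num.max w.1 0)).
      by have [] := InvU k.
    have h2 w : [set: R * n.-tuple R] w ->
        U k w.2 (Num.max w.1 0) @[k --> \oo] --> u w.2 (Num.max w.1 0).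
      by move=> _; apply: Ucvg; exact: max0_ge0.
    exact: (measurable_fun_cvg h1 h2).
  - by move=> y t t0; apply: le_trans (Ule 0%N y t t0); have [_ vn _] := InvU 0%N; exact: vn.
  - move=> y t t0; apply: limr_le; first exact: Ucvg.
    by apply: nearW => k; have [_ _] := InvU k; apply.
have [mu' un uS] := Iu.
have Uforc y (s : R) : 0 <= s -> forcing p Psi (U k) y s @[k --> \oo] --> forcing p Psi u y s.
  move=> s0; apply: cvgD; first exact: Ucvg.
  apply: cvgM; first exact: cvg_cst.
  (* Continuity of the power comes from its derivative at positive points; if the limit is 0, the
     increasing nonnegative sequence is identically 0. *)
  have [us|us] := eqVneq (u y s) 0.
    have Uk0 k : U k y s = 0.
      apply: le_anti; rewrite -{1}us Ule//=; have [_ Un _] := InvU k; exact: Un.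
    rewrite us; under eq_fun do rewrite Uk0; exact: cvg_cst.
  have up : 0 < u y s by rewrite lt_neqAle eq_sym us un.
  apply: (@cvg_comp _ _ _ (fun k => U k y s) (@powR R ^~ p)); first exact: Ucvg.
  have c : {for u y s, continuous (@powR R ^~ p)}.
    apply: differentiable_continuous; apply/derivable1_diffP.
    by apply: derivable_powR; rewrite in_itv/= up.
  exact: c.
have uE x (t : R) : 0 <= t -> (u x t)%:E = duhamel (forcing p Psi u) x t.
  move=> t0; apply/eqP; rewrite eq_le; apply/andP; split.
    rewrite -(fineK (fin u x t Iu t0)) lee_fin; apply: limr_le; first exact: Ucvg.
    apply: nearW => k; apply: (@le_trans _ _ (U k.+1 x t)); first exact: UndS.
    by rewrite US; apply: (le_step _ _ x t (InvU k) Iu) => // y s s0; exact: Ule.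
  apply: (@le_trans _ _ (limn_einf (fun k => duhamel (forcing p Psi (U k)) x t))).
    apply: (fatou_duhamel (f_ := fun k => forcing p Psi (U k)) (x_ := fun=> x)).
    - by move=> k; have [] := InvU k => *; exact: tmeas_forcing.
    - by move=> k; have [] := InvU k => *; exact: tnneg_forcing.
    - exact: tnneg_forcing.
    move=> y s /andP[s0 _].
    apply: limn_einf_mulr_ge; [exact: Bker_ge0| |exact: Uforc].
    by move=> k; have [_ Un _] := InvU k; exact: tnneg_forcing.
  apply: limn_einf_le => k; rewrite -(fineK (fin _ x t (InvU k) t0)) lee_fin.
  by have := Ule k.+1 x t t0; rewrite US.
exists u.
  split=> //.
  have uF x (t : R) : 0 <= t -> u x t = fine (duhamel (forcing p Psi u) x t) by move=> t0; rewrite -uE.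
  apply: (Zinf_ext uF).
  apply: (@duhamel_Zinf _ _ _ a rho M 2) => //.
  - exact: tmeas_forcing.
  - exact: tnneg_forcing.
  move=> T T_ge0.
  pose C := D * lb T `^ m * T `^ m * expR (4 * T).
  have C0 : 0 <= C by rewrite !mulr_ge0 ?powR_ge0 ?expR_ge0 ?(ltW D0).
  have uC y (s : R) : 0 <= s <= T -> u y s <= C * wt M rho y.
    move=> /andP[s0 sT]; apply: (le_trans (uS y s s0)); apply: (le_trans (Ssmall y s T s0 sT)).
    rewrite addr0 /C ler_wpM2r ?(ltW (w0 _))//; apply: ler_pM; rewrite ?mulr_ge0 ?powR_ge0 ?expR_ge0 ?(ltW D0)//.
      rewrite ler_wpM2l ?mulr_ge0 ?powR_ge0 ?(ltW D0)//.
      by apply: ge0_ler_powR; rewrite ?nnegrE ?(ltW m0).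
    by rewrite ler_expR ler_wpM2l.
  exists (C + thu * lb T * C `^ p).
    by rewrite addr_ge0// !mulr_ge0 ?powR_ge0 ?(ltW thu0) ?(ltW (lb0 _)).
  move=> y s sT; have /andP[s0 sT'] := sT.
  rewrite /forcing mulrDl lerD ?uC//.
  apply: (@le_trans _ _ ((thu * lb T * eunorm y `^ sigma) * (C * wt M rho y) `^ p)).
    apply: ler_pM; rewrite ?Psi0 ?powR_ge0//.
      apply: (le_trans (PsiU y s0)); rewrite ler_wpM2r ?powR_ge0// ler_wpM2l ?(ltW thu0)//.
      by apply: (le_trans (lamlb s0)); exact: lb_nd.
    apply: ge0_ler_powR; rewrite ?nnegrE ?(ltW p0) ?un ?uC//.
    exact: mulr_ge0 C0 (ltW (w0 _)).
  rewrite (@powRM R _ _ p C0 (ltW (w0 _))).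
  have Y0 : 0 <= thu * lb T * C `^ p by rewrite !mulr_ge0 ?powR_ge0 ?(ltW thu0) ?(ltW (lb0 _)).
  have := ler_wpM2l Y0 (wt_sublinear y M1); apply: le_trans.
  by rewrite le_eqVlt; apply/orP; left; apply/eqP; ring.
(* A point of positive norm, where [v0] is already positive at time T0. *)
exists (mktuple (fun=> 1)), T0; first exact: ltW.
apply: lt_le_trans (Ule 0%N _ _ (ltW T00)).
rewrite U0 /v0 mulr_gt0// powR_gt0 ?mulr_gt0 ?lt_min ?T00//.
apply: lt_le_trans (tnth_le_eunorm _ (Ordinal n_gt0)).
by rewrite tnth_mktuple normr1.
Qed.

End Estimates.

(** * The weighted space: joint continuity and change of time *)

Lemma Zinf_joint_continuous (R : realType) (n : nat) (a : R) (f : n.-tuple R -> R -> R) :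
  0 <= a -> Zinf a f ->
  forall x (t : R), 0 <= t -> forall e : R, 0 < e -> exists2 d : R, 0 < d &
    forall y (s : R), 0 <= s -> eudist y x < d -> `|s - t| < d -> `|f y s - f x t| < e.
Proof.
move=> a0 [fB fZ] x t t0 e e0.
(* Bounds the weight (1 + |y|)^a on the unit ball around x, so that the weighted continuity in time
   is uniform there. *)
have [A AE] : exists A : R, A = (1 + l1 x + n%:R) `^ a by exists ((1 + l1 x + n%:R) `^ a).
have A0 : 0 <= A by rewrite AE powR_ge0.
have A1 : 0 < A + 1 by rewrite ltr_wpDl.
have e2 : 0 < e / 2 / (A + 1) by rewrite !divr_gt0.
have [d1 d10 h1] := fZ t t0 _ e2.
have [fc _] := fB t t0; have [d2 d20 h2] := fc x (e / 2) (divr_gt0 e0 (ltr0Sn _ 1)).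
exists (Num.min 1 (Num.min d1 d2)); first by rewrite !lt_min ltr01 d10.
move=> y s s0; rewrite !lt_min => /and3P[yx1 yx2 yx3] /and3P[_ sd _].
have yA : (1 + eunorm y) `^ a <= A.
  have h0 := l1_ge0 x; have hn : 0 <= n%:R :> R by [].
  rewrite AE; apply: ge0_ler_powR; rewrite ?nnegrE ?addr_ge0 ?eunorm_ge0//.
  rewrite -addrA lerD2l; apply: (le_trans (eunorm_le_l1 y)).
  apply: (@le_trans _ _ (l1 x + l1 (tsub y x))).
    rewrite /l1 -big_split/=; apply: ler_sum => i _; rewrite tnth_mktuple.
    by rewrite -[in leLHS](subrK (tnth x i) (tnth y i)) addrC ler_normD.
  rewrite lerD2l; apply: (le_trans (l1_le_eunorm _)).
  by rewrite ler_piMr// ltW.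
have k1 := h1 s s0 sd y; have k2 := h2 y yx3.
have k3 : e / 2 / (A + 1) * (1 + eunorm y) `^ a <= e / 2.
  apply: (@le_trans _ _ (e / 2 / (A + 1) * A)); first by rewrite ler_wpM2l// ltW.
  by apply: divD1_mul_le => //; rewrite divr_ge0// ltW.
have := ler_normD (f y s - f y t) (f y t - f x t); rewrite addrA subrK; lra.
Qed.

Lemma Zinf_tmeas (R : realType) (n : nat) (a : R) (f : n.-tuple R -> R -> R) :
  0 <= a -> Zinf a f -> tmeas f.
Proof. by move=> a0 fZ; apply: measurable_joint_continuous; exact: Zinf_joint_continuous fZ. Qed.

(** Meant for the shift t + k and the truncated shift max(t - k, 0), both 1-Lipschitz, with [c]
    equal to e^(-k) and e^k. *)
Lemma Zinf_comp_time (R : realType) (n : nat) (a c : R) (g : R -> R) (f : n.-tuple R -> R -> R) :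
  (forall t : R, 0 <= t -> 0 <= g t) -> (forall s t : R, `|g s - g t| <= `|s - t|) ->
  Zinf a f -> Zinf a (fun x t => c * f x (g t)).
Proof.
move=> g0 gL [fB fZ].
have c1 : 0 < `|c| + 1 by rewrite ltr_wpDl.
split=> [t t0|t t0 e e0].
  have [h1 [C [R0 h2]]] := fB (g t) (g0 t t0); split.
    move=> x e e0; have [d d0 hd] := h1 x (e / (`|c| + 1)) (divr_gt0 e0 c1).
    exists d => // y yd; rewrite -mulrBr normrM.
    apply: (@le_lt_trans _ _ (`|c| * (e / (`|c| + 1)))).
      by rewrite ler_wpM2l// ltW// hd.
    by rewrite mulrA ltr_pdivrMr// mulrC ltr_pM2l// ltrDl.
  exists (`|c| * C), R0 => x xR; rewrite normrM -mulrA ler_wpM2l//; exact: h2.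
have [d d0 hd] := fZ (g t) (g0 t t0) (e / (`|c| + 1)) (divr_gt0 e0 c1).
exists d => // s s0 st x; rewrite -mulrBr normrM.
have h := hd (g s) (g0 s s0) (le_lt_trans (gL s t) st) x.
apply: (@le_trans _ _ (`|c| * (e / (`|c| + 1) * (1 + eunorm x) `^ a))).
  by rewrite ler_wpM2l.
rewrite mulrA ler_wpM2r ?powR_ge0// mulrC; apply: divD1_mul_le => //; exact: ltW.
Qed.

Lemma max0_lipschitz (R : realType) (s t : R) : `|Num.max s 0 - Num.max t 0| <= `|s - t|.
Proof.
have := ler_norm (s - t); have := ler_norm (t - s); rewrite [`|t - s|]distrC => h1 h2.
by rewrite ler_norml; case: (lerP s 0) => hs; case: (lerP t 0) => ht; apply/andP; split; lra.
Qed.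

(** * From s-solutions to the integral equation, and time shifts *)

Section Bridge.
Context {R : realType} {n : nat}.
Local Notation mu := (@lebesgue_measure R).
Implicit Types (x y : n.-tuple R) (f W u : n.-tuple R -> R -> R).

Lemma duhamelZ (k : R) f x (t : R) : 0 <= k -> tmeas f -> tnneg f ->
  (duhamel (fun y s => k * f y s)%R x t = k%:E * duhamel f x t)%E.
Proof.
move=> k0 mf f0; rewrite /duhamel -ge0_integralZl//; last 2 first.
- by apply: measurable_Bconv_time => //; exact: itv0_ge0.
- by move=> s /(itv0_ge0 (lexx 0)) s0; apply: Bconv_ge0 => y; exact: f0.
apply: eq_integral => s; rewrite inE => /(itv0_ge0 (lexx 0)) s0.
by apply: BconvZ => //; [exact: tmeas_slice|move=> y; exact: f0].
Qed.

Lemma duhamel_shift f (k : R) x (t : R) : tmeas f -> tnneg f -> 0 <= k -> 0 <= t ->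
  (forall y (s : R), 0 <= s <= k -> f y s = 0) ->
  duhamel f x (t + k) = duhamel (fun y s => f y (s + k)) x t.
Proof.
move=> mf f0 k0 t0 fk.
have [F FE] : exists F : R -> \bar R, F = fun s => Bconv (f^~ (Num.max s 0)) x.
  by exists (fun s => Bconv (f^~ (Num.max s 0)) x).
have mF : measurable_fun [set: R] F by rewrite FE; exact: measurable_Bconv_max.
have F0 s : (0 <= F s)%E.
  by rewrite FE; apply: Bconv_ge0 => y; apply: f0; exact: max0_ge0.
have Fk (s : R) : 0 <= s <= k -> F s = 0%E.
  move=> sk; have /andP[s0 _] := sk; rewrite FE /= max_l// /Bconv.
  have -> : (fun y => (Bker (tsub x y) * (f y s)%:E)%E) = fun=> 0%E.
    by apply/funext => y; rewrite fk// mule0.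
  exact: intRn0.
transitivity (\int[mu]_(s in `[0%R, (t + k)%R]) F s)%E.
  by apply: eq_integral => s; rewrite inE => /(itv0_ge0 (lexx 0)) s0; rewrite FE max_l.
transitivity (\int[mu]_(s in `[(k + 0)%R, (k + t)%R]) F s)%E.
  rewrite [LHS]integral_mkcond [RHS]integral_mkcond; apply: eq_integral => s _.
  rewrite !patchE; case: ifPn; case: ifPn => //; rewrite !inE/= !in_itv/= addr0 [k + t]addrC.
    move=> h1 /andP[s0 st]; apply: Fk; rewrite s0 leNgt; apply: contra h1 => ks.
    by rewrite inE/= in_itv/= (ltW ks).
  by move=> /andP[ks st] /negP[]; rewrite inE/= in_itv/= st (le_trans k0 ks).
rewrite -integral_shift_itv//; apply: eq_integral => s; rewrite inE => /(itv0_ge0 (lexx 0)) s0.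
by rewrite FE max_l ?addr_ge0// addrC.
Qed.

(** For an s-solution, joint measurability follows from continuity in the weighted space; linearity
    then merges the two integrals. *)
Lemma is_ssolP (p a : R) W u : 0 <= a -> tmeas W -> tnneg W ->
  is_ssol p a W u <->
  dsol p a (fun y t => expR ((1 - p) * t) * W y t) (fun x t => expR t * u x t).
Proof.
move=> a0 mW W0.
have [v vE] : exists v, v = fun x (t : R) => expR t * u x t by exists (fun x (t : R) => expR t * u x t).
have isE : is_ssol p a W u <-> [/\ (forall x (t : R), 0 <= t -> 0 <= u x t), Zinf a v &
    forall x (t : R), 0 <= t -> (v x t)%:E =
    (\int[mu]_(s in `[0%R, t]) Bconv (fun y => v y s) x +
     \int[mu]_(s in `[0%R, t]) ((expR ((1 - p) * s))%:E *
       Bconv (fun y => (W y s * v y s `^ p)%R) x))%E].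
  by rewrite vE; split=> [[? []]|[]].
rewrite isE -vE {isE}.
have Psi0 : tnneg (fun y (t : R) => expR ((1 - p) * t) * W y t).
  by move=> y t t0; rewrite mulr_ge0 ?expR_ge0 ?W0.
have mE : tmeas (fun (_ : n.-tuple R) (t : R) => expR ((1 - p) * t)).
  by apply: tmeas_time; apply: measurableT_comp => //; exact: measurable_funM.
have mPsi : tmeas (fun y (t : R) => expR ((1 - p) * t) * W y t) by exact: tmeasM.
have key (x : n.-tuple R) (t : R) : tmeas v -> tnneg v ->
    (\int[mu]_(s in `[0%R, t]) Bconv (fun y => v y s) x +
     \int[mu]_(s in `[0%R, t]) ((expR ((1 - p) * s))%:E *
       Bconv (fun y => (W y s * v y s `^ p)%R) x))%E =
    duhamel (forcing p (fun y t => expR ((1 - p) * t) * W y t) v) x t.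
  move=> mv v0; have mvp := tmeas_powR p mv.
  rewrite /forcing duhamelD//; last 2 first.
  - exact: tmeasM.
  - by move=> y s s0; rewrite mulr_ge0 ?powR_ge0// Psi0.
  congr (_ + _)%E; apply: eq_integral => s; rewrite inE => /(itv0_ge0 (lexx 0)) s0.
  rewrite -BconvZ ?expR_ge0//.
  - by congr Bconv; apply/funext => y; rewrite mulrA.
  - by apply: measurable_funM; [exact: tmeas_slice|exact: (tmeas_slice (f := fun y t => v y t `^ p))].
  - by move=> y; rewrite mulr_ge0 ?powR_ge0// W0.
have vu x (t : R) : 0 <= v x t = (0 <= u x t) by rewrite vE pmulr_rge0 ?expR_gt0.
split=> [[u0 vZ E]|[mv v0 vZ E]].
  have mv := Zinf_tmeas a0 vZ.
  have v0 : tnneg v by move=> x t t0; rewrite vu u0.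
  by split=> // x t t0; rewrite E// key.
split=> // [x t t0|x t t0]; first by rewrite -vu v0.
by rewrite E// key.
Qed.

(** The homogeneity behind the shift: e^((1-p)(s+k)) (e^k g)^p = e^k e^((1-p)s) g^p, and the linear
    term scales by e^k as well. *)
Lemma duhamel_forcing_shift (p k : R) W (f g : n.-tuple R -> R -> R) x (t : R) :
  0 < p -> 0 <= k -> 0 <= t -> tmeas W -> tnneg W ->
  tmeas f -> tnneg f -> tmeas (fun y s => W y (s + k)) -> tmeas g -> tnneg g ->
  (forall y (s : R), 0 <= s <= k -> f y s = 0) ->
  (forall y (s : R), 0 <= s -> f y (s + k) = expR k * g y s) ->
  (duhamel (forcing p (fun y s => expR ((1 - p) * s) * W y s)%R f) x (t + k) =
   (expR k)%:E * duhamel (forcing p (fun y s => expR ((1 - p) * s) * W y (s + k))%R g) x t)%E.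
Proof.
move=> p0 k0 t0 mW W0 mf f0 mWk mg g0 fk fg.
have mE : tmeas (fun (_ : n.-tuple R) (t : R) => expR ((1 - p) * t)).
  by apply: tmeas_time; apply: measurableT_comp => //; exact: measurable_funM.
rewrite duhamel_shift//; last 3 first.
- by apply: tmeas_forcing => //; exact: tmeasM.
- by apply: tnneg_forcing => // y s s0; rewrite mulr_ge0 ?expR_ge0 ?W0.
- by move=> y s sk; rewrite /forcing fk// powR0 ?gt_eqF// mulr0 addr0.
rewrite -duhamelZ ?expR_ge0//; last 2 first.
- by apply: tmeas_forcing => //; exact: tmeasM.
- by apply: tnneg_forcing => // y s s0; rewrite mulr_ge0 ?expR_ge0 ?W0 ?addr_ge0.
apply: eq_duhamel => y s /andP[s0 _]; rewrite /forcing fg//.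
move: (s : R) s0 => {}s s0.
rewrite powRM ?expR_ge0 ?g0//.
have -> : expR ((1 - p) * (s + k)) = expR ((1 - p) * s) * (expR k / expR k `^ p).
  rewrite -expRM -expRN -!expRD; congr expR; ring.
have h : expR k `^ p != 0 by rewrite gt_eqF ?powR_gt0 ?expR_gt0.
by field.
Qed.

End Bridge.

(** * The time factor of the potential *)

Section TimeWeight.
Context {R : realType}.
Implicit Types (L lam : R -> R).

Lemma within_itv_continuous L : {within `[0%R, +oo[, continuous L} ->
  forall t : R, 0 <= t -> forall e : R, 0 < e -> exists2 d : R, 0 < d &
    forall s : R, 0 <= s -> `|s - t| < d -> `|L s - L t| < e.
Proof.
move=> /subspace_continuousP Lc t t0 e e0.
have tI : `[0%R, +oo[%classic t by rewrite /= in_itv/= t0.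
have /cvgrPdist_lt /(_ e e0) := Lc t tI.
rewrite near_withinE => /nbhs_ballP[d /= d0 hd]; exists d => // s s0 st.
rewrite distrC; apply: hd; first by rewrite /ball/= distrC.
by rewrite /= in_itv/= s0.
Qed.

Lemma continuous_max0 L : {within `[0%R, +oo[, continuous L} ->
  continuous (fun t : R => L (Num.max t 0)).
Proof.
move=> /within_itv_continuous Lc t; apply/cvgrPdist_lt => e e0.
have m0 (s : R) : 0 <= Num.max s 0 by rewrite le_max lexx orbT.
have [d d0 hd] := Lc _ (m0 t) e e0.
apply/nbhs_ballP; exists d => // s /= st; rewrite distrC; apply: hd => //.
move: st; rewrite /ball/= distrC; apply: le_lt_trans.
exact: max0_lipschitz.
Qed.

(** The bounds on the potential are given for t > 0 and used at t = 0 too; signed coefficients cover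
    both of them. *)
Lemma le_at0 (f g : R -> R) (A B : R) :
  (forall e : R, 0 < e -> exists2 d : R, 0 < d & forall s : R, 0 <= s -> `|s - 0| < d -> `|f s - f 0| < e) ->
  (forall e : R, 0 < e -> exists2 d : R, 0 < d & forall s : R, 0 <= s -> `|s - 0| < d -> `|g s - g 0| < e) ->
  (forall t : R, 0 < t -> A * f t + B * g t <= 0) -> A * f 0 + B * g 0 <= 0.
Proof.
move=> fc gc fg; apply/ler_addgt0Pr => e e0; rewrite add0r.
have D0 : 0 < 2 * (`|A| + `|B| + 1) by rewrite mulr_gt0// ltr_wpDl// addr_ge0.
have [d1 d10 h1] := fc _ (divr_gt0 e0 D0).
have [d2 d20 h2] := gc _ (divr_gt0 e0 D0).
have [s s0 /andP[s1 s2]] : exists2 s : R, 0 < s & (s < d1) && (s < d2).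
  exists (Num.min d1 d2 / 2); first by rewrite divr_gt0// lt_min d10.
  rewrite -lt_min ltr_pdivrMr// ltr_pMr ?lt_min ?d10//; lra.
have := h1 s (ltW s0); have := h2 s (ltW s0); rewrite subr0 (gtr0_norm s0) => /(_ s2) k2 /(_ s1) k1.
have := fg s s0.
have b1 : `|A * (f s - f 0)| <= `|A| * (e / (2 * (`|A| + `|B| + 1))) by rewrite normrM ler_wpM2l// ltW.
have b2 : `|B * (g s - g 0)| <= `|B| * (e / (2 * (`|A| + `|B| + 1))) by rewrite normrM ler_wpM2l// ltW.
have b3 : `|A| * (e / (2 * (`|A| + `|B| + 1))) + `|B| * (e / (2 * (`|A| + `|B| + 1))) <= e.
  rewrite -mulrDl mulrA ler_pdivrMr// [e * _]mulrC ler_wpM2r ?(ltW e0)//.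
  have := normr_ge0 A; have := normr_ge0 B; lra.
move: b1 b2; rewrite !ler_norml => /andP[b1 _] /andP[b2 _].
lra.
Qed.

(** The running maximum, finite by the extreme value theorem. *)
Lemma continuous_majorant lam : continuous lam -> exists2 lb : R -> R,
  (forall t : R, 0 <= t -> lam t <= lb t) &
  (forall s t : R, 0 <= s -> s <= t -> lb s <= lb t).
Proof.
move=> lc.
have hs (t : R) : 0 <= t -> has_sup (lam @` `[0%R, t]).
  move=> t0; split; first by exists (lam 0), 0 => //=; rewrite in_itv/= lexx.
  have [c _ hc] := EVT_max t0 (continuous_subspaceT lc).
  by exists (lam c) => _ [s st <-]; exact: hc.
exists (fun t => sup (lam @` `[0%R, t])).
  by move=> t t0; apply: sup_upper_bound; [exact: hs|exists t => //=; rewrite in_itv/= t0 lexx].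
move=> s t s0 st; apply: sup_le; [|exact: (hs s s0).1|exact: hs (le_trans s0 st)].
move=> y [v]; rewrite /= in_itv/= => /andP[v0 vs] <-; apply/downP; exists (lam v) => //.
by exists v => //=; rewrite in_itv/= v0 (le_trans vs).
Qed.

Lemma continuous_flat0 lam : continuous lam -> 0 < lam 0 ->
  forall q : R, 1 < q -> exists2 T0 : R, 0 < T0 & exists2 l : R, 0 < l &
    forall t : R, 0 <= t <= T0 -> l <= lam t <= q * l.
Proof.
move=> lc l0 q q1.
have q10 : 0 < q + 1 by lra.
have e0 : 0 < lam 0 * ((q - 1) / (q + 1)) by rewrite mulr_gt0// divr_gt0// subr_gt0.
have /cvgrPdist_lt /(_ _ e0) /nbhs_ballP[d /= d0 hd] := lc 0.
exists (d / 2); first by rewrite divr_gt0.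
(* With tolerance lam(0) (q - 1) / (q + 1) the extreme values are l = 2 lam(0) / (q + 1) and q l. *)
exists (2 * lam 0 / (q + 1)); first by rewrite divr_gt0// mulr_gt0.
move=> t /andP[t0 td].
have /hd : ball 0 d t by rewrite /ball/= sub0r normrN ger0_norm//; lra.
rewrite ltr_norml => /andP[h1 h2].
have E1 : lam 0 - lam 0 * ((q - 1) / (q + 1)) = 2 * lam 0 / (q + 1) by field; rewrite gt_eqF.
have E2 : lam 0 + lam 0 * ((q - 1) / (q + 1)) = q * (2 * lam 0 / (q + 1)) by field; rewrite gt_eqF.
rewrite -E2 -E1; apply/andP; split; lra.
Qed.

End TimeWeight.

Lemma eudistxx (R : realType) (n : nat) (x : n.-tuple R) : eudist x x = 0.
Proof.
rewrite /eudist /eunorm big1 ?sqrtr0// => i _.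
by rewrite tnth_mktuple subrr expr0n.
Qed.

Lemma pmule_inj (R : realType) (c : R) (u v : \bar R) : 0 < c ->
  (c%:E * u = c%:E * v)%E -> u = v.
Proof.
move=> c0 uv; have h (w : \bar R) : ((c^-1)%:E * (c%:E * w) = w)%E.
  by rewrite muleA -EFinM mulVf ?gt_eqF// mul1e.
by rewrite -(h u) uv h.
Qed.

(** * Nontrivial solutions as delayed maximal solutions *)

Section Characterization.
Context {R : realType} {n : nat}.
Implicit Types (x y : n.-tuple R).
Variables (sigma : R) (Lam : R -> R) (thl thu : R) (V : n.-tuple R -> R -> R) (p eps0 a : R).
Hypotheses (n_gt0 : (0 < n)%N) (sg0 : 0 <= sigma).
Hypotheses (Lam_cont : {within `[0%R, +oo[, continuous Lam}) (Lam0 : forall t : R, 0 <= t -> 0 < Lam t).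
Hypotheses (thl0 : 0 < thl) (thu0 : 0 < thu) (V0 : tnneg V).
Hypothesis V_cont : forall x (t : R), 0 <= t -> forall e : R, 0 < e -> exists2 d : R, 0 < d &
  forall y (s : R), 0 <= s -> eudist y x < d -> `|s - t| < d -> `|V y s - V x t| < e.
Hypothesis VL : forall x (t : R), 1 <= eunorm x -> 0 < t -> thl * Lam t * eunorm x `^ sigma <= V x t.
Hypothesis VU : forall x (t : R), 0 < t -> V x t <= thu * Lam t * eunorm x `^ sigma.
Hypothesis eps00 : 0 < eps0.
Hypothesis Heps : forall x (d : R), 0 <= d -> d <= sigma * p / (1 - p) ->
  ((eps0 * eunorm x `^ (sigma + d))%:E <=
   intRn (fun y => if (1 <= eudist x y)%R
                   then (Bker y * (eudist x y `^ (sigma + d))%:E)%E else 0%E))%E.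
Hypotheses (p0 : 0 < p) (p1 : p < 1) (p_small : p < eps0 * thl / thu).
Hypothesis aH : sigma / (1 - p) <= a.

Local Notation Vs k := (fun y (t : R) => V y (t + k)).
Local Notation Psi k := (fun y (t : R) => expR ((1 - p) * t) * V y (t + k)).

Let a0 : 0 <= a.
Proof. by apply: le_trans aH; rewrite divr_ge0// subr_ge0 ltW. Qed.

Lemma tmeas_potential (k : R) : 0 <= k -> tmeas (Vs k).
Proof.
move=> k0; apply: measurable_joint_continuous => x t t0 e e0.
have [d d0 hd] := V_cont x (addr_ge0 t0 k0) e0; exists d => // y s s0 yx st.
by apply: hd; rewrite ?addr_ge0// opprD addrACA subrr addr0.
Qed.

Lemma tnneg_potential (k : R) : 0 <= k -> tnneg (Vs k).
Proof. by move=> k0 y t t0; rewrite V0// addr_ge0. Qed.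

Lemma potential_cont0 x (e : R) : 0 < e -> exists2 d : R, 0 < d &
  forall s : R, 0 <= s -> `|s - 0| < d -> `|V x s - V x 0| < e.
Proof.
move=> e0; have [d d0 hd] := V_cont x (lexx 0) e0; exists d => // s s0 sd.
by apply: hd => //; rewrite eudistxx.
Qed.

Lemma potential_ge x (t : R) : 0 <= t -> 1 <= eunorm x ->
  thl * Lam t * eunorm x `^ sigma <= V x t.
Proof.
rewrite le_eqVlt => /orP[/eqP <- x1|t0 x1]; last exact: VL.
have := @le_at0 R Lam (V x) (thl * eunorm x `^ sigma) (-1)
  (within_itv_continuous Lam_cont (lexx 0)) (potential_cont0 x).
have h (t' : R) : 0 < t' -> thl * eunorm x `^ sigma * Lam t' + -1 * V x t' <= 0.
  by move=> /(VL x1); lra.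
by move=> /(_ h); lra.
Qed.

Lemma potential_le x (t : R) : 0 <= t -> V x t <= thu * Lam t * eunorm x `^ sigma.
Proof.
rewrite le_eqVlt => /orP[/eqP <-|t0]; last exact: VU.
have := @le_at0 R Lam (V x) (- (thu * eunorm x `^ sigma)) 1
  (within_itv_continuous Lam_cont (lexx 0)) (potential_cont0 x).
have h (t' : R) : 0 < t' -> - (thu * eunorm x `^ sigma) * Lam t' + 1 * V x t' <= 0.
  by move=> /(VU x); lra.
by move=> /(_ h); lra.
Qed.

Let Psi0 (k : R) : 0 <= k -> tnneg (Psi k).
Proof. by move=> k0 y t t0; rewrite mulr_ge0 ?expR_ge0// tnneg_potential. Qed.

Let mPsi (k : R) : 0 <= k -> tmeas (Psi k).
Proof.
move=> k0; apply: tmeasM; last exact: tmeas_potential.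
by apply: tmeas_time; apply: measurableT_comp => //; exact: measurable_funM.
Qed.

(** The exponential in [Psi] is absorbed into the time factor, so all shifted problems have
    two-sided bounds of the same form; the maximum with 0 gives continuity on the whole line. *)
Let lam (k : R) (t : R) : R := Lam (Num.max (t + k) 0) * expR ((1 - p) * t).

Let lam_cont (k : R) : continuous (lam k).
Proof.
move=> t; apply: cvgM.
  apply: (@continuous_comp _ _ _ (fun t : R => t + k) (fun t : R => Lam (Num.max t 0))).
    by apply: cvgD; [exact: cvg_id|exact: cvg_cst].
  exact: continuous_max0.
apply: (@continuous_comp _ _ _ (fun t : R => (1 - p) * t) expR); last exact: continuous_expR.
by apply: cvgM; [exact: cvg_cst|exact: cvg_id].
Qed.

Let lamE (k : R) (t : R) : 0 <= k -> 0 <= t -> lam k t = Lam (t + k) * expR ((1 - p) * t).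
Proof. by move=> k0 t0; rewrite /lam max_l ?addr_ge0. Qed.

Let lam0 (k : R) (t : R) : 0 <= k -> 0 <= t -> 0 < lam k t.
Proof. by move=> k0 t0; rewrite lamE// mulr_gt0 ?expR_gt0// Lam0 ?addr_ge0. Qed.

Let PsiL (k : R) y (t : R) : 0 <= k -> 0 <= t -> 1 <= eunorm y ->
  thl * lam k t * eunorm y `^ sigma <= Psi k y t.
Proof.
move=> k0 t0 y1; rewrite lamE//.
have := ler_wpM2l (expR_ge0 ((1 - p) * t)) (potential_ge (addr_ge0 t0 k0) y1).
by apply: le_trans; rewrite le_eqVlt; apply/orP; left; apply/eqP; ring.
Qed.

Let PsiU (k : R) y (t : R) : 0 <= k -> 0 <= t -> Psi k y t <= thu * lam k t * eunorm y `^ sigma.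
Proof.
move=> k0 t0; rewrite lamE//.
have := ler_wpM2l (expR_ge0 ((1 - p) * t)) (potential_le y (addr_ge0 t0 k0)).
by move/le_trans; apply; rewrite le_eqVlt; apply/orP; left; apply/eqP; ring.
Qed.

Let HepsO x (d : R) : 0 <= d -> d <= sigma * p / (1 - p) ->
  ((eps0 * eunorm x `^ (sigma + d))%:E <=
   Bconv (outside (fun y => eunorm y `^ (sigma + d))%R) x)%E.
Proof. by move=> d0 d1; apply: Bconv_outside_eunorm; exact: Heps. Qed.

Lemma shifted_dsol_le (k : R) u v : 0 <= k -> dsol p a (Psi k) u -> dsol p a (Psi k) v ->
  (forall s : R, 0 < s -> exists x0, exists2 t0 : R, 0 <= t0 < s & 0 < u x0 t0) ->
  forall x (t : R), 0 <= t -> v x t <= u x t.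
Proof.
move=> k0; have [lb lb1 lb2] := continuous_majorant (@lam_cont k).
exact: (@dsol_le R n p sigma thl thu eps0 a (Psi k) (lam k) lb n_gt0 p0 p1 sg0 thl0 thu0 eps00
  aH (@mPsi k k0) (@Psi0 k k0) (fun y t t0 h => @PsiL k y t k0 t0 h) (fun y t t0 => @PsiU k y t k0 t0)
  (fun t t0 => @lam0 k t k0 t0) lb1 lb2 (continuous_flat0 (@lam_cont k) (@lam0 k 0 k0 (lexx 0))) HepsO
  u v p_small).
Qed.

Lemma shifted_dsol_exists (k : R) : 0 <= k ->
  exists2 u, dsol p a (Psi k) u & exists x0, exists2 t0 : R, 0 <= t0 & 0 < u x0 t0.
Proof.
move=> k0; have [lb lb1 lb2] := continuous_majorant (@lam_cont k).
exact: (@dsol_exists R n p sigma thl thu eps0 a (Psi k) (lam k) lb n_gt0 p0 p1 sg0 thl0 thu0 eps00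
  aH (@mPsi k k0) (@Psi0 k k0) (fun y t t0 h => @PsiL k y t k0 t0 h) (fun y t t0 => @PsiU k y t k0 t0)
  (fun t t0 => @lam0 k t k0 t0) lb1 lb2 (continuous_flat0 (@lam_cont k) (@lam0 k 0 k0 (lexx 0))) HepsO).
Qed.

Lemma is_ssol_shiftP (k : R) u : 0 <= k ->
  is_ssol p a (Vs k) u <-> dsol p a (Psi k) (fun x t => expR t * u x t).
Proof. by move=> k0; apply: is_ssolP => //; [exact: tmeas_potential|exact: tnneg_potential]. Qed.

Let mV : tmeas V.
Proof. exact: measurable_joint_continuous V_cont. Qed.

Lemma nontrivial_ssol_is_shift u : is_ssol p a V u -> (exists x t, 0 <= t /\ u x t <> 0) ->
  exists kappa : R, 0 <= kappa /\ exists w : n.-tuple R -> R -> R,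
    is_max_ssol p a (Vs kappa) w /\ forall x (t : R), 0 <= t -> u x t = w x (Num.max (t - kappa) 0).
Proof.
move=> su [x1 [t1 [t10 ux1]]]; have [u0 _] := su.
move/(is_ssolP _ _ a0 mV V0) : su.
have [f fE] : exists f, f = fun x (t : R) => expR t * u x t by exists (fun x (t : R) => expR t * u x t).
rewrite -fE => sf; have [mf f0 fZ Ef] := sf.
have fu x (t : R) : f x t = expR t * u x t by rewrite fE.
have Psi00 : tnneg (fun y (t : R) => expR ((1 - p) * t) * V y t).
  by move=> y t t0; rewrite mulr_ge0 ?expR_ge0 ?V0.
pose S := [set t : R | 0 <= t /\ exists x, 0 < f x t].
have S0 : S !=set0.
  exists t1; split=> //; exists x1; rewrite fu mulr_gt0 ?expR_gt0// lt_neqAle u0// andbT eq_sym.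
  exact/eqP.
have Slb : has_lbound S by exists 0 => s [].
have k0 : 0 <= inf S by apply: lb_le_inf => // s [].
have Sge t : S t -> inf S <= t by exact: ge_inf.
have Sadh (s : R) : 0 < s -> exists2 t, S t & t < inf S + s.
  by move=> s0; apply: inf_adherent.
(* From here on the infimum is used only as a nonnegative number below all times of positivity and
   approached by them. *)
move: (inf S) k0 Sge Sadh => k k0 Sge Sadh.
have fk_lt x (s : R) : 0 <= s -> s < k -> f x s = 0.
  move=> s0 sk; apply/eqP; rewrite eq_le f0// andbT leNgt; apply/negP => fs.
  by have : k <= s by [apply: Sge; split=> //; exists x]; rewrite leNgt sk.
have fk x (s : R) : 0 <= s <= k -> f x s = 0.
  move=> /andP[s0]; rewrite le_eqVlt => /orP[/eqP sk|]; last exact: fk_lt.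
  rewrite sk {s0 s sk}; move: k0; rewrite le_eqVlt => /orP[/eqP <-|kp]; first exact: dsol0 sf.
  (* If f(x, k) were positive, continuity in time with tolerance f(x, k) / 2 would make it positive
     slightly before k. *)
  have [//|fn0] := eqVneq (f x k) 0.
  have fp : 0 < f x k by rewrite lt_neqAle eq_sym fn0 f0// ltW.
  have w0 : 0 < (1 + eunorm x) `^ a by rewrite powR_gt0// ltr_wpDr ?eunorm_ge0.
  have [d d0 hd] := fZ.2 k (ltW kp) _ (divr_gt0 (divr_gt0 fp (ltr0Sn _ 1)) w0).
  pose t := Num.max 0 (k - d / 2).
  have t0 : 0 <= t by rewrite le_max lexx.
  have tk : t < k by rewrite gt_max kp /=; lra.
  have td : `|t - k| < d.
    have : k - d / 2 <= t by rewrite le_max lexx orbT.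
    by rewrite ltr_norml => h; apply/andP; split; lra.
  have := hd t t0 td x; rewrite fk_lt// sub0r normrN ger0_norm ?(ltW fp)//.
  by rewrite divfK ?gt_eqF//; lra.
pose w x (t : R) := u x (t + k).
pose g x (t : R) := expR t * w x t.
have fg y (s : R) : 0 <= s -> f y (s + k) = expR k * g y s.
  by move=> s0; rewrite fu /g /w expRD; ring.
have gf y (s : R) : 0 <= s -> g y s = expR (- k) * f y (s + k).
  by move=> s0; rewrite fg// mulrA -expRD addNr expR0 mul1r.
have gZ : Zinf a g.
  apply: (Zinf_ext gf); apply: (@Zinf_comp_time R n a (expR (- k)) (fun t => t + k) f) => //.
    by move=> t t0; rewrite addr_ge0.
  by move=> s t; rewrite opprD addrACA subrr addr0.
have g0 : tnneg g by move=> y s s0; rewrite gf// mulr_ge0 ?expR_ge0// f0 ?addr_ge0.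
have mg := Zinf_tmeas a0 gZ.
have sg : dsol p a (Psi k) g.
  apply: (And4 mg g0 gZ _) => x t t0.
  have := duhamel_forcing_shift x p0 k0 t0 mV V0 mf f0 (tmeas_potential k0) mg g0 fk fg.
  rewrite -(Ef x _ (addr_ge0 t0 k0)) (fg x t t0) EFinM.
  exact: pmule_inj (expR_gt0 k).
exists k; split; first exact: k0.
exists w; split; last first.
  move=> x t t0; case: (lerP (t - k) 0) => tk; last by rewrite /w subrK.
  have uf (s : R) : f x s = 0 -> u x s = 0.
    by rewrite fu => /eqP; rewrite mulf_eq0 (gt_eqF (expR_gt0 s)) => /eqP.
  by rewrite /w add0r !uf ?fk// ?k0 ?t0//=; lra.
split; first exact/is_ssol_shiftP.
move=> v /(is_ssol_shiftP _ k0) sv x t t0.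
have : expR t * v x t <= g x t.
  (* Times of positivity of [f] come arbitrarily close to k, so [g] is positive somewhere at
     arbitrarily small times. *)
  apply: (shifted_dsol_le k0 sg sv) => // s s0.
  have [r Sr rs] := Sadh s s0; have kr := Sge r Sr; have [r0 [x0 fr]] := Sr.
  exists x0, (r - k); first by apply/andP; split; lra.
  by rewrite gf ?subr_ge0// subrK mulr_gt0 ?expR_gt0.
by rewrite /g ler_pM2l ?expR_gt0.
Qed.

(** The maximal solution is nontrivial because it dominates the one from [shifted_dsol_exists]; the
    equation is checked separately before and after the delay. *)
Lemma shift_is_nontrivial_ssol u (k : R) w : (forall x (t : R), 0 <= t -> 0 <= u x t) -> 0 <= k ->
  is_max_ssol p a (Vs k) w -> (forall x (t : R), 0 <= t -> u x t = w x (Num.max (t - k) 0)) ->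
  is_ssol p a V u /\ exists x t, 0 <= t /\ u x t <> 0.
Proof.
move=> u0 k0 [/(is_ssol_shiftP _ k0) sw wmax] uw.
split; last first.
  have [v sv [x0 [t0 t00 vt0]]] := shifted_dsol_exists k0.
  have sv' : is_ssol p a (Vs k) (fun x t => expR (- t) * v x t).
    apply/(is_ssol_shiftP _ k0).
    have -> : (fun x (t : R) => expR t * (expR (- t) * v x t)) = v; last exact: sv.
    by apply/funext => x; apply/funext => t; rewrite mulrA -expRD subrr expR0 mul1r.
  exists x0, (t0 + k); split; first by rewrite addr_ge0.
  apply/eqP; rewrite gt_eqF// uw ?addr_ge0// addrK max_l//.
  by apply: lt_le_trans (wmax _ sv' x0 t0 t00); rewrite mulr_gt0 ?expR_gt0.
apply/(is_ssolP _ _ a0 mV V0).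
have [f fE] : exists f, f = fun x (t : R) => expR t * u x t by exists (fun x (t : R) => expR t * u x t).
have fu x (t : R) : f x t = expR t * u x t by rewrite fE.
have [g gE] : exists g, g = fun x (t : R) => expR t * w x t by exists (fun x (t : R) => expR t * w x t).
have gw x (t : R) : g x t = expR t * w x t by rewrite gE.
rewrite -fE; rewrite -gE in sw; have [mg g0 gZ Eg] := sw.
have fk x (s : R) : 0 <= s <= k -> f x s = 0.
  move=> /andP[s0 sk]; rewrite fu uw// max_r ?subr_le0//.
  by have := dsol0 x sw; rewrite gw expR0 mul1r => ->; rewrite mulr0.
have fg y (s : R) : 0 <= s -> f y (s + k) = expR k * g y s.
  by move=> s0; rewrite fu gw uw ?addr_ge0// addrK max_l// expRD; ring.
have fmax x (t : R) : 0 <= t -> f x t = expR k * g x (Num.max (t - k) 0).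
  move=> t0; case: (lerP (t - k) 0) => tk.
    by rewrite fk ?(dsol0 x sw) ?mulr0// t0/=; lra.
  by rewrite -{1}(subrK k t) fg// ltW.
have fZ : Zinf a f.
  apply: (Zinf_ext fmax).
  apply: (@Zinf_comp_time R n a (expR k) (fun t => Num.max (t - k) 0) g) => //.
    by move=> t _; exact: max0_ge0.
  by move=> s t; apply: (le_trans (max0_lipschitz _ _)); rewrite opprB addrA subrK.
have f0 : tnneg f by move=> x t t0; rewrite fu mulr_ge0 ?expR_ge0 ?u0.
have mf := Zinf_tmeas a0 fZ.
have E x (t : R) (t0 : 0 <= t) :=
  duhamel_forcing_shift x p0 k0 t0 mV V0 mf f0 (tmeas_potential k0) mg g0 fk fg.
apply: (And4 mf f0 fZ _) => x t t0.
have [kt|tk] := lerP k t.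
  have tk0 : 0 <= t - k by rewrite subr_ge0.
  by have := E x (t - k) tk0; rewrite -(Eg x _ tk0) -EFinM -(fg x _ tk0) subrK.
(* Before the delay both sides vanish, since the Duhamel integral is nondecreasing in time and 0 at
   time k. *)
rewrite fk ?t0 ?(ltW tk)//.
have f0' : tnneg (forcing p (fun y (t : R) => expR ((1 - p) * t) * V y t) f).
  by apply: tnneg_forcing => // y s s0; rewrite mulr_ge0 ?expR_ge0 ?V0.
apply/esym/eqP; rewrite eq_le duhamel_ge0// andbT.
apply: (le_trans (duhamel_nd x f0' (ltW tk))).
by have := E x 0 (lexx 0); rewrite add0r duhamel0 mule0 => ->.
Qed.

End Characterization.

Theorem mainTheorem7 (R : realType) (n : nat) (sigma : R) (Lam : R -> R)
  (thl thu : R) (V : n.-tuple R -> R -> R) (p eps0 a : R) (alpha : R -> R) :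
  (1 <= n)%N ->
  Jplus n sigma ->
  {within `[0%R, +oo[, continuous Lam} ->
  (forall t, 0 <= t -> 0 < Lam t) ->
  0 < thl -> 0 < thu ->
  (* V >= 0, jointly continuous on R^n x [0, oo) *)
  (forall x t, 0 <= t -> 0 <= V x t) ->
  (forall x t, 0 <= t -> forall e : R, 0 < e -> exists2 d : R, 0 < d &
     forall y s, 0 <= s -> eudist y x < d -> `|s - t| < d -> `|V y s - V x t| < e) ->
  (forall x t, 1 <= eunorm x -> 0 < t -> thl * Lam t * eunorm x `^ sigma <= V x t) ->
  (forall x t, 0 < t -> V x t <= thu * Lam t * eunorm x `^ sigma) ->
  0 < eps0 ->
  (forall (x : n.-tuple R) (d : R), 0 <= d -> d <= sigma * p / (1 - p) ->
     ((eps0 * eunorm x `^ (sigma + d))%:E <=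
      intRn (fun y => if (1 <= eudist x y)%R
                      then (Bker y * (eudist x y `^ (sigma + d))%:E)%E
                      else 0%E))%E) ->
  0 < p -> p < 1 -> p < eps0 * thl / thu ->
  sigma / (1 - p) <= a ->
  {within `]0%R, +oo[, continuous alpha} ->
  (forall tau, 0 < tau -> 0 < alpha tau) ->
  alpha @ (0:R)^'+ --> (1:R) ->
  (forall x t tau, 0 < t -> 0 < tau -> alpha tau * V x t <= V x (t + tau)) ->
  forall u : n.-tuple R -> R -> R,
    (forall x t, 0 <= t -> 0 <= u x t) ->
    Zinf a u ->
    ((is_ssol p a V u /\ exists x t, 0 <= t /\ u x t <> 0)
     <->
     exists kappa : R, 0 <= kappa /\
       exists w : n.-tuple R -> R -> R,
         is_max_ssol p a (fun x t => V x (t + kappa)) w /\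
         forall x t, 0 <= t -> u x t = w x (Num.max (t - kappa) 0)).
Proof.
move=> n1 sJ Lc L0 tl tu V0 Vc VL VU e0 He p0 p1 ps aH _ _ _ _ u u0 _.
have sg0 : 0 <= sigma.
  by move: sJ; rewrite /Jplus; case: eqP => // _ [->//|]; exact: le_trans.
split=> [[su nt]|[k [k0 [w [wm uw]]]]].
  exact: (@nontrivial_ssol_is_shift R n sigma Lam thl thu V p eps0 a n1 sg0 Lc L0 tl tu V0 Vc VL VU
    e0 He p0 p1 ps aH u su nt).
exact: (@shift_is_nontrivial_ssol R n sigma Lam thl thu V p eps0 a n1 sg0 Lc L0 tl tu V0 Vc VL VU
  e0 He p0 p1 aH u k w u0 k0 wm uw).
Qed.
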